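(* Let $G$ be an affine algebraic group over $\Bbbk$, let $H\subseteq G$ be an algebraic subgroup, let $G=LG^u$ be a fixed Levi decomposition (a semidirect product of a reductive subgroup $L$ and the unipotent radical $G^u$), let $\phi:G\to G/G^u$ be the quotient homomorphism with $G/G^u$ identified with $L$, and put $K=\phi(H)\subseteq L$. The following conditions are equivalent: (1) the homogeneous $G$-space $G/H$ is affinely closed; (2) the homogeneous $L$-space $L/K$ is affinely closed.
   Context: The base field $\Bbbk$ is algebraically closed of characteristic zero. Groups are not assumed connected. Varieties are reduced but may be reducible. For an affine algebraic group $G$ and an algebraic subgroup $H$, an embedding of the homogeneous space $G/H$, denoted $G/H\hookrightarrow X$, is an algebraic $G$-variety $X$ with a base point $x\in X$ such that the orbit $Gx$ is dense (and open) in $X$ and the stabilizer $G_x$ equals $H$. The embedding is trivial if $Gx=X$, and affine if $X$ is an affine variety. The homogeneous space $G/H$ is called affinely closed if it admits only the trivial affine embedding; that is, $G/H$ is an affine variety and every affine embedding of $G/H$ is trivial. *)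

(* Defs.v *)
(* Mathematical Components with multinomials.

   Affine varieties over an algebraically closed field k are represented by
   their sets of k-points, Zariski closed in some k^n: they are reduced and
   possibly reducible, and their morphisms are the maps on points that are
   restrictions of polynomial maps. *)
From HB Require Import structures.
From mathcomp Require Import all_boot all_order all_algebra.
From mathcomp Require Import mpoly.

Set Implicit Arguments.
Unset Strict Implicit.
Unset Printing Implicit Defensive.

Import GRing.Theory.
Local Open Scope ring_scope.

Definition pset (k : closedFieldType) (n : nat) := 'rV[k]_n -> Prop.

Definition psubset (k : closedFieldType) (n : nat) (A B : pset k n) : Prop :=
  forall x, A x -> B x.

Definition eval_at (k : closedFieldType) (n : nat)
    (p : {mpoly k[n]}) (x : 'rV[k]_n) : k :=
  p.@[fun i => x 0 i].

Definition zariski_closed (k : closedFieldType) (n : nat) (A : pset k n) : Prop :=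
  exists I : {mpoly k[n]} -> Prop,
    forall x, A x <-> (forall p, I p -> eval_at p x = 0).

Definition zariski_connected (k : closedFieldType) (n : nat)
    (A : pset k n) : Prop :=
  (exists x, A x) /\
  forall B C : pset k n, zariski_closed B -> zariski_closed C ->
    (forall x, A x -> B x \/ C x) ->
    (forall x, A x -> ~ (B x /\ C x)) ->
    psubset A B \/ psubset A C.

(* Only the values of f on A matter. *)
Definition regular_map (k : closedFieldType) (n m : nat)
    (A : pset k n) (f : 'rV[k]_n -> 'rV[k]_m) : Prop :=
  exists F : 'I_m -> {mpoly k[n]},
    forall x, A x -> f x = \row_i eval_at (F i) x.

(* A morphism A x B -> k^p, the product sitting in k^(n + m). *)
Definition regular_map2 (k : closedFieldType) (n m p : nat)
    (A : pset k n) (B : pset k m)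
    (f : 'rV[k]_n -> 'rV[k]_m -> 'rV[k]_p) : Prop :=
  regular_map (fun z : 'rV[k]_(n + m) => A (lsubmx z) /\ B (rsubmx z))
              (fun z : 'rV[k]_(n + m) => f (lsubmx z) (rsubmx z)).

(* The operations are kept apart from the carrier so that a group and its
   subgroups share them; they are meaningful only on the carrier. *)
Record group_ops (k : closedFieldType) (n : nat) := GroupOps {
  gmul : 'rV[k]_n -> 'rV[k]_n -> 'rV[k]_n;
  ginv : 'rV[k]_n -> 'rV[k]_n;
  gone : 'rV[k]_n
}.

Record affine_algebraic_group (k : closedFieldType) (n : nat)
    (o : group_ops k n) (G : pset k n) : Prop := AffineAlgebraicGroup {
  aag_closed : zariski_closed G;
  aag_one : G (gone o);
  aag_mul : forall x y, G x -> G y -> G (gmul o x y);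
  aag_inv : forall x, G x -> G (ginv o x);
  aag_mulA : forall x y z, G x -> G y -> G z ->
    gmul o x (gmul o y z) = gmul o (gmul o x y) z;
  aag_mul1g : forall x, G x -> gmul o (gone o) x = x;
  aag_mulg1 : forall x, G x -> gmul o x (gone o) = x;
  aag_mulVg : forall x, G x -> gmul o (ginv o x) x = gone o;
  aag_mulgV : forall x, G x -> gmul o x (ginv o x) = gone o;
  aag_mul_regular : regular_map2 G G (gmul o);
  aag_inv_regular : regular_map G (ginv o)
}.

Record algebraic_subgroup (k : closedFieldType) (n : nat)
    (o : group_ops k n) (G H : pset k n) : Prop := AlgebraicSubgroup {
  asub_sub : psubset H G;
  asub_closed : zariski_closed H;
  asub_one : H (gone o);
  asub_mul : forall x y, H x -> H y -> H (gmul o x y);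
  asub_inv : forall x, H x -> H (ginv o x)
}.

Definition normal_in (k : closedFieldType) (n : nat)
    (o : group_ops k n) (G N : pset k n) : Prop :=
  forall g x, G g -> N x -> N (gmul o (gmul o g x) (ginv o g)).

(* u is unipotent when right translation rho_u, (rho_u f)(x) = f(x u), is a
   locally unipotent operator on k[G]: each f in k[G] is killed by a power of
   rho_u - 1. *)
Definition unipotent_element (k : closedFieldType) (n : nat)
    (o : group_ops k n) (G : pset k n) (u : 'rV[k]_n) : Prop :=
  forall f : {mpoly k[n]}, exists N : nat, forall x, G x ->
    iter N (fun (F : 'rV[k]_n -> k) y => F (gmul o y u) - F y) (eval_at f) x = 0.

Definition unipotent_group (k : closedFieldType) (n : nat)
    (o : group_ops k n) (U : pset k n) : Prop :=
  forall u, U u -> unipotent_element o U u.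

Record connected_normal_unipotent (k : closedFieldType) (n : nat)
    (o : group_ops k n) (G U : pset k n) : Prop := ConnectedNormalUnipotent {
  cnu_subgroup : algebraic_subgroup o G U;
  cnu_connected : zariski_connected U;
  cnu_normal : normal_in o G U;
  cnu_unipotent : unipotent_group o U
}.

Definition is_unipotent_radical (k : closedFieldType) (n : nat)
    (o : group_ops k n) (G U : pset k n) : Prop :=
  connected_normal_unipotent o G U /\
  forall V, connected_normal_unipotent o G V -> psubset V U.

Definition reductive (k : closedFieldType) (n : nat)
    (o : group_ops k n) (G : pset k n) : Prop :=
  is_unipotent_radical o G (fun x => x = gone o).

Record levi_decomposition (k : closedFieldType) (n : nat)
    (o : group_ops k n) (G L Gu : pset k n) : Prop := LeviDecomposition {
  levi_radical : is_unipotent_radical o G Gu;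
  levi_subgroup : algebraic_subgroup o G L;
  levi_reductive : reductive o L;
  levi_product : forall g, G g -> exists l u, [/\ L l, Gu u & g = gmul o l u];
  levi_trivial : forall x, L x -> Gu x -> x = gone o
}.

(* The quotient morphism G -> G/Gu, where G/Gu is identified with L along the
   composite L -> G -> G/Gu: a homomorphism of algebraic groups G -> L with
   kernel Gu which is the identity on L. *)
Record levi_projection (k : closedFieldType) (n : nat)
    (o : group_ops k n) (G L Gu : pset k n)
    (phi : 'rV[k]_n -> 'rV[k]_n) : Prop := LeviProjection {
  lproj_regular : regular_map G phi;
  lproj_codom : forall g, G g -> L (phi g);
  lproj_mul : forall g h, G g -> G h ->
    phi (gmul o g h) = gmul o (phi g) (phi h);
  lproj_ker : forall g, G g -> (phi g = gone o <-> Gu g);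
  lproj_id : forall l, L l -> phi l = l
}.

Definition image_of (k : closedFieldType) (n m : nat)
    (f : 'rV[k]_n -> 'rV[k]_m) (A : pset k n) : pset k m :=
  fun y => exists2 x, A x & y = f x.

Record affine_G_variety (k : closedFieldType) (n m : nat)
    (o : group_ops k n) (G : pset k n) (X : pset k m)
    (act : 'rV[k]_n -> 'rV[k]_m -> 'rV[k]_m) : Prop := AffineGVariety {
  gvar_closed : zariski_closed X;
  gvar_stable : forall g y, G g -> X y -> X (act g y);
  gvar_one : forall y, X y -> act (gone o) y = y;
  gvar_mul : forall g h y, G g -> G h -> X y ->
    act (gmul o g h) y = act g (act h y);
  gvar_regular : regular_map2 G X act
}.

Definition orbit_of (k : closedFieldType) (n m : nat) (G : pset k n)
    (act : 'rV[k]_n -> 'rV[k]_m -> 'rV[k]_m) (x : 'rV[k]_m) : pset k m :=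
  fun y => exists2 g, G g & y = act g x.

(* An affine embedding of G/H. Openness of the orbit in its closure is
   automatic. *)
Record affine_embedding (k : closedFieldType) (n m : nat)
    (o : group_ops k n) (G H : pset k n) (X : pset k m)
    (act : 'rV[k]_n -> 'rV[k]_m -> 'rV[k]_m) (x : 'rV[k]_m) : Prop :=
  AffineEmbedding {
  emb_variety : affine_G_variety o G X act;
  emb_base : X x;
  emb_dense : forall Z : pset k m, zariski_closed Z ->
    psubset (orbit_of G act x) Z -> psubset X Z;
  emb_stab : forall g, G g -> (act g x = x <-> H g)
}.

Definition trivial_embedding (k : closedFieldType) (n m : nat)
    (G : pset k n) (X : pset k m)
    (act : 'rV[k]_n -> 'rV[k]_m -> 'rV[k]_m) (x : 'rV[k]_m) : Prop :=
  psubset X (orbit_of G act x).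

(* G/H is an affine variety: in characteristic 0 the bijective orbit morphism
   from G/H onto an orbit with stabilizer H is an isomorphism, so this says
   that the trivial embedding of G/H is affine. *)
Definition affine_homogeneous_space (k : closedFieldType) (n : nat)
    (o : group_ops k n) (G H : pset k n) : Prop :=
  exists (m : nat) (X : pset k m) (act : 'rV[k]_n -> 'rV[k]_m -> 'rV[k]_m)
         (x : 'rV[k]_m),
    affine_embedding o G H X act x /\ trivial_embedding G X act x.

Definition affinely_closed (k : closedFieldType) (n : nat)
    (o : group_ops k n) (G H : pset k n) : Prop :=
  affine_homogeneous_space o G H /\
  forall (m : nat) (X : pset k m) (act : 'rV[k]_n -> 'rV[k]_m -> 'rV[k]_m)
         (x : 'rV[k]_m),
    affine_embedding o G H X act x -> trivial_embedding G X act x.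

(* Main.v *)
(* The main step: if G/H has an affine embedding and maps onto a non-closed orbit Gy of some
   affine G-variety, then G/H has a nontrivial affine embedding, because functions separating
   the points of G/H, multiplied by translates of a sufficiently divisible function f vanishing
   on a boundary orbit Gz, generate a representation in which 0 is a limit of the orbit of G/H.

   An L-variety is a G-variety through phi, so a nontrivial embedding of L/K provides a
   non-closed orbit onto which G/H maps. Conversely, the functions on an embedding X of G/H that
   vanish on a boundary orbit form a nonzero space stable under Gu, hence contain a Gu-invariant
   by Kolchin's theorem; its L-translates map X to a representation of L where 0 is in the
   closure of a nonzero L-orbit onto which L/K maps.

   That an affine embedding exists for G/H if and only if one exists for L/K is obtained in the
   same way: H is cut out by semi-invariants of some weight chi (Chevalley), and is separated by
   invariants as soon as the weight 1/chi occurs in k[G]; applied to Gu-invariant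
   semi-invariants, this compares H with K. *)
Require Import Defs.
From HB Require Import structures.
From mathcomp Require Import all_boot all_order all_algebra.
From mathcomp Require Import mpoly fingroup perm ring.
From mathcomp Require Import generic_quotient ring_quotient fraction.
From Stdlib Require Import Classical ClassicalEpsilon.

Set Implicit Arguments.
Unset Strict Implicit.
Unset Printing Implicit Defensive.

Import GRing.Theory.
Local Open Scope ring_scope.

(** * Noetherian rings *)

(** Groups may be disconnected, so orbit closures may be reducible and their coordinate rings need
    not be domains. A component through a given point is represented by a prime ideal [(I(Y) : r)];
    multiplication by [r] turns membership back into vanishing on [Y]. The facts usually drawn from
    constructible images and open orbits come from one algebraic lemma, [fibre_product].

    The limit 0 is found without curves or one-parameter subgroups. If it were not a limit, a
    polynomial with value 1 at 0 would vanish on the image of [G]. At a point algebraic over the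
    function field of a component of the orbit closure, this gives [-1 = f x] with [x] in the chart
    [k[Y][v/f]] of the blow-up of the ideal of the translates [v] of [f]. Clearing denominators puts
    [f^(d+1)] into the power [d+2] of that ideal, and the same holds for every translate. As all
    translates vanish at the boundary point, Nakayama's lemma makes [f] vanish on the component.
    Products [v_a v_b] of two translates are used because one [f] absorbs the denominator [h] and
    the other one places the result in the ideal generated by [f]. *)

Record ideal (A : comNzRingType) (J : A -> Prop) : Prop := Ideal {
  ideal0 : J 0;
  idealD : forall x y, J x -> J y -> J (x + y);
  idealM : forall a x, J x -> J (a * x)
}.

Inductive gen_ideal (A : comNzRingType) (P : A -> Prop) : A -> Prop :=
| gen_ideal0 : gen_ideal P 0
| gen_idealD a x y : P x -> gen_ideal P y -> gen_ideal P (a * x + y).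

Section Ideals.
Variable A : comNzRingType.
Implicit Types (J P : A -> Prop).

Lemma idealN J x : ideal J -> J x -> J (- x).
Proof. by move=> hJ Jx; rewrite -mulN1r; apply: idealM. Qed.

Lemma idealB J x y : ideal J -> J x -> J y -> J (x - y).
Proof. by move=> hJ Jx Jy; apply: idealD => //; apply: idealN. Qed.

Lemma ideal_sum J (I : Type) (r : seq I) (P : pred I) (F : I -> A) :
  ideal J -> (forall i, P i -> J (F i)) -> J (\sum_(i <- r | P i) F i).
Proof.
by move=> hJ JF; elim/big_ind: _ => //; [apply: ideal0 | apply: idealD].
Qed.

Lemma gen_ideal_ideal P : ideal (gen_ideal P).
Proof.
split; first by constructor.
  move=> x y; elim=> [|a z t Pz _ IH] hy; first by rewrite add0r.
  by rewrite -addrA; constructor=> //; apply: IH.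
move=> a x; elim=> [|b z t Pz _ IH]; first by rewrite mulr0; constructor.
by rewrite mulrDr mulrA; constructor.
Qed.

Lemma gen_ideal_incl P x : P x -> gen_ideal P x.
Proof. by move=> Px; rewrite -[x]addr0 -{1}[x]mul1r; do 2?constructor. Qed.

Lemma gen_ideal_min P J : ideal J -> (forall x, P x -> J x) ->
  forall x, gen_ideal P x -> J x.
Proof.
move=> hJ PJ x; elim=> [|a z t Pz _ IH]; first exact: ideal0.
by apply: idealD => //; apply: idealM; auto.
Qed.

(** Multiply by the adjugate. For [Q] congruent to the identity modulo another ideal, this is the
    determinant trick of the Nakayama arguments below. *)
Lemma ideal_det J n (Q : 'M[A]_n) (e : 'I_n -> A) : ideal J ->
  (forall i, J (\sum_l Q i l * e l)) -> forall i, J (\det Q * e i).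
Proof.
move=> hJ hQ i.
have -> : \det Q * e i = \sum_j (\adj Q) i j * (\sum_l Q j l * e l).
  transitivity ((\adj Q *m Q *m (\col_l e l)) i 0).
    by rewrite mul_adj_mx mul_scalar_mx !mxE.
  rewrite -mulmxA [LHS]mxE; apply: eq_bigr => j _; congr (_ * _).
  by rewrite [LHS]mxE; apply: eq_bigr => l _; rewrite [X in _ * X]mxE.
by apply: ideal_sum => // j _; apply: idealM.
Qed.

End Ideals.

Lemma ideal_preim (A B : comNzRingType) (f : {rmorphism A -> B})
  (J : B -> Prop) : ideal J -> ideal (fun x => J (f x)).
Proof.
move=> hJ; split; first by rewrite rmorph0; apply: ideal0.
  by move=> x y Jx Jy; rewrite rmorphD; apply: idealD.
by move=> a x Jx; rewrite rmorphM; apply: idealM.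
Qed.

Lemma mpoly_gen_ind (R : comNzRingType) (n : nat) (P : {mpoly R[n]} -> Prop) :
  (forall c, P c%:MP) -> (forall i, P 'X_i) ->
  (forall p q, P p -> P q -> P (p + q)) ->
  (forall p q, P p -> P q -> P (p * q)) -> forall p, P p.
Proof.
move=> PC PX PD PM p; elim/mpolyind: p => [|c m p _ _ IH].
  exact: (PC 0).
have P1 : P 1 by exact: (PC 1).
apply: (PD (c *: 'X_[m]) p) => //; rewrite -mul_mpolyC.
apply: (PM c%:MP 'X_[m]) => //.
rewrite mpolyXE_id; elim/big_rec: _ => [//|i q _ Pq].
apply: (PM ('X_i ^+ m i) q) => //; elim: (m i) => [|l IHl]; first by rewrite expr0.
by rewrite exprS; apply: (PM 'X_i ('X_i ^+ l)).
Qed.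

(** The finite generating set is taken inside [P] itself, which need not be an ideal: this covers
    increasing unions of ideals as well as arbitrary systems of equations. *)
Definition noetherian (A : comNzRingType) :=
  forall P : A -> Prop, exists2 s : seq A,
    (forall x, x \in s -> P x) & (forall x, P x -> gen_ideal (fun y => y \in s) x).

Lemma noetherian_surj (A B : comNzRingType) (f : {rmorphism A -> B}) :
  (forall y, exists x, f x = y) -> noetherian A -> noetherian B.
Proof.
move=> fsurj hA P; have [s sP Ps] := hA (fun x => P (f x)).
exists (map f s); first by move=> y /mapP[x xs ->]; apply: sP.
move=> y; have [x <-] := fsurj y => Px.
apply: (gen_ideal_min (J := fun z => gen_ideal _ (f z))) (Ps x Px).
  by apply: ideal_preim; apply: gen_ideal_ideal.
by move=> u us; apply: gen_ideal_incl; apply: map_f.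
Qed.

Lemma field_noetherian (F : fieldType) : noetherian F.
Proof.
move=> P; case: (classic (exists2 x, P x & x != 0)) => [[x Px x0]|noP].
  exists [:: x]; first by move=> y; rewrite inE => /eqP ->.
  move=> y _; rewrite -[y]addr0 -{1}[y](@divfK _ x) //; constructor; last by constructor.
  exact: mem_head.
exists [::] => // x Px; case: (eqVneq x 0) => [->|x0]; first by constructor.
by case: noP; exists x.
Qed.

Definition coef_ideal (A : comNzRingType) (J : {poly A} -> Prop) (d : nat) (a : A) :=
  exists2 p, J p & (size p <= d.+1)%N /\ p`_d = a.

Lemma gen_ideal_sub (A : comNzRingType) (P Q : A -> Prop) x :
  (forall y, P y -> gen_ideal Q y) -> gen_ideal P x -> gen_ideal Q x.
Proof. by move=> h; apply: gen_ideal_min => //; apply: gen_ideal_ideal. Qed.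

(* Lift generators of the ideal of leading coefficients
   (up to a degree N bounding all of them) and of each coef_ideal J d, d < N. *)
Lemma poly_noetherian (A : comNzRingType) : noetherian A -> noetherian {poly A}.
Proof.
move=> hA.
have ideal_case (J : {poly A} -> Prop) : ideal J -> exists2 s : seq {poly A},
    (forall x, x \in s -> J x) &
    (forall x, J x -> gen_ideal (fun y => y \in s) x).
  move=> hJ.
  have lift (d : nat) : exists2 s : seq {poly A}, (forall p, p \in s -> J p) &
      forall p, J p -> (size p <= d.+1)%N ->
        exists2 q, gen_ideal (fun y => y \in s) q & (size q <= d.+1)%N /\ q`_d = p`_d.
    have [s sJ Js] := hA (coef_ideal J d).
    have [t [tJ st]] : exists t : seq {poly A},
        (forall p, p \in t -> J p /\ (size p <= d.+1)%N) /\
        (forall a, a \in s -> exists2 p, p \in t & p`_d = a).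
      elim: s sJ {Js} => [|a s IH] sJ; first by exists [::].
      have [|t [tJ st]] := IH; first by move=> x xs; apply: sJ; rewrite inE xs orbT.
      have [p Jp [sp pa]] := sJ a (mem_head _ _).
      exists (p :: t); split=> [q|b].
        by rewrite inE => /orP[/eqP ->|/tJ].
      rewrite inE => /orP[/eqP ->|/st[q qt qb]]; first by exists p; rewrite ?mem_head.
      by exists q; rewrite // inE qt orbT.
    exists t => [p /tJ[]//|p Jp sp].
    have /Js : coef_ideal J d p`_d by exists p.
    elim=> [|b x y xs _ [q Jq [sq qy]]].
      by exists 0; [constructor | rewrite size_poly0 coef0].
    have [r rt rx] := st _ xs; have [_ sr] := tJ _ rt.
    exists (b%:P * r + q); first by constructor.
    split; last by rewrite coefD coefCM rx qy.
    rewrite (leq_trans (size_polyD _ _)) // geq_max sq andbT mul_polyC.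
    exact: leq_trans (size_scale_leq _ _) sr.
  have [s sJ Js] := hA (fun a => exists d, coef_ideal J d a).
  have [t [N [tJ st]]] : exists (t : seq {poly A}) (N : nat),
      (forall p, p \in t -> J p /\ (size p <= N.+1)%N) /\
      (forall a, a \in s -> exists2 p, p \in t & p`_N = a).
    elim: s sJ {Js} => [|a s IH] sJ; first by exists [::], 0%N.
    have [|t [N [tJ st]]] := IH; first by move=> x xs; apply: sJ; rewrite inE xs orbT.
    have [d [p Jp [sp pa]]] := sJ a (mem_head _ _).
    have sX (q : {poly A}) i j : (size q <= i.+1)%N -> (size ('X^j * q)%R <= (i + j).+1)%N.
      move=> sq; apply: leq_trans (size_polyMleq _ _) _.
      by rewrite size_polyXn addSn /= addnC -addSn leq_add2r.
    exists ('X^N * p :: [seq 'X^d * q | q <- t]), (N + d)%N; split=> [q|b].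
      rewrite inE => /orP[/eqP ->|/mapP[r /tJ[Jr sr] ->]].
        by split; [apply: idealM | rewrite addnC sX].
      by split; [apply: idealM | apply: sX].
    rewrite inE => /orP[/eqP ->|/st[q qt qb]].
      exists ('X^N * p); first exact: mem_head.
      by rewrite coefXnM ltnNge leq_addr /= addKn.
    exists ('X^d * q); first by rewrite inE (map_f _ qt) orbT.
    by rewrite coefXnM ltnNge leq_addl /= addnK.
  have [u [uJ hu]] : exists u : seq {poly A}, (forall p, p \in u -> J p) /\
      forall d p, (d < N)%N -> J p -> (size p <= d.+1)%N ->
        exists2 q, gen_ideal (fun y => y \in u) q & (size q <= d.+1)%N /\ q`_d = p`_d.
    elim: (N) => [|M [u [uJ hu]]]; first by exists [::]; split.
    have [v vJ hv] := lift M; exists (u ++ v); split.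
      by move=> p; rewrite mem_cat => /orP[/uJ|/vJ].
    move=> d p; rewrite ltnS leq_eqVlt => /orP[/eqP ->|dM] Jp sp.
      have [q Jq hq] := hv p Jp sp; exists q => //.
      by apply: gen_ideal_sub Jq => y yv; apply: gen_ideal_incl; rewrite mem_cat yv orbT.
    have [q Jq hq] := hu d p dM Jp sp; exists q => //.
    by apply: gen_ideal_sub Jq => y yv; apply: gen_ideal_incl; rewrite mem_cat yv.
  exists (t ++ u) => [p|p Jp]; first by rewrite mem_cat => /orP[/tJ[]|/uJ].
  have hg := gen_ideal_ideal (fun y => y \in t ++ u).
  have gJ q : gen_ideal (fun y => y \in t ++ u) q -> J q.
    by apply: gen_ideal_min => // r; rewrite mem_cat => /orP[/tJ[]|/uJ].
  elim: {p}(size p) {-2}p (leqnn (size p)) Jp => [|d IH] p.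
    by rewrite leqn0 size_poly_eq0 => /eqP -> _; constructor.
  move=> sp Jp.
  suff [q gq [sq qd]] : exists2 q, gen_ideal (fun y => y \in t ++ u) q &
      (size q <= d.+1)%N /\ q`_d = p`_d.
    rewrite -[p](subrK q); apply: idealD => //; apply: IH; last by apply: idealB => //; apply: gJ.
    apply/leq_sizeP => j; rewrite leq_eqVlt coefB => /orP[/eqP <-|dj].
      by rewrite qd subrr.
    by rewrite !nth_default ?subr0 //; [apply: leq_trans sq dj | apply: leq_trans sp dj].
  have [dN|Nd] := ltnP d N.
    have [q Jq hq] := hu d p dN Jp sp; exists q => //.
    by apply: gen_ideal_sub Jq => y yv; apply: gen_ideal_incl; rewrite mem_cat yv orbT.
  have /Js : exists e, coef_ideal J e p`_d by exists d, p.
  elim=> [|b x y xs _ [q Jq [sq qy]]].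
    by exists 0; [constructor | rewrite size_poly0 coef0].
  have [r rt rx] := st _ xs; have [_ sr] := tJ _ rt.
  exists ((b%:P * 'X^(d - N)) * r + q).
    by constructor=> //; rewrite mem_cat rt.
  split; last by rewrite coefD -mulrA coefCM coefXnM ltnNge leq_subr /= subKn // rx qy.
  rewrite (leq_trans (size_polyD _ _)) // geq_max sq andbT -mulrA mul_polyC.
  apply: leq_trans (size_scale_leq _ _) _.
  apply: leq_trans (size_polyMleq _ _) _; rewrite size_polyXn /=.
  by rewrite (leq_trans (leq_add (leqnn _) sr)) // addnS subnK.
move=> P; have [s sP Ps] := ideal_case _ (gen_ideal_ideal P).
have [t [tP st]] : exists t : seq {poly A}, (forall p, p \in t -> P p) /\
    (forall a, a \in s -> gen_ideal (fun y => y \in t) a).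
  elim: s sP {Ps} => [|a s IH] sP; first by exists [::].
  have [|t [tP st]] := IH; first by move=> x xs; apply: sP; rewrite inE xs orbT.
  have [v [vP va]] : exists v : seq {poly A}, (forall p, p \in v -> P p) /\
      gen_ideal (fun y => y \in v) a.
    elim: (sP a (mem_head _ _)) => [|b x y Px _ [v [vP vy]]].
      by exists [::]; split=> //; constructor.
    exists (x :: v); split=> [p|]; first by rewrite inE => /orP[/eqP ->|/vP].
    constructor; first exact: mem_head.
    by apply: gen_ideal_sub vy => z zv; apply: gen_ideal_incl; rewrite inE zv orbT.
  exists (v ++ t); split=> [p|b]; first by rewrite mem_cat => /orP[/vP|/tP].
  rewrite inE => /orP[/eqP ->|/st].
    by apply: gen_ideal_sub va => z zv; apply: gen_ideal_incl; rewrite mem_cat zv.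
  by apply: gen_ideal_sub => z zv; apply: gen_ideal_incl; rewrite mem_cat zv orbT.
exists t => // x Px; apply: gen_ideal_sub (Ps x (gen_ideal_incl Px)); exact: st.
Qed.

(** * The Nullstellensatz *)

Lemma choice_fun (S T : Type) (R : S -> T -> Prop) :
  (forall x, exists y, R x y) -> exists f, forall x, R x (f x).
Proof.
move=> h; exists (fun x => proj1_sig (constructive_indefinite_description _ (h x))).
by move=> x; case: (constructive_indefinite_description _ (h x)).
Qed.

(** In the expansion over permutations the identity contributes 1 modulo [M], and any other
    permutation moves an index and so contributes an off-diagonal factor in [M]. Here [M] is an
    ideal of a subring [S] and not of [A]: the lemma is later used with [A] a field, where ideals of
    [A] would be trivial. *)
Lemma det1_sub (A : comNzRingType) (S M : A -> Prop) n (Q : 'M[A]_n) :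
  S 1 -> (forall x y, S x -> S y -> S (x - y)) -> (forall x y, S x -> S y -> S (x * y)) ->
  M 0 -> (forall x y, M x -> M y -> M (x + y)) -> (forall x y, S x -> M y -> M (x * y)) ->
  (forall x, M x -> S x) ->
  (forall i j, M (Q i j - (i == j)%:R)) -> M (\det Q - 1).
Proof.
move=> S1 SB SM M0 MD MM MS hQ.
have S0 : S 0 by rewrite -(subrr 1); apply: (SB).
have SN x : S x -> S (- x) by move=> Sx; rewrite -sub0r; apply: (SB).
have SQ i j : S (Q i j).
  rewrite -[Q i j](subrK (i == j)%:R) -[X in _ + X]opprK; apply: (SB); first by apply: (MS).
  by apply: (SN); case: (i == j).
have Mprod (I : finType) (P : pred I) (i : I) (F : I -> A) :
    P i -> (forall j, S (F j)) -> M (F i) -> M (\prod_(j | P j) F j).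
  move=> Pi SF MF; rewrite (bigD1 i) //= mulrC; apply: (MM) => //.
  by elim/big_rec: _ => // j x _ Sx; apply: (SM).
rewrite /determinant (bigD1 (1%g : 'S_n)) //= odd_perm1 expr0 mul1r addrAC; apply: (MD).
  elim/big_rec: _ => [|i x _ Mx]; first by rewrite subrr.
  rewrite perm1 -[Q i i](subrK 1) mulrDl mul1r -addrA; apply: (MD) => //.
  rewrite mulrC; apply: (MM); last by have := hQ i i; rewrite eqxx.
  by rewrite -[x](subrK 1) -[X in _ + X]opprK; apply: (SB); [apply: (MS) | apply: (SN)].
elim/big_rec: _ => // s x s1 Mx; apply: (MD) => //.
have [i si] : exists i, s i != i.
  apply/existsP; apply: contraNT s1; rewrite negb_exists => /forallP h.
  by apply/eqP/permP => i; rewrite perm1; apply/eqP; have := h i; rewrite negbK.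
apply: (MM); first by case: (odd_perm s); rewrite ?expr0 // expr1; apply: (SN).
by apply: (Mprod _ _ i) => //; have := hQ i (s i); rewrite eq_sym (negbTE si) subr0.
Qed.

Lemma ideal_det1 (A : comNzRingType) (M : A -> Prop) n (Q : 'M[A]_n) :
  ideal M -> (forall i j, M (Q i j - (i == j)%:R)) -> M (\det Q - 1).
Proof.
by move=> hM; apply: (@det1_sub _ (fun=> True)) => //; [apply: ideal0 | apply: idealD |
  move=> x y _; apply: idealM].
Qed.

Section Eval.
Variables (F : comNzRingType) (n : nat) (w : 'I_n -> nat).

(* The change of variables used to make a polynomial monic in its first variable. *)
Let subst (i : 'I_n.+1) : {poly {mpoly F[n]}} :=
  if unlift ord0 i is Some j then ('X_j)%:P + 'X^(w j) else 'X.
Let unsubst (j : 'I_n) : {mpoly F[n.+1]} := 'X_(lift ord0 j) - 'X_ord0 ^+ w j.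

Lemma nagata : exists (f : {rmorphism {mpoly F[n.+1]} -> {poly {mpoly F[n]}}})
  (g : {rmorphism {poly {mpoly F[n]}} -> {mpoly F[n.+1]}}),
  [/\ cancel f g, (forall c, f c%:MP = c%:MP%:P), (forall c, g c%:MP%:P = c%:MP),
   f 'X_ord0 = 'X & forall j, f 'X_(lift ord0 j) = ('X_j)%:P + 'X^(w j)].
Proof.
pose f : {rmorphism {mpoly F[n.+1]} -> {poly {mpoly F[n]}}} :=
  mmap (polyC \o @mpolyC n F) subst.
pose u : {rmorphism {mpoly F[n]} -> {mpoly F[n.+1]}} := mmap (@mpolyC n.+1 F) unsubst.
pose g : {rmorphism {poly {mpoly F[n]}} -> {mpoly F[n.+1]}} :=
  horner_eval ('X_ord0 : {mpoly F[n.+1]}) \o map_poly u.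
have gC p : g p%:P = u p by rewrite /g /= /horner_eval map_polyC hornerC.
have gX : g 'X = 'X_ord0 by rewrite /g /= /horner_eval map_polyX hornerX.
have uC c : u c%:MP = c%:MP by rewrite /u /= mmapC.
have uX j : u 'X_j = unsubst j by rewrite /u /= mmapX mmap1U.
have fC c : f c%:MP = c%:MP%:P by rewrite /f /= mmapC.
have fX i : f 'X_i = subst i by rewrite /f /= mmapX mmap1U.
clearbody f g; exists f, g; split=> //.
- move=> p; elim/mpoly_gen_ind: p => [c|i|p q Hp Hq|p q Hp Hq].
  + by rewrite fC gC uC.
  + rewrite fX /subst; case: unliftP => [j ->|->]; last by rewrite gX.
    by rewrite rmorphD rmorphXn gC gX uX subrK.
  + by rewrite (rmorphD f) (rmorphD g) Hp Hq.
  + by rewrite (rmorphM f) (rmorphM g) Hp Hq.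
- by move=> c; rewrite gC uC.
- by rewrite fX /subst unlift_none.
- by move=> j; rewrite fX /subst liftK.
Qed.

End Eval.

Theorem mpoly_noetherian (F : fieldType) (n : nat) : noetherian {mpoly F[n]}.
Proof.
elim: n => [|n IH].
  apply: (noetherian_surj (f := @mpolyC 0 F)) (@field_noetherian F) => p.
  elim/mpoly_gen_ind: p => [c|[]//|p q [x <-] [y <-]|p q [x <-] [y <-]]; first by exists c.
    by exists (x + y); rewrite rmorphD.
  by exists (x * y); rewrite rmorphM.
have [f [g [fg _ _ _ _]]] := @nagata F n (fun=> 0%N).
apply: (noetherian_surj (f := g)) (poly_noetherian IH) => p.
by exists (f p).
Qed.

Definition fin_codim (F A : comNzRingType) (c : F -> A) (M : A -> Prop) :=
  exists (I : finType) (e : I -> A),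
    forall p, exists a : I -> F, M (p - \sum_i c (a i) * e i).

(** A Nullstellensatz for fields that need not be algebraically closed: a point with coordinates
    algebraic over [F] is replaced by a proper ideal of finite codimension. It will be applied over
    a function field. *)
Definition nullst (F A : comNzRingType) (c : F -> A) :=
  forall J : A -> Prop, ideal J -> ~ J 1 ->
  exists M : A -> Prop, [/\ ideal M, ~ M 1, (forall x, J x -> M x) & fin_codim c M].

Lemma poly_sumX (A : nzRingType) (p : {poly A}) d : (size p <= d)%N ->
  \sum_(l < d) (p`_l)%:P * 'X^l = p.
Proof.
move=> sp; under eq_bigr => l _ do rewrite mul_polyC.
rewrite -(poly_def _ (fun l => p`_l)); apply/polyP => i; rewrite coef_poly.
by case: ltnP => // h; rewrite nth_default // (leq_trans sp h).
Qed.

Section MonicStep.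
Variables (F A : comNzRingType) (c : {rmorphism F -> A}).

Let coefs_in (M : A -> Prop) (p : {poly A}) := forall i, M p`_i.

Let coefs_ideal M : ideal M -> ideal (coefs_in M).
Proof.
move=> hM; split=> [i|p q hp hq i|a p hp i]; rewrite ?coef0 ?coefD.
- exact: ideal0.
- exact: idealD.
- by rewrite coefM; apply: ideal_sum => // j _; apply: idealM.
Qed.

Let monic_div (M : A -> Prop) (P p : {poly A}) : ideal M -> P \is monic -> coefs_in M p ->
  exists q r, [/\ p = q * P + r, (size r < size P)%N & coefs_in M r].
Proof.
move=> hM mP; elim: {p}(size p) {-2}p (leqnn (size p)) => [|d IH] p sp hp.
  exists 0, 0; rewrite mul0r add0r size_poly0 size_poly_gt0 monic_neq0 //.
  by split=> //; [apply/eqP; rewrite -size_poly_eq0 -leqn0 | move=> i; rewrite coef0; apply: ideal0].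
have [lt|le] := ltnP (size p) (size P).
  by exists 0, p; rewrite mul0r add0r.
pose t := (lead_coef p)%:P * 'X^(size p - size P).
have ht : coefs_in M t.
  move=> i; rewrite coefCM coefXn mulrC; apply: idealM => //; exact: hp.
have := IH (p - t * P).
case=> [||q [r [e sr hr]]].
- have [p0|p0] := eqVneq p 0.
    by rewrite p0 size_poly0 leqNgt size_poly_gt0 monic_neq0 in le.
  apply/leq_sizeP => j; rewrite leq_eqVlt coefB mulrAC coefMXn => dj.
  have sP0 : (0 < size P)%N by rewrite size_poly_gt0 monic_neq0.
  have [jp|jp] := ltnP j (size p).
    have ej : j = (size p).-1.
      apply/eqP; rewrite eqn_leq; apply/andP; split; first by rewrite -ltnS prednK // size_poly_gt0.
      rewrite -ltnS prednK ?size_poly_gt0 //; apply: leq_trans sp _.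
      by case/orP: dj => [/eqP ->|/ltnW].
    have le' : (size p - size P <= (size p).-1)%N.
      by rewrite -subn1 leq_sub2l.
    rewrite ej ltnNge le' /= coefCM.
    have -> : ((size p).-1 - (size p - size P))%N = (size P).-1.
      by rewrite -!subn1 subnAC subKn.
    by rewrite -!lead_coefE (monicP mP) mulr1 subrr.
  rewrite nth_default // sub0r ltnNge (leq_trans (leq_subr _ _) jp) /= coefCM.
  rewrite [P`__]nth_default ?mulr0 ?oppr0 //.
  by rewrite -{1}(subKn le) leq_sub2r.
- by apply: (idealB (coefs_ideal hM)) => //; rewrite mulrC; apply: (idealM (coefs_ideal hM)).
exists (t + q), r; split=> //.
by rewrite mulrDl -addrA -e addrC subrK.
Qed.

(** Lying over, since [{poly A}] modulo [P] is finite over [A]. The ideal [M] is [J + M' A[X]] for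
    some [M'] containing the contraction of [J]. If [M] contained 1, division by [P] would write
    each [X^i] below the degree, modulo [J], with coefficients in [M']; the determinant trick then
    gives an element of the contraction that is 1 modulo [M']. *)
Lemma nullst_monic (J : {poly A} -> Prop) (P : {poly A}) : nullst c ->
  ideal J -> ~ J 1 -> P \is monic -> J P ->
  exists M : {poly A} -> Prop,
    [/\ ideal M, ~ M 1, (forall x, J x -> M x) & fin_codim (polyC \o c) M].
Proof.
move=> hc hJ J1 mP JP.
have hJ' := ideal_preim polyC hJ.
have [|M' [hM' M1 JM' [I [e he]]]] := hc _ hJ'; first by rewrite rmorph1.
pose M p := exists2 j, J j & coefs_in M' (p - j).
have hC := coefs_ideal hM'.
have hM : ideal M.
  split.
  - by exists 0; [apply: ideal0 | rewrite subrr; apply: (ideal0 hC)].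
  - move=> p q [j Jj hj] [l Jl hl]; exists (j + l); first exact: idealD.
    by rewrite opprD addrACA; apply: (idealD hC).
  - move=> a p [j Jj hj]; exists (a * j); first exact: idealM.
    by rewrite -mulrBr; apply: (idealM hC).
have JM p : J p -> M p by move=> Jp; exists p => //; rewrite subrr; apply: (ideal0 hC).
have sP : size P = (size P).-1.+1 by rewrite prednK // size_poly_gt0 monic_neq0.
set d := (size P).-1 in sP.
exists M; split=> //.
  case=> j Jj hj; have [d0|d0] := posnP d.
    have e1 : P = (P`_0)%:P by apply: size1_polyC; rewrite sP d0.
    by apply: J1; move: (monicP mP) JP; rewrite e1 lead_coefC => ->.
  have hr (i : 'I_d) : exists r : {poly A}, [/\ J ('X^i - r), (size r <= d)%N & coefs_in M' r].
    have [|q [r [eq sr hr]]] := @monic_div M' P ('X^i * (1 - j)) hM' mP.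
      exact: (idealM hC).
    exists r; split=> //; last by rewrite -ltnS -sP.
    have -> : 'X^i - r = 'X^i * j + q * P.
      have eq' : 'X^i = q * P + r + 'X^i * j by rewrite -eq mulrBr mulr1 subrK.
      by rewrite {1}eq' addrAC addrK addrC.
    by apply: idealD => //; apply: idealM.
  have [r hr'] := choice_fun hr.
  pose Q : 'M[A]_d := \matrix_(i, l) ((i == l)%:R - (r i)`_l).
  have JQ i : J (\sum_l (map_mx polyC Q) i l * 'X^l).
    have [Ji si _] := hr' i.
    suff -> : \sum_l (map_mx polyC Q) i l * 'X^l = 'X^i - r i by [].
    under eq_bigr => l _ do rewrite !mxE rmorphB mulrBl.
    rewrite sumrB (bigD1 i) //= eqxx mul1r big1 ?addr0; last first.
      by move=> l li; rewrite eq_sym (negbTE li) mul0r.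
    by rewrite poly_sumX.
  have := ideal_det hJ JQ (Ordinal d0); rewrite expr0 mulr1 det_map_mx => /JM' hd.
  apply: M1; rewrite -[1](subKr (\det Q)); apply: idealB => //.
  apply: ideal_det1 => // i l; rewrite mxE addrAC subrr sub0r.
  by apply: idealN => //; case: (hr' i).
exists (I * 'I_d)%type, (fun x : I * 'I_d => (e x.1)%:P * 'X^(x.2)) => p.
have [//|//|q [r [eq sr _]]] := @monic_div (fun=> True) P p _ mP.
have [a ha] := choice_fun (fun l : 'I_d => he r`_l).
exists (fun x => a x.2 x.1); exists (q * P); first exact: idealM.
have hr : \sum_(l < d) (r`_l)%:P * 'X^l = r by rewrite poly_sumX // -ltnS -sP.
have hs : \sum_x (polyC \o c) (a x.2 x.1) * ((e x.1)%:P * 'X^(x.2)) =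
    \sum_(l < d) (\sum_i c (a l i) * e i)%:P * 'X^l.
  rewrite -(pair_bigA _ (fun i (l : 'I_d) => (polyC \o c) (a l i) * ((e i)%:P * 'X^l))).
  rewrite exchange_big; apply: eq_bigr => l _; rewrite rmorph_sum mulr_suml.
  by apply: eq_bigr => i _; rewrite rmorphM /= mulrA.
rewrite hs eq.
have -> : q * P + r - \sum_(l < d) (\sum_i c (a l i) * e i)%:P * 'X^l - q * P =
   \sum_(l < d) (r`_l - \sum_i c (a l i) * e i)%:P * 'X^l.
  rewrite -{1}hr addrAC [_ + \sum_(l < d) _]addrC addrK -sumrB.
  by apply: eq_bigr => l _; rewrite polyCB mulrBl.
move=> i; rewrite coef_sum; apply: ideal_sum => // l _.
by rewrite coefCM mulrC; apply: idealM.
Qed.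

End MonicStep.

Lemma nat_digits_inj (e n : nat) (a b : 'I_n -> nat) :
  (forall i, (a i < e)%N) -> (forall i, (b i < e)%N) ->
  (\sum_i a i * e ^ i = \sum_i b i * e ^ i)%N -> a =1 b.
Proof.
elim: n a b => [|n IH] a b ha hb; first by move=> _ [].
rewrite !big_ord_recl /= !expn0 !muln1 => eq.
have e0 : (0 < e)%N by apply: leq_ltn_trans (ha ord0).
have shift (c : 'I_n.+1 -> nat) : (\sum_(i < n) c (lift ord0 i) * e ^ bump 0 i =
    (\sum_(i < n) c (lift ord0 i) * e ^ i) * e)%N.
  by rewrite big_distrl /=; apply: eq_bigr => i _; rewrite /bump /= add1n expnSr mulnA.
rewrite !shift in eq.
have eq0 : a ord0 = b ord0.
  have := congr1 (modn^~ e) eq.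
  by rewrite !(addnC _ (_ * e)%N) !modnMDl !modn_small.
have eqS : a \o lift ord0 =1 b \o lift ord0.
  apply: IH => [i|i|]; [exact: ha | exact: hb |].
  by move/eqP: eq; rewrite eq0 eqn_add2l eqn_pmul2r // => /eqP.
by move=> i; case: (unliftP ord0 i) => [j ->|-> //]; apply: eqS.
Qed.

Section Nullstellensatz.
Variable F : fieldType.

(** As [e] exceeds every exponent in [q], the degree of the image of a monomial in the new variable
    is the number whose digits in base [e] are its exponents. Distinct monomials get distinct
    degrees, so the leading coefficient is a nonzero constant. *)
Lemma nagata_monic n (q : {mpoly F[n.+1]}) (w : 'I_n -> nat)
    (e := (msize q).+1) (f : {rmorphism {mpoly F[n.+1]} -> {poly {mpoly F[n]}}}) :
  q != 0 -> (forall j : 'I_n, w j = e ^ j.+1)%N ->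
  (forall c, f c%:MP = c%:MP%:P) -> f 'X_ord0 = 'X ->
  (forall j, f 'X_(lift ord0 j) = ('X_j)%:P + 'X^(w j)) ->
  exists2 c : F, c != 0 & c%:MP%:P * f q \is monic.
Proof.
move=> q0 hw fC f0 fS.
pose wt (m : 'X_{1..n.+1}) := (\sum_i m i * e ^ i)%N.
have mon i k : f ('X_i ^+ k) \is monic /\ size (f ('X_i ^+ k)) = (k * e ^ i).+1.
  have [mi si] : f 'X_i \is monic /\ size (f 'X_i) = (e ^ i).+1.
    case: (unliftP ord0 i) => [j ->|->]; last first.
      by rewrite f0 monicX size_polyX expn0.
    rewrite fS lift0 hw.
    have s1 : (size ('X_j : {mpoly F[n]})%:P%R < size ('X^(e ^ j.+1) : {poly {mpoly F[n]}}))%N.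
      by rewrite size_polyXn ltnS (leq_trans (size_polyC_leq1 _)) // expn_gt0.
    by rewrite addrC monicE lead_coefDl // lead_coefXn eqxx size_polyDl // size_polyXn.
  rewrite rmorphXn; elim: k => [|k [mk sk]]; first by rewrite expr0 monic1 size_poly1.
  rewrite exprS monicMl // size_monicM ?monic_neq0 // si sk mulSn.
  by split=> //; rewrite addSn addnS /=.
have monX m : f 'X_[m] \is monic /\ size (f 'X_[m]) = (wt m).+1.
  rewrite mpolyXE_id rmorph_prod /wt.
  elim/big_rec2: _ => [|i p k _ [mk sk]]; first by rewrite monic1 size_poly1.
  have [mi si] := mon i (m i); rewrite monicMl // size_monicM ?monic_neq0 // si sk.
  by split=> //; rewrite addSn addnS.
have wt_inj : {in msupp q &, injective wt}.
  move=> m m' hm hm' eqm; apply/mnmP.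
  have small (m1 : 'X_{1..n.+1}) i : m1 \in msupp q -> (m1 i < e)%N.
    move/msize_mdeg_lt => h; rewrite /e ltnS (leq_trans _ (ltnW h)) // mdegE.
    by rewrite (bigD1 i) //= leq_addr.
  by apply: nat_digits_inj eqm => i; apply: small.
have [m hm hmax] : exists2 m, m \in msupp q & forall m', m' \in msupp q -> (wt m' <= wt m)%N.
  have : msupp q != [::] by rewrite msupp_eq0.
  elim: (msupp q) => // m s IH _; case: (eqVneq s [::]) => [->|s0].
    by exists m; rewrite ?mem_head // => m'; rewrite inE => /eqP ->.
  have [m1 hm1 h1] := IH s0; have [le|lt] := leqP (wt m) (wt m1).
    exists m1; first by rewrite inE hm1 orbT.
    by move=> m'; rewrite inE => /orP[/eqP ->|/h1].
  exists m; first exact: mem_head.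
  move=> m'; rewrite inE => /orP[/eqP -> //|/h1 h]; exact: leq_trans h (ltnW lt).
have cm : q@_m != 0 by rewrite -mcoeff_msupp.
exists (q@_m)^-1; first by rewrite invr_eq0.
rewrite [X in f X]mpolyE rmorph_sum mulr_sumr (bigD1_seq m) ?msupp_uniq //=.
have fZ c p : f (c *: p) = c%:MP%:P * f p by rewrite -mul_mpolyC rmorphM fC.
rewrite fZ mulrA -!rmorphM /= mulVf // !rmorph1 mul1r.
have [mm sm] := monX m.
rewrite monicE lead_coefDl ?(monicP mm) // sm ltnS.
apply: leq_trans (size_sum _ _ _) _.
apply/bigmax_leqP_seq => m' hm' nm.
have [mm' sm'] := monX m'.
have lt : (wt m' < wt m)%N.
  rewrite ltn_neqAle hmax // andbT; apply/eqP => /(wt_inj _ _ hm' hm) h.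
  by move: nm; rewrite h ?eqxx.
rewrite fZ mulrA -polyCM mul_polyC.
by apply: leq_trans (size_scale_leq _ _) _; rewrite sm'.
Qed.

(** Induction on the number of variables. A nonzero element of [J] becomes monic after the change of
    variables; the zero ideal lies in the kernel of evaluation at the origin. *)
Theorem mpoly_nullst n : nullst (@mpolyC n F).
Proof.
elim: n => [|n IH] J hJ J1.
  have nz (p : {mpoly F[0]}) : exists c, p = c%:MP.
    elim/mpoly_gen_ind: p => [c|[]//|p q [x ->] [y ->]|p q [x ->] [y ->]]; first by exists c.
      by exists (x + y); rewrite rmorphD.
    by exists (x * y); rewrite rmorphM.
  exists J; split=> //; exists unit, (fun=> 1) => p; have [c ->] := nz p.
  exists (fun=> c); rewrite big_const card_unit /= addr0 mulr1 subrr; exact: ideal0.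
case: (classic (exists2 q, J q & q != 0)) => [[q Jq q0]|noJ]; last first.
  have J0 q : J q -> q = 0 by move=> Jq; case: (eqVneq q 0) => // ?; case: noJ; exists q.
  exists (fun q => q.@[fun=> 0] = 0); split.
  - by split=> [|x y hx hy|a x hx]; rewrite ?raddf0 ?mevalD ?mevalM ?hx ?hy ?addr0 ?mulr0.
  - by rewrite meval1; apply/eqP; rewrite oner_eq0.
  - by move=> x /J0 ->; rewrite raddf0.
  - exists unit, (fun=> 1) => p; exists (fun=> p.@[fun=> 0]).
    by rewrite big_const card_unit /= addr0 mulr1 mevalB mevalC subrr.
have [f [g [fg fC gC f0 fS]]] := @nagata F n (fun j => (msize q).+1 ^ j.+1)%N.
have [c c0 mq] := nagata_monic q0 (fun=> erefl) fC f0 fS.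
have Jg1 : ~ J (g 1) by rewrite rmorph1.
have Jq' : J (g (c%:MP%:P * f q)) by rewrite rmorphM fg; apply: idealM.
have [M [hM M1 JM [I [e he]]]] := nullst_monic IH (ideal_preim g hJ) Jg1 mq Jq'.
(* [f] is only a section of [g]; elements with the same image under [g] agree modulo [M] because [M]
   contains the preimage of [J]. *)
have ker p p' : g p = g p' -> M p -> M p'.
  move=> eqg Mp; rewrite -[p'](subrK p); apply: idealD => //; apply: JM.
  by rewrite rmorphB eqg subrr; apply: ideal0.
exists (fun x => M (f x)); split.
- by have := ideal_preim f hM.
- by rewrite rmorph1.
- by move=> x Jx; apply: JM; rewrite fg.
- exists I, (g \o e) => p; have [a ha] := he (f p); exists a.
  apply: ker ha; rewrite fg !rmorphB /= fg; congr (_ - _); rewrite rmorph_sum.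
  by apply: eq_bigr => i _; rewrite rmorphM /= gC.
Qed.

End Nullstellensatz.

(** * Polynomial functions, Zariski closures and polynomial maps *)

Section Evaluation.
Variables (k : closedFieldType) (n : nat).
Implicit Types (p q : {mpoly k[n]}) (x : 'rV[k]_n).

Lemma ev0 x : eval_at 0 x = 0 :> k. Proof. exact: meval0. Qed.
Lemma ev1 x : eval_at 1 x = 1 :> k. Proof. exact: meval1. Qed.
Lemma evC c x : eval_at c%:MP x = c. Proof. exact: mevalC. Qed.
Lemma evX i x : eval_at 'X_i x = x 0 i. Proof. by rewrite /eval_at mevalXU. Qed.
Lemma evD p q x : eval_at (p + q) x = eval_at p x + eval_at q x.
Proof. exact: mevalD. Qed.
Lemma evN p x : eval_at (- p) x = - eval_at p x. Proof. exact: mevalN. Qed.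
Lemma evB p q x : eval_at (p - q) x = eval_at p x - eval_at q x.
Proof. exact: mevalB. Qed.
Lemma evM p q x : eval_at (p * q) x = eval_at p x * eval_at q x.
Proof. exact: mevalM. Qed.
Lemma evZ c p x : eval_at (c *: p) x = c * eval_at p x. Proof. exact: mevalZ. Qed.
Lemma evXn p i x : eval_at (p ^+ i) x = eval_at p x ^+ i.
Proof. by rewrite /eval_at rmorphXn. Qed.
Lemma ev_sum (I : Type) (r : seq I) (P : pred I) (F : I -> {mpoly k[n]}) x :
  eval_at (\sum_(i <- r | P i) F i) x = \sum_(i <- r | P i) eval_at (F i) x.
Proof. by rewrite /eval_at rmorph_sum. Qed.
Definition evE := (ev0, ev1, evC, evX, evD, evN, evB, evM, evZ, evXn).

Definition vanishes (A : pset k n) p := forall x, A x -> eval_at p x = 0.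
Definition zclosure (A : pset k n) : pset k n :=
  fun x => forall p, vanishes A p -> eval_at p x = 0.

Lemma vanishes_ideal (A : pset k n) : ideal (vanishes A).
Proof.
split=> [x _|p q hp hq x Ax|p q hq x Ax]; rewrite ?evE //.
  by rewrite hp ?hq ?addr0.
by rewrite hq ?mulr0.
Qed.

Lemma zclosure_closed (A : pset k n) : zariski_closed (zclosure A).
Proof. by exists (vanishes A). Qed.

Lemma sub_zclosure (A : pset k n) x : A x -> zclosure A x.
Proof. by move=> Ax p; apply. Qed.

Lemma zclosure_min (A B : pset k n) : zariski_closed B -> psubset A B ->
  psubset (zclosure A) B.
Proof.
move=> [I hI] AB x hx; apply/hI => p Ip; apply: hx => y /AB /hI; exact.
Qed.

Lemma closedP (A : pset k n) x : zariski_closed A ->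
  (forall p, vanishes A p -> eval_at p x = 0) -> A x.
Proof. by move=> hA; apply: zclosure_min. Qed.

End Evaluation.

Section PolyMaps.
Variables (k : closedFieldType).

Definition polymap n r (F : 'I_r -> {mpoly k[n]}) (x : 'rV[k]_n) : 'rV[k]_r :=
  \row_i eval_at (F i) x.

Definition polycomp n r (p : {mpoly k[r]}) (F : 'I_r -> {mpoly k[n]}) : {mpoly k[n]} :=
  p \mPo [tuple F i | i < r].

Lemma ev_comp n r (p : {mpoly k[r]}) (F : 'I_r -> {mpoly k[n]}) x :
  eval_at (polycomp p F) x = eval_at p (polymap F x).
Proof.
rewrite /eval_at /polycomp comp_mpoly_meval; apply: meval_eq => i.
by rewrite tnth_mktuple mxE.
Qed.

Definition inl_poly n m (p : {mpoly k[n]}) : {mpoly k[n + m]} :=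
  polycomp p (fun i => 'X_(lshift m i)).
Definition inr_poly n m (p : {mpoly k[m]}) : {mpoly k[n + m]} :=
  polycomp p (fun i => 'X_(rshift n i)).

Lemma ev_inl n m (p : {mpoly k[n]}) x (y : 'rV_m) :
  eval_at (inl_poly m p) (row_mx x y) = eval_at p x.
Proof.
rewrite ev_comp; congr (eval_at _ _); apply/rowP => i.
by rewrite mxE evX row_mxEl.
Qed.

Lemma ev_inr n m (p : {mpoly k[m]}) (x : 'rV_n) y :
  eval_at (inr_poly n p) (row_mx x y) = eval_at p y.
Proof.
rewrite ev_comp; congr (eval_at _ _); apply/rowP => i.
by rewrite mxE evX row_mxEr.
Qed.

(** Functions on a product are sums of products of functions on the factors. This is why the
    translates of one function span a finite-dimensional space. *)
Lemma poly_split n m (p : {mpoly k[n + m]}) :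
  exists s : seq ({mpoly k[n]} * {mpoly k[m]}), forall x y,
    eval_at p (row_mx x y) = \sum_(q <- s) eval_at q.1 x * eval_at q.2 y.
Proof.
elim/mpoly_gen_ind: p => [c|i|p q [s hs] [t ht]|p q [s hs] [t ht]].
- by exists [:: (c%:MP, 1)] => x y; rewrite big_seq1 !evE mulr1.
- rewrite -(splitK i); case: (split i) => j /=.
    by exists [:: ('X_j, 1)] => x y; rewrite big_seq1 !evE mulr1 row_mxEl.
  by exists [:: (1, 'X_j)] => x y; rewrite big_seq1 !evE mul1r row_mxEr.
- by exists (s ++ t) => x y; rewrite evD hs ht big_cat.
- exists [seq (a.1 * b.1, a.2 * b.2) | a <- s, b <- t] => x y.
  rewrite evM hs ht big_allpairs_dep big_distrlr /=.
  by apply: eq_bigr => a _; apply: eq_bigr => b _; rewrite !evM mulrACA.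
Qed.

End PolyMaps.

(** * The weak Nullstellensatz over an algebraically closed field *)

Definition adjoin_ideal (A : comNzRingType) (N : A -> Prop) (x : A) : A -> Prop :=
  fun p => exists b, N (p - b * x).

Lemma adjoin_ideal_ideal (A : comNzRingType) (N : A -> Prop) x :
  ideal N -> ideal (adjoin_ideal N x).
Proof.
move=> hN; split; first by exists 0; rewrite mul0r subr0; apply: ideal0.
  move=> p q [a ha] [b hb]; exists (a + b).
  by rewrite mulrDl opprD addrACA; apply: idealD.
move=> c p [a ha]; exists (c * a).
by rewrite -mulrA -mulrBr; apply: idealM.
Qed.

(** If every factor were invertible modulo [N], so would be the product, which is zero modulo
    [N]. *)
Lemma adjoin_ideal_prod (A : comNzRingType) (N : A -> Prop) (r : seq A) :
  ideal N -> N (\prod_(a <- r) a) -> ~ N 1 -> exists2 a, a \in r & ~ adjoin_ideal N a 1.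
Proof.
move=> hN hr N1; apply: NNPP => no; apply: N1.
have all1 a : a \in r -> adjoin_ideal N a 1.
  by move=> ar; apply: NNPP => h; apply: no; exists a.
suff [b hb] : adjoin_ideal N (\prod_(a <- r) a) 1.
  by rewrite -[1](subrK (b * \prod_(a <- r) a)); apply: idealD => //; apply: idealM.
elim: r all1 {hr no} => [|a r IH] h.
  by exists 1; rewrite big_nil mulr1 subrr; apply: ideal0.
have [b hb] := h a (mem_head _ _).
have [|c hc] := IH; first by move=> d dr; apply: h; rewrite inE dr orbT.
exists (b * c); rewrite big_cons mulrACA; set P := \prod_(_ <- _) _ in hc *.
have -> : 1 - (b * a) * (c * P) = (1 - b * a) + (b * a) * (1 - c * P).
  by rewrite mulrBr mulr1 addrA subrK.
by apply: idealD => //; apply: idealM.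
Qed.

Section WeakNullstellensatz.
Variables (k : closedFieldType) (n : nat).

(** Multiplication by [X_i] on the quotient by [M] has a characteristic polynomial, which
    annihilates it and splits over [k]; one of its linear factors can be added to [N] without
    reaching 1. Its root is the [i]-th coordinate of the point sought. *)
Lemma fin_codim_root (M N : {mpoly k[n]} -> Prop) (i : 'I_n) :
  ideal M -> fin_codim (@mpolyC n k) M -> ideal N -> (forall p, M p -> N p) -> ~ N 1 ->
  exists a, ~ adjoin_ideal N ('X_i - a%:MP) 1.
Proof.
move=> hM [I [e he]] hN MN N1.
pose E (j : 'I_#|I|) := e (enum_val j).
have he' p : exists a : 'I_#|I| -> k, M (p - \sum_j (a j)%:MP * E j).
  have [a ha] := he p; exists (a \o enum_val).
  by rewrite (reindex (@enum_val I predT)) /= in ha; [|exact/onW_bij/enum_val_bij].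
have [a ha] := choice_fun (fun j => he' ('X_i * E j)).
pose B : 'M[k]_#|I| := \matrix_(j, l) a j l.
pose Q : 'M[{mpoly k[n]}]_#|I| := \matrix_(j, l) ('X_i *+ (j == l) - (a j l)%:MP).
have MQ j : M (\sum_l Q j l * E l).
  suff -> : \sum_l Q j l * E l = 'X_i * E j - \sum_l (a j l)%:MP * E l by apply: ha.
  under eq_bigr => l _ do rewrite mxE mulrBl.
  rewrite sumrB (bigD1 j) //= eqxx big1 ?addr0 // => l lj.
  by rewrite eq_sym (negbTE lj) mul0r.
have Mdet : M (\det Q).
  have [c hc] := he' 1.
  have -> : \det Q = \det Q * (1 - \sum_j (c j)%:MP * E j) +
      \sum_j (c j)%:MP * (\det Q * E j).
    rewrite mulrBr mulr1 mulr_sumr -addrA [X in _ + X]addrC -sumrB big1 ?addr0 //.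
    by move=> j _; rewrite mulrCA subrr.
  apply: idealD => //; first exact: idealM.
  by apply: ideal_sum => // j _; apply: idealM => //; apply: ideal_det.
have [r hr] := closed_field_poly_normal (char_poly B).
have eQ : \det Q = \prod_(z <- r) ('X_i - z%:MP).
  pose f : {rmorphism {poly k} -> {mpoly k[n]}} :=
    horner_eval 'X_i \o map_poly (@mpolyC n k).
  have fX : f 'X = 'X_i by rewrite /f /= /horner_eval map_polyX hornerX.
  have fC c : f c%:P = c%:MP by rewrite /f /= /horner_eval map_polyC hornerC.
  clearbody f; have -> : Q = map_mx f (char_poly_mx B).
    by apply/matrixP => j l; rewrite !mxE rmorphB rmorphMn fX fC.
  rewrite det_map_mx -/(char_poly B) hr (monicP (char_poly_monic B)) scale1r rmorph_prod.
  by apply: eq_bigr => z _; rewrite rmorphB fX fC.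
have := @adjoin_ideal_prod _ N [seq 'X_i - z%:MP | z <- r] hN.
rewrite big_map -eQ => /(_ (MN _ Mdet) N1) [_ /mapP[z _ ->] hz].
by exists z.
Qed.

Theorem weak_nullst (J : {mpoly k[n]} -> Prop) : ideal J -> ~ J 1 ->
  exists x : 'rV[k]_n, forall p, J p -> eval_at p x = 0.
Proof.
move=> hJ J1; have [M [hM M1 JM cM]] := mpoly_nullst hJ J1.
have [N [hN N1 MN hX]] : exists N : {mpoly k[n]} -> Prop,
    [/\ ideal N, ~ N 1, (forall p, M p -> N p) &
     forall i : 'I_n, i \in enum 'I_n -> exists a, N ('X_i - a%:MP)].
  elim: (enum 'I_n) => [|i s [N [hN N1 MN hX]]]; first by exists M.
  have [a ha] := fin_codim_root i hM cM hN MN N1.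
  have sN p : N p -> adjoin_ideal N ('X_i - a%:MP) p.
    by move=> Np; exists 0; rewrite mul0r subr0.
  exists (adjoin_ideal N ('X_i - a%:MP)); split=> //.
  - exact: adjoin_ideal_ideal.
  - by move=> p /MN /sN.
  - move=> j; rewrite inE => /orP[/eqP ->|/hX[b hb]]; last by exists b; apply: sN.
    by exists a, 1; rewrite mul1r subrr; apply: ideal0.
have [a ha] := choice_fun (fun i : 'I_n => hX i (mem_enum _ i)).
exists (\row_i a i) => p /JM /MN Np.
have Np' : N (p - (eval_at p (\row_i a i))%:MP).
  elim/mpoly_gen_ind: p {Np} => [c|i|p q Hp Hq|p q Hp Hq]; rewrite !evE.
  - by rewrite subrr; apply: ideal0.
  - by rewrite mxE; apply: ha.
  - by rewrite rmorphD opprD addrACA; apply: idealD.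
  - set x := eval_at p _ in Hp *; set y := eval_at q _ in Hq *.
    have -> : p * q - (x * y)%:MP = q * (p - x%:MP) + x%:MP * (q - y%:MP).
      by rewrite mulrBr [q * p]mulrC [q * _]mulrC mulrBr addrA subrK rmorphM.
    by apply: idealD => //; apply: idealM.
set c := eval_at p _ in Np' *; case: (eqVneq c 0) => // c0; case: N1.
have -> : 1 = (c^-1)%:MP * (p - (p - c%:MP)) :> {mpoly k[n]}.
  by rewrite subKr -rmorphM mulVf.
by apply: idealM => //; apply: idealB.
Qed.

End WeakNullstellensatz.

(** * Maximal ideals in a family, and prime colon ideals *)

Lemma noetherian_max (A : comNzRingType) (T : Type) (I : T -> A -> Prop) (S : T -> Prop) t0 :
  noetherian A -> (forall t, ideal (I t)) -> S t0 ->
  exists2 t, S t & forall t', S t' -> (forall x, I t x -> I t' x) -> forall x, I t' x -> I t x.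
Proof.
move=> hA hI St0; apply: NNPP => no.
have step t : exists t', S t -> [/\ S t', (forall x, I t x -> I t' x) & exists2 x, I t' x & ~ I t x].
  case: (classic (S t)) => [St|nSt]; last by exists t.
  apply: NNPP => nt; apply: no; exists t => // t' St' sub x It'x.
  by apply: NNPP => nIx; apply: nt; exists t' => _; split=> //; exists x.
have [f hf] := choice_fun step.
pose u i := iter i f t0.
have uS i : S (u i) by elim: i => //= i IH; have [] := hf _ IH.
have mono i j : (i <= j)%N -> forall x, I (u i) x -> I (u j) x.
  move=> /subnKC <-; elim: (j - i)%N => [|d IH] x; first by rewrite addn0.
  by rewrite addnS => /IH; have [_ h _] := hf _ (uS (i + d)%N); apply: h.
have [s sU Us] := hA (fun x => exists i, I (u i) x).
have [N hN] : exists N, forall x, x \in s -> I (u N) x.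
  elim: s sU {Us} => [|a s IH] sU; first by exists 0%N.
  have [|N hN] := IH; first by move=> x xs; apply: sU; rewrite inE xs orbT.
  have [i hi] := sU a (mem_head _ _); exists (maxn i N) => x.
  rewrite inE => /orP[/eqP ->|/hN]; first exact: mono (leq_maxl _ _) _ hi.
  exact: mono (leq_maxr _ _) _.
have [_ _ [x hx []]] := hf _ (uS N).
apply: (gen_ideal_min (hI (u N)) hN); apply: Us; by exists N.+1.
Qed.

(** The ideal quotient [(I(Y) : r)]. Since [I(Y)] is radical, a prime ideal of this form is the
    ideal of an irreducible component of the closure of [Y]. *)
Definition colon (k : closedFieldType) n (Y : pset k n) (r p : {mpoly k[n]}) : Prop :=
  vanishes Y (r * p).

Record colon_prime (k : closedFieldType) n (Y : pset k n) (r : {mpoly k[n]}) : Prop :=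
  ColonPrime {
  cprimeM : forall p q, colon Y r (p * q) -> colon Y r p \/ colon Y r q;
  cprime1 : ~ colon Y r 1
}.

Section Colon.
Variables (k : closedFieldType) (n : nat) (Y : pset k n).
Implicit Types (r p q : {mpoly k[n]}).

Lemma colon_ideal r : ideal (colon Y r).
Proof.
split=> [x _|p q hp hq x Ax|p q hq x Ax]; first by rewrite mulr0 evE.
  by rewrite mulrDr evD hp ?hq ?addr0.
by rewrite mulrCA evM hq ?mulr0.
Qed.

Lemma vanishes_colon r p : vanishes Y p -> colon Y r p.
Proof. by move=> h y Yy; rewrite evM h ?mulr0. Qed.

Lemma colon_self r : colon_prime Y r -> ~ colon Y r r.
Proof.
move=> h hr; case: (cprime1 h) => y Yy; have := hr y Yy.
by rewrite mulr1 evM => /eqP; rewrite mulf_eq0 orbb => /eqP.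
Qed.

(* A colon ideal, maximal among those contained in the maximal ideal of z, is prime:
   if p q is in it but p is not, the colon ideal of r p escapes the maximal ideal. *)
Lemma exists_colon_prime z : zclosure Y z ->
  exists2 r, colon_prime Y r & forall p, colon Y r p -> eval_at p z = 0.
Proof.
move=> Yz; pose S r := forall p, colon Y r p -> eval_at p z = 0.
have S1 : S 1 by move=> p hp; apply: Yz => y Yy; rewrite -(mul1r p); apply: hp.
have [r Sr rmax] := noetherian_max (@mpoly_noetherian k n) colon_ideal S1.
exists r => //; split; last first.
  by move=> /Sr; rewrite ev1 => /eqP; rewrite oner_eq0.
move=> p q hpq; apply: NNPP => hno.
have [np nq] : ~ colon Y r p /\ ~ colon Y r q by split=> h; apply: hno; [left|right].
have sub a b : colon Y r b -> colon Y (a * r) b.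
  by move=> hb y Yy; rewrite -mulrA evM hb ?mulr0.
have [c hc cz] : exists2 c, colon Y (p * r) c & eval_at c z != 0.
  apply: NNPP => no; apply: nq; apply: (rmax (p * r)).
  - by move=> c hc; apply/eqP; apply: contraT => cz; case: no; exists c.
  - exact: sub.
  - by move=> y Yy; rewrite -mulrA mulrCA; apply: hpq.
apply: np; apply: (rmax (c * r)).
- move=> d hd; have := Sr (c * d); rewrite evM => h.
  have /eqP : eval_at c z * eval_at d z = 0.
    by apply: h => y Yy; rewrite mulrA [r * c]mulrC; apply: hd.
  by rewrite mulf_eq0 (negbTE cz) => /eqP.
- exact: sub.
- rewrite /colon; have -> : c * r * p = p * r * c by rewrite mulrC [c * r]mulrC mulrA.
  exact: hc.
Qed.

End Colon.

(* Functions on G' form a module over k[Y] through zeta; modulo torsion with respect to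
   the prime ideal colon Y r, every finite set of them containing 1 admits a functional
   which does not kill 1. *)
Section Functional.
Variables (k : closedFieldType) (n' s : nat) (Y : pset k s) (r0 : {mpoly k[s]}).
Variables (G' : pset k n') (zeta : 'I_s -> {mpoly k[n']}).
Hypothesis hr0 : colon_prime Y r0.
Hypothesis zetaY : forall g, G' g -> Y (polymap zeta g).
Hypothesis zeta_dom : forall p, vanishes G' (polycomp p zeta) -> colon Y r0 p.

Let torsion (f : {mpoly k[n']}) :=
  exists2 p, ~ colon Y r0 p & vanishes G' (polycomp p zeta * f).

Let comb (w : seq ({mpoly k[s]} * {mpoly k[n']})) :=
  \sum_(q <- w) polycomp q.1 zeta * q.2.

Let compD p q : polycomp (p + q) zeta = polycomp p zeta + polycomp q zeta.
Proof. exact: rmorphD. Qed.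
Let compM p q : polycomp (p * q) zeta = polycomp p zeta * polycomp q zeta.
Proof. exact: rmorphM. Qed.

Let torsion_ideal : ideal torsion.
Proof.
split; first by exists 1; [exact: cprime1 | move=> x _; rewrite mulr0 ev0].
  move=> f g [p np hp] [q nq hq]; exists (p * q); first by move=> /(cprimeM hr0)[].
  move=> x Gx; have -> : polycomp (p * q) zeta * (f + g) =
    polycomp q zeta * (polycomp p zeta * f) + polycomp p zeta * (polycomp q zeta * g).
    by rewrite compM; ring.
  by rewrite evD evM hp // mulr0 add0r evM hq ?mulr0.
move=> a f [p np hp]; exists p => // x Gx.
by rewrite mulrCA evM hp ?mulr0.
Qed.

Let torsion_colon p f : colon Y r0 p -> torsion (polycomp p zeta * f).
Proof.
move=> hp; exists r0; first exact: colon_self.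
move=> x Gx; rewrite mulrA -compM evM ev_comp (hp _ (zetaY Gx)) ?mul0r //.
Qed.

Let comb_cat w w' : comb (w ++ w') = comb w + comb w'.
Proof. exact: big_cat. Qed.

Let comb_scale p w : comb [seq (p * q.1, q.2) | q <- w] = polycomp p zeta * comb w.
Proof.
rewrite /comb big_map mulr_sumr; apply: eq_bigr => q _ /=.
by rewrite compM mulrA.
Qed.

Let coefs_of q0 w : {mpoly k[s]} :=
  \sum_(q <- w | (q : {mpoly k[s]} * {mpoly k[n']}).2 == q0) q.1.

Let comb_split q0 w :
  comb w = polycomp (coefs_of q0 w) zeta * q0 + comb [seq q <- w | q.2 != q0].
Proof.
rewrite /comb (bigID (fun q => q.2 == q0)) /= big_filter; congr (_ + _).
rewrite /coefs_of; elim: w => [|q w IH]; first by rewrite !big_nil [polycomp _ _]rmorph0 mul0r.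
rewrite !big_cons; case: eqP => // e; by rewrite compD mulrDl IH e.
Qed.

Lemma exists_functional (S : seq {mpoly k[n']}) :
  exists2 lam : {mpoly k[n']} -> {mpoly k[s]}, ~ colon Y r0 (lam 1) &
    forall w, (forall q, q \in w -> q.2 \in 1 :: S) ->
      vanishes G' (comb w) -> colon Y r0 (\sum_(q <- w) q.1 * lam q.2).
Proof.
(* The induction needs relations that hold only modulo torsion. Keeping 1 at the end of the list
   means that it is treated in the base case, where it receives a nonzero value. *)
suff [lam h1 h2] : exists2 lam : {mpoly k[n']} -> {mpoly k[s]}, ~ colon Y r0 (lam 1) &
    forall w, (forall q, q \in w -> q.2 \in S ++ [:: 1]) -> torsion (comb w) ->
       colon Y r0 (\sum_(q <- w) q.1 * lam q.2).
  exists lam => // w hw hv; apply: h2 => [q /hw|].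
    by rewrite mem_cat mem_seq1 inE orbC.
  by exists 1; [exact: cprime1 | rewrite [polycomp _ _]rmorph1 mul1r].
have hJ := colon_ideal Y r0.
elim: S => [|q0 S [lam h1 h2]].
  exists (fun=> 1); first exact: cprime1.
  move=> w hw [p np hp]; have : colon Y r0 (p * \sum_(q <- w) q.1).
    apply: zeta_dom => x Gx; rewrite -(hp x Gx) compM; congr (eval_at (_ * _) x).
    rewrite [polycomp _ _]rmorph_sum; apply: eq_big_seq => q /hw.
    by rewrite mem_seq1 => /eqP ->; rewrite mulr1.
  case/(cprimeM hr0) => // h.
  by rewrite (eq_bigr (fun q => q.1)) // => q _; rewrite mulr1.
have [q0S|q0S] := boolP (q0 \in S ++ [:: 1]).
  by exists lam => // w hw; apply: h2 => q /hw; rewrite inE => /orP[/eqP ->|].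
have not1 : 1 != q0 by apply: contraNneq q0S => <-; rewrite mem_cat mem_head orbT.
have in_filter w : (forall q, q \in w -> q.2 \in (q0 :: S) ++ [:: 1]) ->
    forall q, q \in [seq q <- w | q.2 != q0] -> q.2 \in S ++ [:: 1].
  by move=> hw q; rewrite mem_filter => /andP[nq /hw]; rewrite inE (negbTE nq).
(* If [q0] depends on the others modulo torsion, with denominator [c], then [lam] is multiplied by
   [c] and its value at [q0] is forced; otherwise [q0] can be sent to 0. *)
case: (classic (exists c w0, [/\ ~ colon Y r0 c, (forall q, q \in w0 -> q.2 \in S ++ [:: 1])
    & torsion (polycomp c zeta * q0 - comb w0)])) => [[c [w0 [nc hw0 hc]]]|indep].
  pose l0 := \sum_(q <- w0) q.1 * lam q.2.
  exists (fun q => if q == q0 then l0 else c * lam q).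
    by rewrite (negbTE not1) => /(cprimeM hr0)[].
  move=> w hw htor; set rho := coefs_of q0 w.
  pose w' := [seq (c * q.1, q.2) | q <- [seq q <- w | q.2 != q0]] ++
             [seq (rho * q.1, q.2) | q <- w0].
  have : colon Y r0 (\sum_(q <- w') q.1 * lam q.2).
    apply: h2 => [q|].
      by rewrite mem_cat => /orP[] /mapP[p hp ->] /=; [apply: in_filter hp | apply: hw0].
    rewrite comb_cat !comb_scale.
    have -> : polycomp c zeta * comb [seq q <- w | q.2 != q0] + polycomp rho zeta * comb w0 =
      polycomp c zeta * comb w - polycomp rho zeta * (polycomp c zeta * q0 - comb w0).
      by rewrite (comb_split q0 w) -/rho; ring.
    by apply: (idealB torsion_ideal); apply: (idealM torsion_ideal).
  congr (colon Y r0 _); rewrite big_cat !big_map big_filter /=.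
  rewrite [RHS](bigID (fun q => q.2 == q0)) /= addrC; congr (_ + _).
    rewrite [RHS](eq_bigr (fun q => q.1 * l0)); last by move=> q ->.
    rewrite -mulr_suml -/(coefs_of q0 w) -/rho mulr_sumr.
    by apply: eq_bigr => q _; rewrite mulrA.
  by apply: eq_bigr => q /negbTE ->; rewrite mulrCA mulrA.
exists (fun q => if q == q0 then 0 else lam q); first by rewrite (negbTE not1).
move=> w hw htor; set rho := coefs_of q0 w.
have hrho : colon Y r0 rho.
  apply: NNPP => nrho; apply: indep.
  exists rho, [seq (-1 * q.1, q.2) | q <- [seq q <- w | q.2 != q0]]; split=> //.
    by move=> q /mapP[p hp ->] /=; apply: in_filter hp.
  rewrite comb_scale [polycomp (-1) _]rmorphN1 mulN1r opprK.
  by rewrite (comb_split q0 w) in htor.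
rewrite (bigID (fun q => q.2 == q0)) /= big1 ?add0r; last by move=> q ->; rewrite mulr0.
rewrite (eq_bigr (fun q => q.1 * lam q.2)); last by move=> q /negbTE ->.
rewrite -big_filter; apply: h2; first exact: in_filter.
have -> : comb [seq q <- w | q.2 != q0] = comb w - polycomp rho zeta * q0.
  by rewrite (comb_split q0 w) -/rho; ring.
by apply: (idealB torsion_ideal) => //; apply: torsion_colon.
Qed.

End Functional.

(** * Fibre products over dense images *)

Section FibreProduct.
Variables (k : closedFieldType) (n n' s t : nat).
Variables (G : pset k n) (G' : pset k n') (Y : pset k s) (r0 : {mpoly k[s]}).
Variables (pi : 'I_s -> {mpoly k[n]}) (zeta : 'I_s -> {mpoly k[n']}).
Variable beta : 'I_t -> {mpoly k[n]}.
Hypotheses (clG : zariski_closed G) (clG' : zariski_closed G').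
Hypothesis hr0 : colon_prime Y r0.
Hypothesis piY : forall g, G g -> Y (polymap pi g).
Hypothesis zetaY : forall g, G' g -> Y (polymap zeta g).
Hypothesis zeta_dom : forall p, vanishes G' (polycomp p zeta) -> colon Y r0 p.
Hypothesis disj : forall g g', G g -> G' g' -> (forall i, eval_at (beta i) g = 0) ->
  polymap pi g <> polymap zeta g'.

Let sum3 (c : 'I_t -> {mpoly k[n + n']}) (d : 'I_s -> {mpoly k[n + n']}) g g' :=
  \sum_i eval_at (beta i) g * eval_at (c i) (row_mx g g') +
  \sum_j (eval_at (pi j) g - eval_at (zeta j) g') * eval_at (d j) (row_mx g g').

Let fibre_ideal (q : {mpoly k[n + n']}) := exists c d, forall g g', G g -> G' g' ->
  eval_at q (row_mx g g') = sum3 c d g g'.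

Let fibre_ideal_ideal : ideal fibre_ideal.
Proof.
split.
- exists (fun=> 0), (fun=> 0) => g g' _ _; rewrite /sum3 ev0.
  by rewrite !big1 ?addr0 // => i _; rewrite mulr0.
- move=> x y [c [d hx]] [c' [d' hy]].
  exists (fun i => c i + c' i), (fun i => d i + d' i) => g g' Gg Gg'.
  rewrite evD hx // hy // /sum3 addrACA -!big_split /=.
  by congr (_ + _); apply: eq_bigr => i _; rewrite evD mulrDr.
- move=> a x [c [d hx]]; exists (fun i => a * c i), (fun i => a * d i) => g g' Gg Gg'.
  rewrite evM hx // /sum3 mulrDr !mulr_sumr.
  by congr (_ + _); apply: eq_bigr => i _; rewrite evM mulrCA.
Qed.

(** The zero set of this ideal is the part of the fibre product of [G] and [G'] on which all
    [beta i] vanish, and this is empty by [disj]. *)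
Let fibre_ideal1 : fibre_ideal 1.
Proof.
apply: NNPP => /(weak_nullst fibre_ideal_ideal) [z hz].
rewrite -(hsubmxK z) in hz; set g := lsubmx z in hz; set g' := rsubmx z in hz.
have hv q : (forall g g', G g -> G' g' -> eval_at q (row_mx g g') = 0) ->
    eval_at q (row_mx g g') = 0.
  move=> hq; apply: hz; exists (fun=> 0), (fun=> 0) => h h' Gh Gh'; rewrite hq // /sum3.
  by rewrite !big1 ?addr0 // => i _; rewrite /= ?ev0 mulr0.
have Gg : G g.
  apply: closedP => // p hp; rewrite -(ev_inl p g g'); apply: hv => h h' Gh _.
  by rewrite ev_inl hp.
have Gg' : G' g'.
  apply: closedP => // p hp; rewrite -(ev_inr p g g'); apply: hv => h h' _ Gh.
  by rewrite ev_inr hp.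
apply: (disj Gg Gg').
  move=> i; rewrite -(ev_inl _ g g'); apply: hz.
  exists (fun j => (i == j)%:R), (fun=> 0) => h h' _ _; rewrite ev_inl /sum3.
  rewrite [X in _ + X]big1 ?addr0; last by move=> j _; rewrite /= ?ev0 mulr0.
  rewrite (bigD1 i) //= eqxx ev1 mulr1 big1 ?addr0 // => j ji.
  by rewrite eq_sym (negbTE ji) ev0 mulr0.
apply/rowP => i; rewrite !mxE; apply/eqP; rewrite -subr_eq0; apply/eqP.
rewrite -(ev_inl _ g g') -(ev_inr (zeta i) g g') -evB; apply: hz.
exists (fun=> 0), (fun j => (i == j)%:R) => h h' _ _; rewrite evB ev_inl ev_inr /sum3.
rewrite big1 ?add0r; last by move=> j _; rewrite /= ?ev0 mulr0.
rewrite (bigD1 i) //= eqxx ev1 mulr1 big1 ?addr0 // => j ji.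
by rewrite eq_sym (negbTE ji) ev0 mulr0.
Qed.

(* Write 1 = sum_i beta_i(g) c_i(g, g') + sum_j (pi_j(g) - zeta_j(g')) d_j(g, g'), apply
   a k[Y]-linear functional in g', then specialise the variables of k[Y] to pi(g). *)
Lemma fibre_product : exists2 p, ~ colon Y r0 p &
  exists c : 'I_t -> {mpoly k[n]}, forall g, G g ->
    eval_at p (polymap pi g) = \sum_i eval_at (beta i) g * eval_at (c i) g.
Proof.
have [c [d hcd]] := fibre_ideal1.
have [sc hsc] := choice_fun (fun i => poly_split (c i)).
have [sd hsd] := choice_fun (fun i => poly_split (d i)).
pose S := flatten [seq [seq q.2 | q <- sc i] | i <- index_enum 'I_t] ++
  flatten ([seq [seq q.2 | q <- sd i] | i <- index_enum 'I_s] ++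
           [seq [seq q.2 * zeta i | q <- sd i] | i <- index_enum 'I_s]).
have [lam lam1 hlam] := exists_functional hr0 zetaY zeta_dom S.
(* A relation between values of [lam] holds in [colon Y r0]; the factor [r0] makes it an identity on
   [Y]. *)
exists (r0 * lam 1); first by move=> /(cprimeM hr0)[] //; apply: colon_self.
exists (fun i => polycomp r0 pi * \sum_(q <- sc i) q.1 * polycomp (lam q.2) pi) => g Gg.
(* For a fixed [g], the expression of 1 is a [k[Y]]-linear relation between functions of [g'], where
   [X_i] stands for [zeta i]. Specialising [X_i] to the value of [pi i] at [g] then kills the last
   family of coefficients. *)
pose w : seq ({mpoly k[s]} * {mpoly k[n']}) := (1, 1) ::
  flatten [seq [seq ((- (eval_at (beta i) g * eval_at q.1 g))%:MP, q.2) | q <- sc i]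
          | i <- index_enum 'I_t] ++
  flatten [seq [seq (('X_i - (eval_at (pi i) g)%:MP) * (eval_at q.1 g)%:MP, q.2)
          | q <- sd i] | i <- index_enum 'I_s].
have sumw (T : nzRingType) (F : {mpoly k[s]} -> {mpoly k[n']} -> T) :
    \sum_(q <- w) F q.1 q.2 = F 1 1 +
    (\sum_i \sum_(q <- sc i) F (- (eval_at (beta i) g * eval_at q.1 g))%:MP q.2 +
     \sum_i \sum_(q <- sd i) F (('X_i - (eval_at (pi i) g)%:MP) * (eval_at q.1 g)%:MP) q.2).
  rewrite big_cons big_cat !big_flatten !big_map /=; congr (_ + (_ + _)).
    by apply: eq_bigr => i _; rewrite big_map.
  by apply: eq_bigr => i _; rewrite big_map.
have hw : colon Y r0 (\sum_(q <- w) q.1 * lam q.2).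
  apply: hlam => [q|].
    rewrite inE => /orP[/eqP -> /=|]; first exact: mem_head.
    rewrite mem_cat => /orP[] /flattenP[u /mapP[i _ ->] /mapP[p hp ->]] /=; rewrite inE mem_cat.
      apply/orP; right; apply/orP; left; apply/flattenP; exists [seq q.2 | q <- sc i].
        by apply: map_f; rewrite mem_index_enum.
      by apply/mapP; exists p.
    apply/orP; right; apply/orP; right; apply/flattenP; exists [seq q.2 | q <- sd i].
      by rewrite mem_cat; apply/orP; left; apply: map_f; rewrite mem_index_enum.
    by apply/mapP; exists p.
  move=> g' Gg'; rewrite (sumw _ (fun a b => polycomp a zeta * b)).
  rewrite [polycomp 1 _]rmorph1 mulr1 2!evD 2!ev_sum ev1.
  have := hcd g g' Gg Gg'; rewrite ev1 => ->; rewrite /sum3.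
  rewrite addrACA -!big_split /= !big1 ?addr0 // => i _; rewrite ev_sum.
    rewrite hsd mulr_sumr -big_split big1 //= => q _; rewrite evM ev_comp !evE mxE.
    by rewrite [X in _ + X = _]mulrAC; ring.
  rewrite hsc mulr_sumr -big_split big1 //= => q _; rewrite evM ev_comp !evE.
  by ring.
have := hw _ (piY Gg); rewrite evM (sumw _ (fun a b => a * lam b)) mul1r 2!evD 2!ev_sum.
rewrite [X in _ + (_ + X)]big1 ?addr0; last first.
  move=> i _; rewrite ev_sum big1 // => q _; rewrite !evE mxE subrr !mul0r //.
rewrite mulrDr evM => /eqP; rewrite addr_eq0 => /eqP ->; rewrite mulr_sumr -sumrN.
apply: eq_bigr => i _; rewrite evM ev_comp !ev_sum mulrCA -mulrN; congr (_ * _).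
rewrite mulr_sumr -sumrN; apply: eq_bigr => q _.
by rewrite !evM !evE ev_comp mulNr opprK mulrA.
Qed.

End FibreProduct.

(** This replaces the constructibility of images. If the images were disjoint, [fibre_product] with
    an empty family [beta] would give a function outside the prime ideal that vanishes on the image
    of [G], hence on [Y]. *)
Lemma dense_images_meet (k : closedFieldType) (n n' s : nat) (G : pset k n) (G' : pset k n')
    (pi : 'I_s -> {mpoly k[n]}) (zeta : 'I_s -> {mpoly k[n']}) g0 :
  zariski_closed G -> zariski_closed G' -> G g0 ->
  (forall g, G g -> zclosure (image_of (polymap zeta) G') (polymap pi g)) ->
  (forall g, G' g -> zclosure (image_of (polymap pi) G) (polymap zeta g)) ->
  exists g g', [/\ G g, G' g' & polymap pi g = polymap zeta g'].
Proof.
move=> clG clG' Gg0 h1 h2.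
pose Y := zclosure (image_of (polymap pi) G).
have piY g : G g -> Y (polymap pi g) by move=> Gg; apply: sub_zclosure; exists g.
have [r0 hr0 _] := exists_colon_prime (sub_zclosure (piY _ Gg0)).
apply: NNPP => no.
have [||p np [c hc]] := @fibre_product k n n' s 0 G G' Y r0 pi zeta
    (fun=> 0) clG clG' hr0 piY h2.
- move=> p hp; apply: vanishes_colon => y; apply => _ [g Gg ->].
  apply: h1 => // _ [g' Gg' ->]; rewrite -ev_comp; exact: hp.
- by move=> g g' Gg Gg' _ e; apply: no; exists g, g'.
apply: np; apply: vanishes_colon => y; apply => _ [g Gg ->].
by rewrite hc // big_ord0.
Qed.

(** * Kolchin's theorem *)

Section LinearAlgebra.
Variable F : fieldType.

(** Take a matrix of maximal rank among those with row space inside [S]. It converts a subspace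
    given by a predicate into one to which ranks apply. *)
Lemma subspace_mx n (S : 'rV[F]_n -> Prop) :
  S 0 -> (forall u v, S u -> S v -> S (u + v)) -> (forall a u, S u -> S (a *: u)) ->
  exists B : 'M[F]_n, forall v, S v <-> (v <= B)%MS.
Proof.
move=> S0 SD SZ; pose P r := exists2 B : 'M[F]_n, \rank B = r & forall v, (v <= B)%MS -> S v.
have [r [B rB BS] rmax] : exists2 r, P r & ~ P r.+1 /\ forall d, P (r.+1 + d)%N -> False.
  apply: NNPP => no.
  have step r : P r -> exists d, P (r.+1 + d)%N.
    move=> Pr; apply: NNPP => nd; apply: no; exists r => //; split=> [h|d h].
      by apply: nd; exists 0%N; rewrite addn0.
    by apply: nd; exists d.
  have P0 : P 0%N by exists 0; rewrite ?mxrank0 // => v; rewrite submx0 => /eqP ->.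
  have big m : exists2 r, (m <= r)%N & P r.
    elim: m => [|m [r mr /step[d Pd]]]; first by exists 0%N.
    by exists (r.+1 + d)%N => //; rewrite addSn ltnS (leq_trans mr) // leq_addr.
  have [r nr [B rB _]] := big n.+1.
  by move: nr; rewrite -rB ltnNge rank_leq_row.
exists B => v; split=> [Sv|]; last exact: BS.
apply: contraT => nv; case: rmax => _ rmax.
have lt : (r < \rank (B + v)%MS)%N.
  rewrite -rB ltnNge; apply: contra nv => le; apply: submx_trans (addsmxSr B v) _.
  by rewrite -(geq_leqif (mxrank_leqif_sup (addsmxSl B v))).
case: (rmax (\rank (B + v)%MS - r.+1)%N); rewrite subnKC //; exists (B + v)%MS => // u.
by case/sub_addsmxP => [[a b] /= ->]; apply: SD; [apply: BS; apply: submxMl |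
  rewrite [b]mx11_scalar mul_scalar_mx; apply: SZ].
Qed.

Lemma mxtrace_idempotent n (e : 'M[F]_n) : e *m e = e -> \tr e = (\rank e)%:R.
Proof.
move=> ee; have := mulmx_base e; set C := col_base e; set R := row_base e => eCR.
have RC : R *m C = 1%:M.
  have : C *m (R *m C) *m R = C *m 1%:M *m R by rewrite mulmx1 mulmxA eCR -mulmxA eCR.
  by move/(row_free_inj (row_base_free e))/(row_full_inj (col_base_full e)).
by rewrite -{1}eCR mxtrace_mulC RC mxtrace1.
Qed.

End LinearAlgebra.

Section Kolchin.
Variables (k : closedFieldType) (m : nat).
Hypothesis char_k0 : [pchar k] =i pred0.
Implicit Types (A B j : 'M[k]_m.+1).

Lemma mxtrace_nilpotent A i : A ^+ i = 0 -> \tr A = 0.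
Proof.
move=> Ai; have := @char_poly_trace _ _ A isT.
have [r hr] := closed_field_poly_normal (char_poly A).
rewrite (monicP (char_poly_monic A)) scale1r in hr.
have r0 z : z \in r -> z = 0.
  move=> zr; have : eigenvalue A z.
    by rewrite eigenvalue_root_char hr root_prod_XsubC.
  case/eigenvalueP => v vA v0.
  have vAj l : v *m A ^+ l = z ^+ l *: v.
    elim: l => [|l IH]; first by rewrite !expr0 scale1r mulmx1.
    by rewrite !exprSr -mulmxE mulmxA IH -scalemxAl vA scalerA.
  have := vAj i; rewrite Ai mulmx0 => /esym/eqP; rewrite scalemx_eq0 (negbTE v0) orbF.
  by rewrite expf_eq0 => /andP[_ /eqP].
have -> : char_poly A = 'X^(size r).
  rewrite hr; elim: (r) r0 => [|z s IH] h; first by rewrite big_nil.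
  rewrite big_cons (h z (mem_head _ _)) subr0 IH ?exprS // => y ys.
  by apply: h; rewrite inE ys orbT.
have -> : size r = m.+1.
  by have := size_char_poly A; rewrite hr size_prod_XsubC => -[].
by rewrite coefXn /= ltn_eqF // => /esym/eqP; rewrite oppr_eq0 => /eqP.
Qed.

Variable U : 'M[k]_m.+1 -> Prop.
Hypotheses (U1 : U 1) (UM : forall A B, U A -> U B -> U (A * B)).
Hypothesis unip : forall A, U A -> exists i, (A - 1) ^+ i = 0.

(* A two-sided ideal of the algebra spanned by U, as C (A - 1) = (C A - 1) - (C - 1). *)
Inductive augmentation : 'M[k]_m.+1 -> Prop :=
| aug0 : augmentation 0
| augD c A B j : U A -> U B -> augmentation j -> augmentation (c *: ((A - 1) * B) + j).

Let augDD i j : augmentation i -> augmentation j -> augmentation (i + j).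
Proof.
by elim=> [|c A B l UA UB _ IH] hj; rewrite ?add0r // -addrA; constructor; auto.
Qed.

Let augZ c j : augmentation j -> augmentation (c *: j).
Proof.
elim=> [|d A B l UA UB _ IH]; first by rewrite scaler0; constructor.
by rewrite scalerDr scalerA; constructor.
Qed.

Let augMU j A : augmentation j -> U A -> augmentation (j * A).
Proof.
move=> + UA; elim=> [|d C B l UC UB _ IH]; first by rewrite mul0r; constructor.
by rewrite mulrDl -scalerAl -mulrA; constructor=> //; apply: UM.
Qed.

Let augM i j : augmentation i -> augmentation j -> augmentation (i * j).
Proof.
move=> hi; elim=> [|d A B l UA UB _ IH]; first by rewrite mulr0; constructor.
rewrite mulrDr; apply: augDD => //; rewrite -scalerAr; apply: augZ.
rewrite mulrBl mul1r mulrBr mulrA -scaleN1r.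
by apply: augDD; [do 2!apply: augMU => // | apply: augZ; apply: augMU].
Qed.

Let aug_trace j : augmentation j -> \tr j = 0.
Proof.
have trU A : U A -> \tr A = m.+1%:R.
  move=> /unip[i hi]; have := mxtrace_nilpotent hi.
  by rewrite linearB /= mxtrace1 => /eqP; rewrite subr_eq0 => /eqP.
elim=> [|c A B l UA UB _ IH]; first exact: mxtrace0.
rewrite linearD linearZ /= IH addr0 mulrBl mul1r linearB /= !trU ?subrr ?mulr0 //.
exact: UM.
Qed.

(** If [j] fixed [w] and [w] were nonzero, some polynomial in [j] without constant term would be an
    idempotent fixing [w]. It lies in the augmentation ideal, so its trace is 0; but this trace is
    its rank, nonzero in characteristic zero. *)
Let aug_no_fix j (w : 'rV[k]_m.+1) : augmentation j -> w *m j = w -> w = 0.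
Proof.
move=> hj wj; apply/eqP; apply: contraT => w0.
have wp p : w *m horner_mx j p = p.[1] *: w.
  elim/poly_ind: p => [|p c IH]; first by rewrite rmorph0 horner0 mulmx0 scale0r.
  rewrite rmorphD rmorphM /= horner_mx_X horner_mx_C mulmxDr -mulmxE mulmxA IH.
  by rewrite -scalemxAl wj mul_mx_scalar -scalerDl hornerMXaddC mulr1.
have augp p : augmentation (horner_mx j (p * 'X)).
  rewrite rmorphM /= horner_mx_X; elim/poly_ind: p => [|p c IH].
    by rewrite rmorph0 mul0r; constructor.
  rewrite rmorphD rmorphM /= horner_mx_X horner_mx_C mulrDl; apply: augDD; first exact: augM.
  by rewrite -mulmxE mul_scalar_mx; apply: augZ.
have [a [q hq eq]] := multiplicity_XsubC (char_poly j) 0.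
rewrite subr0 in eq; rewrite monic_neq0 ?char_poly_monic //= in hq.
have cop : coprimep q ('X ^+ a.+1) by apply: coprimep_expr; rewrite coprimepX.
have /Bezout_eq1_coprimepP [[u v] /= uv] := cop.
(* The projection along the generalised kernel of [j]. The exponent [a.+1] instead of [a] makes the
   polynomial divisible by [X] even for [a = 0], so that [e] is in the augmentation ideal. *)
pose e := horner_mx j (v * 'X ^+ a.+1).
have q1 : q.[1] = 0.
  have : root (char_poly j) 1.
    by rewrite -eigenvalue_root_char; apply/eigenvalueP; exists w; rewrite ?scale1r.
  by rewrite eq rootM => /orP[/eqP //|]; rewrite rootE hornerXn expr1n oner_eq0.
have we : w *m e = w.
  rewrite wp; suff -> : (v * 'X^(a.+1)).[1] = 1 by rewrite scale1r.
  by rewrite -[RHS](hornerC 1 1) polyC1 -uv hornerD !hornerM q1 mulr0 add0r.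
have ee : e *m e = e.
  apply/eqP; rewrite mulmxE -subr_eq0 -[X in _ - X]mulr1 -mulrBr /e.
  have -> : 1 = horner_mx j 1 by rewrite rmorph1.
  rewrite -rmorphB -rmorphM.
  have -> : v * 'X^(a.+1) - 1 = - (u * q) by rewrite -uv; ring.
  have -> : v * 'X^(a.+1) * (- (u * q)) = - (v * 'X * u) * char_poly j.
    by rewrite eq exprS; ring.
  by rewrite rmorphM /= Cayley_Hamilton mulr0.
have : \tr e = 0 by apply: aug_trace; rewrite /e exprSr mulrA; apply: augp.
rewrite mxtrace_idempotent // => /eqP; rewrite (proj1 (pcharf0P k) char_k0) mxrank_eq0 => /eqP e0.
by rewrite -we e0 mulmx0 eqxx in w0.
Qed.

(** Let [w] be a nonzero vector of a minimal stable subspace [W]. The image of [w] under the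
    augmentation ideal is stable; if [w] were moved, this image would be nonzero, hence all of [W],
    and [w = w j] would contradict [aug_no_fix]. *)
Theorem kolchin : exists2 c : 'rV[k]_m.+1, c != 0 & forall A, U A -> c *m A = c.
Proof.
pose stab (W : 'M[k]_m.+1) := W != 0 /\ forall A, U A -> (W *m A <= W)%MS.
have [W [W0 Wst] Wmin] : exists2 W, stab W & forall W', stab W' -> (\rank W <= \rank W')%N.
  apply: NNPP => no.
  have : forall r (W : 'M[k]_m.+1), stab W -> (\rank W <= r)%N -> False.
    elim=> [|r IH] W sW; first by rewrite leqn0 mxrank_eq0 (negbTE sW.1).
    move=> rW; apply: no; exists W => // W' sW'; rewrite leqNgt; apply/negP => lt.
    by apply: (IH W') => //; rewrite -ltnS (leq_trans lt).
  move/(_ m.+1 1); apply; last exact: rank_leq_row.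
  by split=> [|A _]; [exact: oner_neq0 | apply: submx1].
have /rowV0Pn[w wW w0] := W0.
case: (classic (forall A, U A -> w *m A = w)) => [h|nfix]; first by exists w.
have [B hB] := @subspace_mx k m.+1 (fun v => exists2 j, augmentation j & v = w *m j)
  ltac:(by exists 0; [constructor | rewrite mulmx0])
  ltac:(by move=> _ _ [i hi ->] [j hj ->]; exists (i + j); [exact: augDD | rewrite mulmxDr])
  ltac:(by move=> a _ [i hi ->]; exists (a *: i); [exact: augZ | rewrite scalemxAr]).
have BW : (B <= W)%MS.
  apply/row_subP => i; have /hB[j hj ->] := row_sub i B.
  elim: hj => [|c A C l UA UC _ IH]; first by rewrite mulmx0 sub0mx.
  rewrite mulmxDr addmx_sub // -scalemxAr scalemx_sub // mulrBl mul1r mulmxBr.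
  by rewrite addmx_sub ?eqmx_opp // ?(submx_trans (submxMr _ wW)) ?Wst //; auto.
have Bst : stab B.
  split.
    apply/negP => /eqP B0; apply: nfix => A UA.
    have : (w *m (1 *: ((A - 1) * 1) + 0) <= B)%MS.
      by apply/hB; exists (1 *: ((A - 1) * 1) + 0) => //; constructor=> //; constructor.
    rewrite B0 submx0 addr0 scale1r mulr1 mulmxBr mulmx1 subr_eq0; exact/eqP.
  move=> A UA; apply/row_subP => i; rewrite row_mul.
  have /hB[j hj ->] := row_sub i B; apply/hB; exists (j * A); first exact: augMU.
  by rewrite mulmxA.
have /hB[j hj e] : (w <= B)%MS.
  apply: submx_trans wW _; rewrite -(geq_leqif (mxrank_leqif_sup BW)).
  exact: Wmin.
by move: w0; rewrite (aug_no_fix hj (esym e)) eqxx.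
Qed.

End Kolchin.

(** * Group actions on varieties and functions *)

Section Regular.
Variable k : closedFieldType.

Lemma regular2P n m p (A : pset k n) (B : pset k m) (f : 'rV_n -> 'rV_m -> 'rV_p) :
  regular_map2 A B f <-> exists F : 'I_p -> {mpoly k[n + m]},
    forall x y, A x -> B y -> f x y = polymap F (row_mx x y).
Proof.
split=> [[F hF]|[F hF]]; exists F.
  move=> x y Ax By; have := hF (row_mx x y); rewrite row_mxKl row_mxKr.
  by apply.
by move=> z [Az Bz]; rewrite hF // hsubmxK.
Qed.

Lemma regular2_split n m p (A : pset k n) (B : pset k m) (f : 'rV_n -> 'rV_m -> 'rV_p)
    (q : {mpoly k[p]}) : regular_map2 A B f ->
  exists s : seq ({mpoly k[n]} * {mpoly k[m]}), forall x y, A x -> B y ->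
    eval_at q (f x y) = \sum_(a <- s) eval_at a.1 x * eval_at a.2 y.
Proof.
case/regular2P => F hF; have [s hs] := poly_split (polycomp q F).
by exists s => x y Ax By; rewrite hF // -ev_comp hs.
Qed.

Lemma regular2_right n m p (A : pset k n) (B : pset k m) (f : 'rV_n -> 'rV_m -> 'rV_p)
    (q : {mpoly k[p]}) x : regular_map2 A B f -> A x ->
  exists r : {mpoly k[m]}, forall y, B y -> eval_at q (f x y) = eval_at r y.
Proof.
move=> /(@regular2_split _ _ _ _ _ _ q)[s hs] Ax.
exists (\sum_(a <- s) eval_at a.1 x *: a.2) => y By.
by rewrite hs // ev_sum; apply: eq_bigr => a _; rewrite evZ.
Qed.

Lemma regular2_left n m p (A : pset k n) (B : pset k m) (f : 'rV_n -> 'rV_m -> 'rV_p)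
    (q : {mpoly k[p]}) y : regular_map2 A B f -> B y ->
  exists r : {mpoly k[n]}, forall x, A x -> eval_at q (f x y) = eval_at r x.
Proof.
move=> /(@regular2_split _ _ _ _ _ _ q)[s hs] By.
exists (\sum_(a <- s) eval_at a.2 y *: a.1) => x Ax.
by rewrite hs // ev_sum; apply: eq_bigr => a _; rewrite evZ mulrC.
Qed.

(* A maximal family q of elements of S whose values at some points y form an invertible
   matrix spans S. *)
Lemma function_basis m (X : pset k m) (S : {mpoly k[m]} -> Prop) K (b : 'I_K -> {mpoly k[m]}) :
  (forall f, S f -> exists c : 'I_K -> k, forall z, X z ->
     eval_at f z = \sum_i c i * eval_at (b i) z) ->
  exists M (q : 'I_M -> {mpoly k[m]}) (y : 'I_M -> 'rV[k]_m),
    let V := \matrix_(i, l) eval_at (q i) (y l) in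
    [/\ forall i, S (q i), forall l, X (y l), V \in unitmx &
     forall f z, S f -> X z ->
       eval_at f z = \sum_i ((\row_l eval_at f (y l)) *m invmx V) 0 i * eval_at (q i) z].
Proof.
move=> hS.
pose P M := exists (q : 'I_M -> {mpoly k[m]}) (y : 'I_M -> 'rV[k]_m),
  [/\ forall i, S (q i), forall l, X (y l) & \matrix_(i, l) eval_at (q i) (y l) \in unitmx].
have PK M : P M -> (M <= K)%N.
  move=> [q [y [hq hy]]]; have [c hc] := choice_fun (fun i => hS _ (hq i)).
  have -> : \matrix_(i, l) eval_at (q i) (y l) =
    (\matrix_(i, j) c i j) *m (\matrix_(j, l) eval_at (b j) (y l)).
    apply/matrixP => i l; rewrite !mxE hc //.
    by apply: eq_bigr => j _; rewrite !mxE.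
  rewrite -row_free_unit -row_leq_rank => h; apply: leq_trans h _.
  exact: leq_trans (mxrankM_maxl _ _) (rank_leq_col _).
have [M [q [y [hq hy hV]]] nP] : exists2 M, P M & ~ P (M + 1)%N.
  apply: NNPP => no; have : P K.+1; last by move/PK; rewrite ltnn.
  elim: K.+1 => [|M PM]; last by apply: NNPP => h; apply: no; exists M => //; rewrite addn1.
  exists (fun=> 0), (fun=> 0); split=> [[]//|[]//|].
  by rewrite unitmxE det_mx00 unitr1.
exists M, q, y; set V := \matrix_(i, l) _ in hV *; split=> // f z Sf Xz.
set r := \row_l _; pose cl := \col_i eval_at (q i) z.
have -> : \sum_i (r *m invmx V) 0 i * eval_at (q i) z = (r *m invmx V *m cl) 0 0.
  by rewrite [RHS]mxE; apply: eq_bigr => i _; rewrite [cl _ _]mxE.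
apply/eqP; rewrite -subr_eq0; apply: contraT => ne; case: nP.
pose ext (T : Type) (u : 'I_M -> T) (v : T) (i : 'I_(M + 1)) :=
  match split i with inl j => u j | inr _ => v end.
exists (ext _ q f), (ext _ y z); split.
- by move=> i; rewrite /ext; case: (split i).
- by move=> i; rewrite /ext; case: (split i).
have -> : \matrix_(i, l) eval_at (ext _ q f i) (ext _ y z l) =
    block_mx V cl r (eval_at f z)%:M.
  apply/matrixP => i l; rewrite !mxE /ext.
  by case: (split i) => i'; rewrite !mxE; case: (split l) => l'; rewrite !mxE // !ord1.
(* The Schur complement of [V] is the difference between the value of [f] at [z] and its
   interpolation from the points [y]. *)
have -> : block_mx V cl r (eval_at f z)%:M =
   block_mx 1%:M 0 (r *m invmx V) 1%:M *m
   block_mx V cl 0 ((eval_at f z)%:M - r *m invmx V *m cl).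
  rewrite mulmx_block !mul1mx !mul0mx !addr0 mulmxKV //.
  by rewrite addrCA subrr addr0.
rewrite unitmxE det_mulmx det_lblock det_ublock !det1 !mul1r unitrM -unitmxE hV /=.
rewrite [X in \det X]mx11_scalar det_scalar1 unitfE.
by rewrite mxE [_%:M 0 0]mxE mulr1n [X in _ + X]mxE.
Qed.

End Regular.

Lemma subgroup_group (k : closedFieldType) n (o : group_ops k n) (G H : pset k n) :
  affine_algebraic_group o G -> algebraic_subgroup o G H -> affine_algebraic_group o H.
Proof.
case=> clG G1 GM GV mulA mul1g mulg1 mulVg mulgV regM regV [HG clH H1 HM HV].
split=> //; try by move=> *; auto.
- by case: regM => F hF; exists F => z [Hz Hz']; apply: hF; split; apply: HG.
- by case: regV => F hF; exists F => z Hz; apply: hF; apply: HG.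
Qed.

Section Linearization.
Variables (k : closedFieldType) (n m : nat) (o : group_ops k n) (G : pset k n).
Variables (X : pset k m) (act : 'rV[k]_n -> 'rV[k]_m -> 'rV[k]_m).
Hypotheses (hG : affine_algebraic_group o G) (hX : affine_G_variety o G X act).

Let G1 := aag_one hG.
Let GM := aag_mul hG.
Let XS := gvar_stable hX.
#[local] Hint Resolve G1 GM XS : core.

Definition evmx M (A : 'I_M -> 'I_M -> {mpoly k[n]}) (g : 'rV[k]_n) : 'M[k]_M :=
  \matrix_(i, j) eval_at (A i j) g.

(* The functions q form a basis of the span of the translates of the functions f. *)
Record linearization t (f : 'I_t -> {mpoly k[m]}) M (q : 'I_M -> {mpoly k[m]})
    (A : 'I_M -> 'I_M -> {mpoly k[n]}) : Prop := Linearization {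
  lin_act : forall g y i, G g -> X y ->
    eval_at (q i) (act g y) = \sum_j evmx A g i j * eval_at (q j) y;
  lin_mul : forall g h, G g -> G h -> evmx A (gmul o g h) = evmx A g *m evmx A h;
  lin_one : evmx A (gone o) = 1%:M;
  lin_src : forall i, exists a g, G g /\
    forall y, X y -> eval_at (q i) y = eval_at (f a) (act g y);
  lin_span : forall a, exists c : 'I_M -> k, forall y, X y ->
    eval_at (f a) y = \sum_i c i * eval_at (q i) y;
  lin_free : forall c : 'I_M -> k, (forall y, X y -> \sum_i c i * eval_at (q i) y = 0) ->
    forall i, c i = 0
}.

Let translate t (f : 'I_t -> {mpoly k[m]}) (p : {mpoly k[m]}) :=
  exists a g, G g /\ forall y, X y -> eval_at p y = eval_at (f a) (act g y).

Let translate_bounded t (f : 'I_t -> {mpoly k[m]}) :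
  exists K (b : 'I_K -> {mpoly k[m]}), forall p, translate f p ->
    exists c : 'I_K -> k, forall z, X z -> eval_at p z = \sum_i c i * eval_at (b i) z.
Proof.
suff [K [b hb]] : exists K (b : 'I_K -> {mpoly k[m]}), forall a g, a \in enum 'I_t -> G g ->
    exists c : 'I_K -> k, forall z, X z ->
      eval_at (f a) (act g z) = \sum_i c i * eval_at (b i) z.
  exists K, b => p [a [g [Gg e]]]; have [|c hc] := hb a g _ Gg; first by rewrite mem_enum.
  by exists c => z Xz; rewrite e // hc.
elim: (enum 'I_t) => [|a r [K [b hb]]]; first by exists 0%N, (fun=> 0).
have [s hs] := regular2_split (f a) (gvar_regular hX).
pose b' (i : 'I_(K + size s)) :=
  match split i with inl j => b j | inr j => (nth (0, 0) s j).2 end.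
have sumb (c : 'I_K -> k) (d : 'I_(size s) -> k) z :
  \sum_i match split i with inl j => c j | inr j => d j end * eval_at (b' i) z =
  \sum_j c j * eval_at (b j) z + \sum_j d j * eval_at (nth (0, 0) s j).2 z.
  rewrite big_split_ord; congr (_ + _); apply: eq_bigr => j _; rewrite /b'.
    by rewrite (unsplitK (inl j)).
  by rewrite (unsplitK (inr j)).
exists (K + size s)%N, b' => a' g; rewrite inE => /orP[/eqP ->|ar] Gg.
  exists (fun i => match split i with inl j => 0 | inr j => eval_at (nth (0, 0) s j).1 g end).
  move=> z Xz; rewrite sumb big1 ?add0r => [|j _]; last by rewrite mul0r.
  by rewrite hs // (big_nth (0, 0)) big_mkord.
have [c hc] := hb a' g ar Gg.
exists (fun i => match split i with inl j => c j | inr j => 0 end) => z Xz.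
by rewrite sumb [X in _ + X]big1 ?addr0 ?hc // => j _; rewrite mul0r.
Qed.

Lemma linearization_exists t (f : 'I_t -> {mpoly k[m]}) :
  exists M q A, @linearization t f M q A.
Proof.
have [K [b hb]] := translate_bounded f.
have [M [q [y [hq hy hV span]]]] := function_basis hb.
set V := \matrix_(i, l) _ in hV span.
have [P hP] := choice_fun (fun i => choice_fun (fun l =>
  regular2_left (q i) (gvar_regular hX) (hy l))).
(* Coordinates with respect to [q] are read off from the values at the points [y l], and these
   values are polynomial in the group element. *)
pose A i j := \sum_l (invmx V l j)%:MP * P i l.
have tq g i : G g -> exists2 r, translate f r &
    forall z, X z -> eval_at (q i) (act g z) = eval_at r z.
  move=> Gg; have [r hr] := regular2_right (q i) (gvar_regular hX) Gg.
  exists r => //; have [a [h [Gh e]]] := hq i; exists a, (gmul o h g).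
  split=> [|z Xz]; first exact: (aag_mul hG).
  by rewrite -hr // e ?(gvar_mul hX); auto.
have AV g : G g -> evmx A g = (\matrix_(i, l) eval_at (q i) (act g (y l))) *m invmx V.
  move=> Gg; apply/matrixP => i j; rewrite !mxE ev_sum; apply: eq_bigr => l _.
  by rewrite evM evC mxE hP // mulrC.
have actE g z i : G g -> X z ->
    eval_at (q i) (act g z) = \sum_j evmx A g i j * eval_at (q j) z.
  move=> Gg Xz; have [r tr hr] := tq g i Gg; rewrite hr // (span r z tr Xz).
  apply: eq_bigr => j _; congr (_ * _); rewrite AV // !mxE; apply: eq_bigr => l _.
  by rewrite !mxE hr.
exists M, q, A; split=> //.
- move=> g h Gg Gh; rewrite (AV _ (GM Gg Gh)) (AV h Gh) mulmxA; congr (_ *m _).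
  apply/matrixP => i l; rewrite [LHS]mxE (gvar_mul hX) // actE ?[RHS]mxE; auto.
  by apply: eq_bigr => j _; rewrite !mxE.
- rewrite AV // -[RHS](mulmxV hV); congr (_ *m _).
  by apply/matrixP => i l; rewrite !mxE (gvar_one hX).
- move=> a; exists (fun i => ((\row_l eval_at (f a) (y l)) *m invmx V) 0 i) => z Xz.
  apply: span => //; exists a, (gone o); split=> [|w Xw]; first exact: (aag_one hG).
  by rewrite (gvar_one hX).
- move=> c hc i; have : (\row_j c j) *m V = 0.
    apply/rowP => l; rewrite [LHS]mxE [RHS]mxE -[RHS](hc _ (hy l)); apply: eq_bigr => j _.
    by rewrite !mxE.
  by move/(congr1 (mulmx^~ (invmx V))); rewrite mulmxK // mul0mx => /rowP/(_ i); rewrite !mxE.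
Qed.

(** On the matrix entries of [A], the operator [rho_u - 1] is right multiplication by
    [evmx A u - 1]; evaluating its powers at the neutral element gives the powers of that matrix. *)
Lemma lin_unipotent t (f : 'I_t -> {mpoly k[m]}) M (q : 'I_M.+1 -> {mpoly k[m]}) A u :
  linearization f q A -> G u -> unipotent_element o G u ->
  exists N, (evmx A u - 1) ^+ N = 0.
Proof.
move=> lin Gu unip.
pose D (F : 'rV[k]_n -> k) y := F (gmul o y u) - F y.
have iterD (F : 'rV[k]_n -> k) N d : (forall x, G x -> iter N D F x = 0) ->
    forall x, G x -> iter (d + N) D F x = 0.
  move=> hF; elim: d => [|d IH] x Gx; first exact: hF.
  by rewrite addSn iterS {1}/D !IH ?subr0; auto.
have iterA N i j x : G x ->
    iter N D (eval_at (A i j)) x = (evmx A x *m (evmx A u - 1) ^+ N) i j.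
  elim: N x => [|N IH] x Gx; first by rewrite expr0 mulmx1 mxE.
  rewrite iterS {1}/D [in X in X - _]IH ?[in X in _ - X]IH; auto; rewrite (lin_mul lin) // exprS -mulmxE.
  rewrite [in RHS]mulmxA mulmxBr mulmx1 mulmxBl.
  by rewrite [RHS]mxE [X in _ = _ + X]mxE.
have [N hN] := choice_fun (fun p : 'I_M.+1 * 'I_M.+1 => unip (A p.1 p.2)).
pose Nmax := \max_p N p; exists Nmax; apply/matrixP => i j; rewrite [RHS]mxE.
rewrite -[_ ^+ _]mul1mx -(lin_one lin) -iterA //.
rewrite -(subnK (leq_bigmax (i, j) : (N (i, j) <= Nmax)%N)).
by apply: iterD G1 => x Gx; apply: (hN (i, j)).
Qed.

(** Kolchin's theorem for the coefficient vectors with respect to a basis of the span of the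
    translates. Writing [f'] as a combination of translates of [f] preserves what survives
    translation: vanishing on an orbit, or being a semi-invariant for a commuting action. *)
Theorem unipotent_invariant (f : {mpoly k[m]}) (y0 : 'rV[k]_m) :
  [pchar k] =i pred0 -> unipotent_group o G -> X y0 -> eval_at f y0 != 0 ->
  exists2 f' : {mpoly k[m]},
    exists s : seq (k * 'rV[k]_n), (forall a, a \in s -> G a.2) /\
      forall y, X y -> eval_at f' y = \sum_(a <- s) a.1 * eval_at f (act a.2 y) &
    (exists2 y, X y & eval_at f' y != 0) /\
    forall u y, G u -> X y -> eval_at f' (act u y) = eval_at f' y.
Proof.
move=> ch unip Xy0 fy0; have [M [q [A lin]]] := linearization_exists (fun _ : 'I_1 => f).
case: M q A lin => [|M] q A lin.
  by have [c hc] := lin_span lin ord0; rewrite hc // big_ord0 eqxx in fy0.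
have [|||c c0 hc] := @kolchin k M ch (fun B => exists2 u, G u & B = evmx A u).
- by exists (gone o); [exact: G1 | rewrite (lin_one lin)].
- move=> _ _ [u Gu ->] [v Gv ->]; exists (gmul o u v); first exact: GM.
  by rewrite (lin_mul lin).
- by move=> _ [u Gu ->]; apply: lin_unipotent lin Gu (unip u Gu).
exists (\sum_i c 0 i *: q i).
  have [r hr] := choice_fun (lin_src lin); have [h hh] := choice_fun hr.
  exists [seq (c 0 i, h i) | i <- index_enum 'I_M.+1]; split.
    by move=> a /mapP[i _ ->]; case: (hh i).
  move=> y Xy; rewrite ev_sum big_map; apply: eq_bigr => i _; rewrite evZ.
  by case: (hh i) => _ ->.
have evc y : eval_at (\sum_i c 0 i *: q i) y = \sum_i c 0 i * eval_at (q i) y.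
  by rewrite ev_sum; apply: eq_bigr => i _; rewrite evZ.
split.
  apply: NNPP => no; case/negP: c0; apply/eqP/rowP => i; rewrite mxE.
  apply: (lin_free lin (c := fun i => c 0 i)) => y Xy; rewrite -evc; apply/eqP.
  by apply: contraT => h; case: no; exists y.
move=> u y Gu Xy; rewrite !evc.
transitivity (\sum_j (c *m evmx A u) 0 j * eval_at (q j) y).
  under eq_bigr => i _ do rewrite (lin_act lin) // mulr_sumr.
  rewrite exchange_big; apply: eq_bigr => j _; rewrite mxE mulr_suml.
  by apply: eq_bigr => i _; rewrite mulrA.
by rewrite hc //; exists u.
Qed.

End Linearization.

Lemma zclosureS (k : closedFieldType) n (A B : pset k n) :
  psubset A B -> psubset (zclosure A) (zclosure B).
Proof. by move=> AB x hx p hp; apply: hx => y /AB /hp. Qed.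

(** * Orbits, their closures, and embeddings given by functions *)

Section Groups.
Variables (k : closedFieldType) (n : nat) (o : group_ops k n) (G : pset k n).
Hypothesis hG : affine_algebraic_group o G.

Let G1 := aag_one hG.
Let GM := aag_mul hG.
Let GV := aag_inv hG.
#[local] Hint Resolve G1 GM GV : core.

Lemma gmulKV g h : G g -> G h -> gmul o (ginv o g) (gmul o g h) = h.
Proof. by move=> Gg Gh; rewrite (aag_mulA hG) ?(aag_mulVg hG) ?(aag_mul1g hG); auto. Qed.

Lemma gmulVK g h : G g -> G h -> gmul o g (gmul o (ginv o g) h) = h.
Proof. by move=> Gg Gh; rewrite (aag_mulA hG) ?(aag_mulgV hG) ?(aag_mul1g hG); auto. Qed.

Lemma gmulgVK g h : G g -> G h -> gmul o (gmul o h (ginv o g)) g = h.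
Proof. by move=> Gg Gh; rewrite -(aag_mulA hG) ?(aag_mulVg hG) ?(aag_mulg1 hG); auto. Qed.

Lemma ginv_unique g h : G g -> G h -> gmul o g h = gone o -> h = ginv o g.
Proof. by move=> Gg Gh e; rewrite -[LHS](gmulKV Gg Gh) e (aag_mulg1 hG); auto. Qed.

Lemma ginvK g : G g -> ginv o (ginv o g) = g.
Proof. by move=> Gg; symmetry; apply: ginv_unique; rewrite ?(aag_mulVg hG); auto. Qed.

Lemma ginvM g h : G g -> G h -> ginv o (gmul o g h) = gmul o (ginv o h) (ginv o g).
Proof.
move=> Gg Gh; symmetry; apply: ginv_unique; auto.
by rewrite -(aag_mulA hG) ?gmulVK ?(aag_mulgV hG); auto.
Qed.

Lemma ginv1 : ginv o (gone o) = gone o.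
Proof. by symmetry; apply: ginv_unique; rewrite ?(aag_mul1g hG). Qed.

Lemma left_variety : affine_G_variety o G G (gmul o).
Proof.
split=> //; [exact: (aag_closed hG) | exact: (aag_mul1g hG) | | exact: (aag_mul_regular hG)].
by move=> g h y Gg Gh Gy; rewrite (aag_mulA hG).
Qed.

Lemma inv_polys : exists V : 'I_n -> {mpoly k[n]}, forall g, G g -> ginv o g = polymap V g.
Proof. exact: (aag_inv_regular hG). Qed.

Lemma right_variety : affine_G_variety o G G (fun g y => gmul o y (ginv o g)).
Proof.
have [V hV] := inv_polys; have /regular2P[F hF] := aag_mul_regular hG.
split; [exact: (aag_closed hG) | auto | | | ].
- by move=> y Gy; rewrite ginv1 (aag_mulg1 hG).
- by move=> g h y Gg Gh Gy; rewrite ginvM // (aag_mulA hG); auto.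
apply/regular2P; exists (fun i => polycomp (F i) (fun j : 'I_(n + n) =>
  match split j with inl j => inr_poly n 'X_j | inr j => inl_poly n (V j) end)).
move=> g y Gg Gy; rewrite hF; auto; apply/rowP => i; rewrite !mxE ev_comp.
congr (eval_at _ _); apply/rowP => j; rewrite !mxE.
by case: (split j) => j'; rewrite ?ev_inr ?ev_inl ?evX // hV // mxE.
Qed.

Section Action.
Variables (m : nat) (X : pset k m) (act : 'rV[k]_n -> 'rV[k]_m -> 'rV[k]_m).
Hypothesis hX : affine_G_variety o G X act.

Let XS := gvar_stable hX.
#[local] Hint Resolve XS : core.

Lemma act_invK g y : G g -> X y -> act (ginv o g) (act g y) = y.
Proof.
by move=> Gg Xy; rewrite -(gvar_mul hX) ?(aag_mulVg hG) ?(gvar_one hX); auto.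
Qed.

Lemma subgroup_variety H : algebraic_subgroup o G H -> affine_G_variety o H X act.
Proof.
move=> hH; have HG := asub_sub hH; split.
- exact: (gvar_closed hX).
- by move=> *; auto.
- exact: (gvar_one hX).
- by move=> *; apply: (gvar_mul hX); auto.
- by case: (gvar_regular hX) => F hF; exists F => z [Hz Xz]; apply: hF; split; auto.
Qed.

Lemma orbit_map x : X x -> exists F : 'I_m -> {mpoly k[n]},
  forall g, G g -> act g x = polymap F g.
Proof.
move=> Xx; have [F hF] := choice_fun (fun i : 'I_m =>
  regular2_left 'X_i (gvar_regular hX) Xx).
by exists F => g Gg; apply/rowP => i; rewrite mxE -hF // evX.
Qed.

Lemma orbit_sub x : X x -> psubset (orbit_of G act x) X.
Proof. by move=> Xx _ [g Gg ->]; auto. Qed.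

Lemma orbit_self x : X x -> orbit_of G act x x.
Proof. by move=> Xx; exists (gone o) => //; rewrite (gvar_one hX). Qed.

Lemma closure_variety (A : pset k m) : psubset A X ->
  (forall g y, G g -> A y -> zclosure A (act g y)) ->
  affine_G_variety o G (zclosure A) act.
Proof.
move=> AX AS; have cAX : psubset (zclosure A) X.
  exact: zclosure_min (gvar_closed hX) AX.
split; first exact: zclosure_closed.
- move=> g y Gg cy p hp; have [r hr] := regular2_right p (gvar_regular hX) Gg.
  rewrite hr; last exact: cAX; apply: cy => z Az; rewrite -hr; last exact: AX.
  exact: AS hp.
- by move=> y /cAX; apply: (gvar_one hX).
- by move=> g h y Gg Gh /cAX; apply: (gvar_mul hX).
- by case: (gvar_regular hX) => F hF; exists F => z [Hz Xz]; apply: hF; split; auto.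
Qed.

Lemma orbit_closure_variety x : X x ->
  affine_G_variety o G (zclosure (orbit_of G act x)) act.
Proof.
move=> Xx; apply: closure_variety; first exact: orbit_sub.
move=> g _ Gg [h Gh ->]; apply: sub_zclosure; exists (gmul o g h); auto.
by rewrite (gvar_mul hX).
Qed.

(** This plays the part of the openness of an orbit in its closure: both orbit maps have dense image
    in the same closed set, so the orbits meet. *)
Lemma dense_orbits_eq x z : X x -> X z -> zclosure (orbit_of G act x) z ->
  zclosure (orbit_of G act z) x -> orbit_of G act x z.
Proof.
move=> Xx Xz hz hx; have [F hF] := orbit_map Xx; have [F' hF'] := orbit_map Xz.
have sub y (D : 'I_m -> {mpoly k[n]}) : (forall g, G g -> act g y = polymap D g) ->
    psubset (orbit_of G act y) (image_of (polymap D) G).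
  by move=> hD _ [g Gg ->]; exists g => //; rewrite hD.
have [||g [g' [Gg Gg' e]]] := dense_images_meet (aag_closed hG) (aag_closed hG) G1
    (pi := F) (zeta := F').
- move=> g Gg; apply: zclosureS (sub _ _ hF') _ _; rewrite -hF //.
  exact: (gvar_stable (orbit_closure_variety Xz)).
- move=> g Gg; apply: zclosureS (sub _ _ hF) _ _; rewrite -hF' //.
  exact: (gvar_stable (orbit_closure_variety Xx)).
exists (gmul o (ginv o g') g); first by auto.
by rewrite (gvar_mul hX) ?hF ?e -?hF' ?act_invK; auto.
Qed.

(* Kostant--Rosenlicht: if z is in the closure of Gx but not in Gx, some invariant function
   on this closure vanishes at z but not at x, although it is constant on Gx. *)
Theorem unipotent_orbit_closed x : [pchar k] =i pred0 -> unipotent_group o G -> X x ->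
  psubset (zclosure (orbit_of G act x)) (orbit_of G act x).
Proof.
move=> ch unip Xx z cz; set Z := zclosure (orbit_of G act x).
have hZ : affine_G_variety o G Z act by apply: orbit_closure_variety.
have Xz : X z by apply: (zclosure_min (gvar_closed hX)) cz; apply: orbit_sub.
apply: dense_orbits_eq => // f hf; apply/eqP; apply: contraT => fx.
have Zx : Z x by apply: sub_zclosure; apply: orbit_self.
have [f' [s [sG hs]] [[y Zy f'y] inv]] := unipotent_invariant hG hZ ch unip Zx fx.
have f'z : eval_at f' z = 0.
  rewrite hs // big_seq big1 // => a /sG Ga; rewrite hf ?mulr0 //.
  by exists a.2.
have const y' : Z y' -> eval_at f' y' = eval_at f' x.
  move=> Zy'; apply/eqP; rewrite -subr_eq0; apply/eqP.
  have := Zy' (f' - (eval_at f' x)%:MP); rewrite !evE; apply=> _ [g Gg ->].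
  by rewrite !evE inv // subrr.
by move: f'y; rewrite const // -(const z) // f'z eqxx.
Qed.

End Action.

Lemma linearization_map m (X : pset k m) act t (f : 'I_t -> {mpoly k[m]}) M
    (q : 'I_M -> {mpoly k[m]}) A : linearization o G X act f q A ->
  forall g y, G g -> X y -> polymap q (act g y) = polymap q y *m (evmx A g)^T.
Proof.
move=> lin g y Gg Xy; apply/rowP => i; rewrite mxE (lin_act lin) //.
by rewrite [RHS]mxE; apply: eq_bigr => j _; rewrite !mxE mulrC.
Qed.

Lemma linearization_variety m (X : pset k m) act t (f : 'I_t -> {mpoly k[m]}) M
    (q : 'I_M -> {mpoly k[m]}) A : linearization o G X act f q A ->
  affine_G_variety o G (fun=> True) (fun g y => y *m (evmx A g)^T).
Proof.
move=> lin; split=> //.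
- by exists (fun=> False) => y; split.
- by move=> y _; rewrite (lin_one lin) trmx1 mulmx1.
- by move=> g h y Gg Gh _; rewrite (lin_mul lin) // trmx_mul mulmxA.
apply/regular2P; exists (fun i => \sum_j inl_poly M (A i j) * inr_poly n 'X_j).
move=> g y Gg _; apply/rowP => i; rewrite !mxE ev_sum; apply: eq_bigr => j _.
by rewrite evM ev_inl ev_inr evX !mxE mulrC.
Qed.

(** The property of having an affine embedding, in terms of functions: finitely many functions on
    [G] whose common stabiliser under right translation is [H]. The next two lemmas give the two
    directions. *)
Definition separates (H : pset k n) t (f : 'I_t -> {mpoly k[n]}) : Prop :=
  (forall a g h, G g -> H h -> eval_at (f a) (gmul o g h) = eval_at (f a) g) /\
  (forall g0, G g0 -> (forall a g, G g -> eval_at (f a) (gmul o g g0) = eval_at (f a) g) ->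
   H g0).

Lemma embedding_separates (H : pset k n) m (X : pset k m) act x :
  psubset H G -> affine_embedding o G H X act x ->
  exists f : 'I_m -> {mpoly k[n]}, separates H f /\
    forall g, G g -> act g x = polymap f g.
Proof.
move=> HG hE; have hX := emb_variety hE; have Xx := emb_base hE.
have [F hF] := orbit_map hX Xx; exists F; split=> //; split.
  move=> a g h Gg Hh; have e : polymap F (gmul o g h) = polymap F g.
    rewrite -!hF; auto; rewrite (gvar_mul hX); auto.
    by move/(emb_stab hE (HG _ Hh)): Hh => ->.
  by have /rowP/(_ a) := e; rewrite !mxE.
move=> g0 Gg0 h; apply/(emb_stab hE) => //; rewrite hF // -[RHS](gvar_one hX) // hF //.
by apply/rowP => a; rewrite !mxE -[RHS](h a (gone o)) // (aag_mul1g hG).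
Qed.

(** The embedding is the orbit closure of the vector of values at the neutral element, in the
    representation spanned by the translates of [f]. Its orbit map is [q], so the equations of the
    embedding are the polynomial relations between the functions [q i]. *)
Lemma function_embedding (H : pset k n) t (f : 'I_t -> {mpoly k[n]}) :
  psubset H G -> separates H f ->
  exists M (q : 'I_M -> {mpoly k[n]}) (A : 'I_M -> 'I_M -> {mpoly k[n]}),
  let act g y := y *m (evmx A g)^T in
  [/\ linearization o G G (gmul o) f q A,
    affine_embedding o G H (zclosure (image_of (polymap q) G)) act (polymap q (gone o)) &
    forall g, G g -> act g (polymap q (gone o)) = polymap q g].
Proof.
move=> HG [finv fsep]; have [M [q [A lin]]] := linearization_exists hG left_variety f.
exists M, q, A => act; set X := zclosure _.
have actE g y : G g -> G y -> act g (polymap q y) = polymap q (gmul o g y).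
  by move=> Gg Gy; rewrite (linearization_map lin).
have act1 g : G g -> act g (polymap q (gone o)) = polymap q g.
  by move=> Gg; rewrite actE // (aag_mulg1 hG).
split=> //; split.
- apply: (closure_variety (linearization_variety lin)) => // g _ Gg [h Gh ->]; apply: sub_zclosure.
  by exists (gmul o g h); [auto | rewrite (linearization_map lin)].
- by apply: sub_zclosure; exists (gone o).
- move=> Z clZ oZ; apply: zclosure_min => // _ [g Gg ->].
  by apply: oZ; exists g => //; rewrite act1.
move=> g Gg; rewrite act1 //; split=> [e|Hg].
  apply: fsep => // a h Gh; have [c hc] := lin_span lin a; rewrite !hc; auto.
  apply: eq_bigr => i _; congr (_ * _).
  have /rowP/(_ i) : act h (polymap q g) = act h (polymap q (gone o)) by rewrite e.
  by rewrite !actE // !mxE (aag_mulg1 hG).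
apply/rowP => i; rewrite !mxE; have [a [h [Gh hq]]] := lin_src lin i.
by rewrite !hq // finv // (aag_mulg1 hG).
Qed.

End Groups.

(** * Degenerations of orbits *)

Lemma fraction_numden (R : idomainType) (y : {fraction R}) :
  exists a b, b != 0 /\ y * @FracField.tofrac R b = @FracField.tofrac R a.
Proof.
elim/quotW: y => r; exists \n_r, \d_r; have d0 := denom_ratioP r; split=> //.
rewrite !piE; apply/eqP; rewrite FracField.equivf_def.
have n1 : (1 : R) != 0 := oner_neq0 R.
rewrite /FracField.mulf !numer_Ratio ?denom_Ratio ?mulf_neq0 //.
by rewrite !mulr1 mulrC.
Qed.

(** * The field of fractions of a quotient by a prime ideal *)

Section PrimeFractions.
Variables (A : comNzRingType) (P : A -> Prop).
Hypotheses (hP : ideal P) (P1 : ~ P 1).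
Hypothesis primeP : forall x y, P (x * y) -> P x \/ P y.

Let I : {pred A} := fun x => if excluded_middle_informative (P x) then true else false.

Let IP x : reflect (P x) (x \in I).
Proof.
rewrite -[x \in I]/(if excluded_middle_informative (P x) then true else false).
by case: excluded_middle_informative => h; constructor.
Qed.

Let I_zmod : zmod_closed I.
Proof.
split; first exact/IP/(ideal0 hP).
by move=> x y /IP Px /IP Py; apply/IP/(idealB hP).
Qed.

Let I_proper : 1 \notin I /\ forall a, {in I, forall u, a * u \in I}.
Proof.
split; first by apply/negP => /IP.
by move=> a x /IP Px; apply/IP/(idealM hP).
Qed.

Let I_prime : prime_idealr_closed I.
Proof. by move=> x y /IP /primeP[] h; apply/orP; [left|right]; apply/IP. Qed.

HB.instance Definition _ := GRing.isZmodClosed.Build A I I_zmod.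
HB.instance Definition _ := isProperIdeal.Build A I I_proper.
HB.instance Definition _ := isPrimeIdealrClosed.Build A I I_prime.

Definition prime_quotient := {ideal_quot I}.
HB.instance Definition _ := GRing.ComNzRing.on prime_quotient.

Let quot_unit (x : prime_quotient) : bool :=
  if excluded_middle_informative (exists y, y * x = 1) then true else false.
Let quot_inv (x : prime_quotient) : prime_quotient :=
  match excluded_middle_informative (exists y, y * x = 1) with
  | left h => proj1_sig (constructive_indefinite_description _ h)
  | right _ => x
  end.

Let quot_mulVr : {in quot_unit, left_inverse 1 quot_inv *%R}.
Proof.
move=> x; rewrite /in_mem /= /quot_unit /quot_inv.
by case: excluded_middle_informative => // h _; case: constructive_indefinite_description.
Qed.

Let quot_unitP (x y : prime_quotient) : y * x = 1 -> quot_unit x.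
Proof.
by rewrite /quot_unit; case: excluded_middle_informative => // h e; case: h; exists y.
Qed.

Let quot_invout : {in [predC quot_unit], quot_inv =1 id}.
Proof.
by move=> x; rewrite !inE /in_mem /= /quot_unit /quot_inv; case: excluded_middle_informative.
Qed.

HB.instance Definition _ := GRing.ComNzRing_hasMulInverse.Build prime_quotient
  quot_mulVr quot_unitP quot_invout.
HB.instance Definition _ := GRing.ComUnitRing_isIntegral.Build prime_quotient
  (@Quotient.rquot_IdomainAxiom A I).

Lemma prime_fractions : exists (F : fieldType) (iota : {rmorphism A -> F}),
  (forall x, iota x = 0 <-> P x) /\
  forall y, exists a b, ~ P b /\ y * iota b = iota a.
Proof.
pose pi : {rmorphism A -> prime_quotient} := \pi_({ideal_quot I})%qT.
have pi0 x : pi x = 0 <-> P x.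
  have e : (pi x == 0) = (x \in I).
    by rewrite -[x in RHS]subr0 Quotient.idealrBE -(rmorph0 pi).
  split=> [/eqP|/IP Ix]; first by rewrite e => /IP.
  by apply/eqP; rewrite e.
exists {fraction prime_quotient}, (@FracField.tofrac prime_quotient \o pi).
split=> [x|y] /=.
  split=> [/eqP|/pi0 ->]; last by rewrite rmorph0.
  by rewrite tofrac_eq0 => /eqP/pi0.
have [a [b [b0 e]]] := fraction_numden y.
exists (repr a), (repr b).
have piK c : pi (repr c) = c by exact: reprK.
by rewrite !piK; split=> // /pi0; rewrite piK => h; rewrite h eqxx in b0.
Qed.

End PrimeFractions.

(** * Powers of an ideal and a form of Nakayama's lemma *)

Section IdealPowers.
Variables (A : comNzRingType) (N : nat) (E : 'I_N -> A).

(* The powers of the ideal generated by E. *)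
Inductive ipow : nat -> A -> Prop :=
| ipow_base a : ipow 0 a
| ipow_zero d : ipow d 0
| ipow_step d i a b : ipow d a -> ipow d.+1 b -> ipow d.+1 (E i * a + b).

Lemma ipowD d a b : ipow d a -> ipow d b -> ipow d (a + b).
Proof.
elim=> {d a} [a _|d|d i a c ha _ _ IH hb]; rewrite ?add0r //; first by constructor.
by rewrite -addrA; constructor; auto.
Qed.

Lemma ipowM d e a b : ipow d a -> ipow e b -> ipow (d + e) (a * b).
Proof.
move=> + hb; elim=> {d a} [a|d|d i a c _ IHa _ IHc].
- rewrite add0n; elim: hb => {e b} [b|e|e i b c _ IHb _ IHc]; first by constructor.
    by rewrite mulr0; constructor.
  by rewrite mulrDr mulrCA; constructor.
- by rewrite mul0r; constructor.
by rewrite mulrDl -mulrA addSn; constructor.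
Qed.

Lemma ipow_scale d c a : ipow d a -> ipow d (c * a).
Proof. by move=> h; rewrite -[d]add0n; apply: ipowM => //; constructor. Qed.

Lemma ipow_gen i : ipow 1 (E i).
Proof. by rewrite -[E i]mulr1 -[_ * 1]addr0; do 2!constructor. Qed.

Lemma ipow_sum d (I : Type) (r : seq I) (F : I -> A) :
  (forall i, ipow d (F i)) -> ipow d (\sum_(i <- r) F i).
Proof. by move=> h; elim/big_rec: _ => [|i x _ hx]; [constructor | apply: ipowD]. Qed.

Lemma ipow_prod (w : seq 'I_N) : ipow (size w) (\prod_(i <- w) E i).
Proof.
elim: w => [|i w IH]; first by rewrite big_nil; constructor.
by rewrite big_cons -[_ * _]addr0 /=; constructor => //; constructor.
Qed.

Lemma ipow_ideal (J : A -> Prop) d a : ideal J -> (forall i, J (E i)) -> ipow d.+1 a -> J a.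
Proof.
move=> hJ JE; move e: d.+1 => n h; elim: h d e => {n a} [|n _ _|n i a b _ _ _ IH d e] //.
  exact: ideal0.
by apply: idealD; [exact: hJ | rewrite mulrC; apply: idealM | apply: (IH d)].
Qed.

(** Combinations of words of length exactly [q] in the generators, with coefficients in the [j]-th
    power. Isolating such words makes the words of length [q] a finite system on which matrices
    act. *)
Inductive wspan (q j : nat) : A -> Prop :=
| wspan0 : wspan q j 0
| wspanD c w x : ipow j c -> size w = q -> wspan q j x ->
    wspan q j (c * (\prod_(i <- w) E i) + x).

Let wspan_add q j x y : wspan q j x -> wspan q j y -> wspan q j (x + y).
Proof.
elim=> [|c w z hc sw _ IH] hy; first by rewrite add0r.
by rewrite -addrA; constructor; auto.
Qed.

Lemma ipow_wspan q j a : ipow (q + j) a -> wspan q j a.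
Proof.
elim: q a => [|q IHq] a.
  move=> h; rewrite -[a]addr0 -[a]mulr1; have := wspanD (w := [::]) h erefl (wspan0 0 j).
  by rewrite big_nil.
move e: (q.+1 + j)%N => n h; elim: h e => {n a} [//|n _|n i a b ha _ _ IH e].
  by constructor.
apply: wspan_add; last exact: IH.
have {ha} /IHq : ipow (q + j) a by move: e ha; rewrite addSn => -[->].
elim=> [|c w x hc sw _ IHx]; first by rewrite mulr0; constructor.
rewrite mulrDr mulrCA; have := @wspanD q.+1 j c (i :: w) _ hc _ IHx.
by rewrite big_cons; apply; rewrite /= sw.
Qed.

Lemma wspan_coef q j a : wspan q j a -> exists c : q.-tuple 'I_N -> A,
  (forall w, ipow j (c w)) /\ a = \sum_w c w * \prod_(i <- w) E i.
Proof.
elim=> [|c w x hc /eqP sw _ [d [hd ->]]].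
  by exists (fun=> 0); split=> [w|]; [constructor | rewrite big1 // => w _; rewrite mul0r].
have [t <-] : exists t : q.-tuple 'I_N, tval t = w by exists (Tuple sw).
exists (fun v => (if v == t then c else 0) + d v); split=> [v|].
  by apply: ipowD => //; case: ifP => // _; constructor.
under [RHS]eq_bigr => v _ do rewrite mulrDl.
rewrite big_split /=; congr (_ + _); rewrite [RHS](bigD1 t) //= eqxx.
rewrite [X in _ = _ + X]big1 ?addr0 // => v /negbTE ->.
by rewrite mul0r.
Qed.

Lemma pigeonhole d (w : seq 'I_N) : (0 < N)%N -> size w = (N * d.+1)%N ->
  exists i, (d < count_mem i w)%N.
Proof.
move=> N0 sw; apply/existsP; apply: contraT; rewrite negb_exists => /forallP h.
suff : (size w <= N * d)%N by rewrite sw leqNgt ltn_pmul2l // ltnSn.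
have -> : size w = (\sum_i count_mem i w)%N.
  elim: (w) => [|a s IH]; first by rewrite big1.
  rewrite /= IH big_split /= -add1n; congr (_ + _)%N.
  by rewrite (bigD1 a) //= eqxx big1 // => i /negbTE; rewrite eq_sym => ->.
rewrite -[X in (_ <= X * _)%N]card_ord -sum_nat_const; apply: leq_sum => i _.
by rewrite leqNgt.
Qed.

(* With I the ideal generated by E, the pigeonhole principle gives I^q = I^(q+1) modulo J for
   q = N (d + 1). *)
Lemma ipow_nakayama (J M : A -> Prop) d : ideal J -> ideal M -> (forall i, M (E i)) ->
  (forall i, exists2 s, ipow d.+2 s & J (E i ^+ d.+1 - s)) ->
  exists2 u, M (u - 1) & forall i, exists q, J (u * E i ^+ q).
Proof.
move=> hJ hM ME hs; have [N0|N0] := posnP N.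
  by exists 1; [rewrite subrr; apply: ideal0 | move=> [i hi]; exfalso; rewrite N0 in hi].
pose q := (N * d.+1)%N; pose T := q.-tuple 'I_N.
have hw (w : T) : exists c : T -> A, (forall v, ipow 1 (c v)) /\
    J (\prod_(i <- w) E i - \sum_v c v * \prod_(i <- v) E i).
  have [i hi] := pigeonhole N0 (size_tuple w).
  have [s hsi Js] := hs i; pose w' := [seq j <- w | j != i].
  have ew : \prod_(j <- w) E j =
      E i ^+ d.+1 * (E i ^+ (count_mem i w - d.+1) * \prod_(j <- w') E j).
    rewrite mulrA -exprD subnKC // big_filter (bigID (pred1 i)) /=; congr (_ * _).
    elim: (tval w) => [|a r IH]; first by rewrite big_nil expr0.
    by rewrite big_cons /=; case: eqP => [->|_]; rewrite IH // add1n exprS.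
  (* Trading the factor [E i ^+ d.+1] for [s], which is in the power [d.+2], raises the order of the
     word by one. *)
  pose t := s * (E i ^+ (count_mem i w - d.+1) * \prod_(j <- w') E j).
  have ht : ipow (q + 1) t.
    have -> : (q + 1 = d.+2 + ((count_mem i w - d.+1) + size w'))%N.
      have e1 : (count_mem i w + size w' = q)%N.
        by rewrite size_filter count_predC size_tuple.
      have ar c s1 q1 : (c + s1 = q1 -> d < c -> q1 + 1 = d.+2 + ((c - d.+1) + s1))%N.
        by move=> <- h; rewrite addnA addSn subnKC // addSn addn1.
      exact: ar.
    apply: ipowM => //; apply: ipowM (ipow_prod w').
    elim: (_ - _)%N => [|l IH]; first by constructor.
    by rewrite exprS; apply: (ipowM (d := 1)) IH; apply: ipow_gen.
  have [c [hc et]] := wspan_coef (ipow_wspan ht); exists c; split=> //.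
  rewrite -et ew /t -mulrBl mulrC; exact: idealM.
have [c hc] := choice_fun hw.
pose Q : 'M[A]_#|{: T}| := \matrix_(a, b) ((a == b)%:R - c (enum_val a) (enum_val b)).
pose mu (a : 'I_#|{: T}|) := \prod_(i <- enum_val a) E i.
exists (\det Q).
  apply: ideal_det1 => // a b; rewrite mxE addrAC subrr sub0r; apply: idealN => //.
  by apply: (ipow_ideal hM ME) ((hc _).1 _).
move=> i; exists q; have -> : E i ^+ q = mu (enum_rank (nseq_tuple q i)).
  by rewrite /mu enum_rankK /= big_nseq iter_mulr_1.
apply: ideal_det => // a; have [_] := hc (enum_val a); congr J.
rewrite (reindex (@enum_val _ {: T})) /=; last exact/onW_bij/enum_val_bij.
under [RHS]eq_bigr => b _ do rewrite mxE mulrBl.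
rewrite [in RHS]sumrB [X in _ = X - _](bigD1 a) //= eqxx mul1r.
rewrite [X in _ = _ + X - _]big1 ?addr0 // => b ba.
by rewrite eq_sym (negbTE ba) mul0r.
Qed.

End IdealPowers.

(** * Multiplication matrices with entries in a subring *)

Section GenericUnit.
Variables (F : fieldType) (m : nat) (M : {mpoly F[m]} -> Prop).
Variables (I : finType) (e : I -> {mpoly F[m]}).
Hypotheses (hM : ideal M) (M1 : ~ M 1).
Hypothesis span : forall p, exists a : I -> F, M (p - \sum_i (a i)%:MP * e i).

(* q acts on the spanning family e, modulo M, by a matrix with entries in S. *)
Definition acts_in (S : F -> Prop) (q : {mpoly F[m]}) := forall i, exists Z : I -> F,
  (forall l, S (Z l)) /\ M (q * e i - \sum_l (Z l)%:MP * e l).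

Lemma acts_in_const (S : F -> Prop) c : S 0 -> S c -> acts_in S c%:MP.
Proof.
move=> S0 Sc i; exists (fun l => if l == i then c else 0); split=> [l|]; first by case: ifP.
rewrite (bigD1 i) //= eqxx big1 ?addr0 ?subrr; first exact: ideal0.
by move=> l /negbTE ->; rewrite mul0r.
Qed.

Lemma acts_inD (S : F -> Prop) p q : (forall x y, S x -> S y -> S (x + y)) ->
  acts_in S p -> acts_in S q -> acts_in S (p + q).
Proof.
move=> SD hp hq i; have [Z [SZ MZ]] := hp i; have [W [SW MW]] := hq i.
exists (fun l => Z l + W l); split=> [l|]; first exact: SD.
under eq_bigr => l _ do rewrite rmorphD mulrDl.
by rewrite big_split /= mulrDl opprD addrACA; apply: idealD.
Qed.

Lemma acts_inM (S T U : F -> Prop) p q : U 0 -> (forall x y, U x -> U y -> U (x + y)) ->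
  (forall x y, S x -> T y -> U (x * y)) ->
  acts_in T p -> acts_in S q -> acts_in U (p * q).
Proof.
move=> U0 UD ST hp hq i; have [Z [SZ MZ]] := hq i.
have [W hW] := choice_fun hp.
exists (fun l => \sum_j Z j * W j l); split=> [l|].
  by elim/big_rec: _ => // j x _ Ux; apply: (UD) => //; apply: ST; case: (hW j).
have -> : p * q * e i - \sum_l (\sum_j Z j * W j l)%:MP * e l =
    p * (q * e i - \sum_j (Z j)%:MP * e j) +
    \sum_j (Z j)%:MP * (p * e j - \sum_l (W j l)%:MP * e l).
  rewrite mulrBr mulrA; under [X in _ = _ + X]eq_bigr => j _ do rewrite mulrBr.
  rewrite sumrB mulr_sumr addrA; under [X in _ = _ - X + _ - _]eq_bigr => j _ do rewrite mulrCA.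
  rewrite subrK; congr (_ - _).
  under eq_bigr => l _ do rewrite rmorph_sum mulr_suml.
  rewrite exchange_big; apply: eq_bigr => j _; rewrite mulr_sumr.
  by apply: eq_bigr => l _; rewrite rmorphM mulrA.
apply: idealD => //; first exact: idealM.
by apply: ideal_sum => // j _; apply: idealM => //; case: (hW j).
Qed.

(** If [w] acts by the matrix [Z], then [1 + Z] kills the spanning family modulo [M], so its
    determinant is a constant in the proper ideal [M], that is 0; but it is also 1 modulo [T]. *)
Lemma acts_in_unit (S T : F -> Prop) w :
  S 1 -> (forall x y, S x -> S y -> S (x - y)) -> (forall x y, S x -> S y -> S (x * y)) ->
  T 0 -> (forall x y, T x -> T y -> T (x + y)) -> (forall x y, S x -> T y -> T (x * y)) ->
  (forall x, T x -> S x) -> acts_in T w -> M (1 + w) -> T (-1).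
Proof.
move=> S1 SB SM T0 TD TM TS hw Mw; have [Z hZ] := choice_fun hw.
pose Q : 'M[F]_#|I| := \matrix_(a, b) ((a == b)%:R + Z (enum_val a) (enum_val b)).
have hdet i : M ((\det Q)%:MP * e i).
  have := @ideal_det _ M #|I| (map_mx (@mpolyC m F) Q) (e \o enum_val) hM.
  rewrite det_map_mx => /(_ _ (enum_rank i)) /=; rewrite enum_rankK; apply=> a.
  have [_ MZ] := hZ (enum_val a).
  have -> : \sum_l (map_mx (@mpolyC m F) Q) a l * e (enum_val l) =
     (1 + w) * e (enum_val a) -
     (w * e (enum_val a) - \sum_l (Z (enum_val a) l)%:MP * e l).
    rewrite mulrDl mul1r opprB addrA [_ + _ + \sum_(_ | _) _]addrAC addrK.
    rewrite (reindex (@enum_val _ I)) /=; last exact/onW_bij/enum_val_bij.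
    under eq_bigr => b _ do rewrite !mxE rmorphD mulrDl.
    rewrite big_split /=; congr (_ + _).
    rewrite (bigD1 a) //= eqxx rmorph1 mul1r big1 ?addr0 // => b ba.
    by rewrite eq_sym (negbTE ba) rmorph0 mul0r.
  by apply: idealB => //; rewrite mulrC; apply: idealM.
have M_det : M (\det Q)%:MP.
  have [a ha] := span 1.
  have -> : (\det Q)%:MP = (\det Q)%:MP * (1 - \sum_i (a i)%:MP * e i) +
      \sum_i (a i)%:MP * ((\det Q)%:MP * e i).
    rewrite mulrBr mulr1 mulr_sumr -addrA [X in _ + X]addrC -sumrB big1 ?addr0 //.
    by move=> j _; rewrite mulrCA subrr.
  apply: idealD => //; first exact: idealM.
  by apply: ideal_sum => // j _; apply: idealM.
have d0 : \det Q = 0.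
  apply/eqP; apply: contraT => d0; case: M1.
  have -> : 1 = (\det Q)^-1%:MP * (\det Q)%:MP :> {mpoly F[m]} by rewrite -rmorphM mulVf.
  exact: idealM.
rewrite -sub0r -d0; apply: (det1_sub S1 SB SM T0 TD TM TS) => a b.
by rewrite mxE addrAC subrr add0r; case: (hZ (enum_val a)).
Qed.

End GenericUnit.

(** * Algebraic points over the function field of a component *)

Section GenericPoint.
Variables (k : closedFieldType) (s m : nat) (O : pset k s) (r0 : {mpoly k[s]}).
Variables (n : nat) (G : pset k n) (gam : 'rV[k]_n -> 'rV[k]_s) (p : 'rV[k]_n -> 'I_m -> k).
Hypothesis hr0 : colon_prime O r0.
Hypothesis gamO : forall g, G g -> O (gam g).
Hypothesis Ogam : forall x, O x -> exists2 g, G g & x = gam g.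

Definition ev2 (u : 'rV[k]_s) (v : 'I_m -> k) : {rmorphism {mpoly {mpoly k[s]}[m]} -> k} :=
  mmap (meval (fun i => u 0 i)) v.

Lemma ev2C u v c : ev2 u v c%:MP = eval_at c u.
Proof. exact: mmapC. Qed.

Lemma ev2X u v i : ev2 u v 'X_i = v i.
Proof. by rewrite /ev2 /= mmapX mmap1U. Qed.

(** The factor [r0] restricts the condition to the component singled out by [colon O r0]. *)
Definition relation (Q : {mpoly {mpoly k[s]}[m]}) :=
  forall g, G g -> eval_at r0 (gam g) * ev2 (gam g) (p g) Q = 0.

(* A point, with coordinates algebraic over the fraction field F of k[O]/(0 : r0), of the
   variety defined by the relations. *)
Lemma generic_point : exists (F : fieldType) (iota : {rmorphism {mpoly k[s]} -> F})
  (M : {mpoly F[m]} -> Prop) (I : finType) (e : I -> {mpoly F[m]}) (h : {mpoly k[s]}),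
  [/\ forall x, iota x = 0 <-> colon O r0 x, ideal M, ~ M 1 &
    [/\ forall Q, relation Q -> M (map_mpoly iota Q),
      forall q, exists a : I -> F, M (q - \sum_i (a i)%:MP * e i),
      ~ colon O r0 h &
      forall j i, exists x : I -> {mpoly k[s]},
        M ((iota h)%:MP * ('X_j * e i) - \sum_l (iota (x l))%:MP * e l)]].
Proof.
have [F [iota [iota0 frac]]] :=
  prime_fractions (colon_ideal O r0) (cprime1 hr0) (@cprimeM _ _ _ _ hr0).
have clear_denom (q : {mpoly F[m]}) : exists c Q, ~ colon O r0 c /\
    (iota c)%:MP * q = map_mpoly iota Q.
  elim/mpoly_gen_ind: q => [y|i|q q' [c [Q [nc e]]] [c' [Q' [nc' e']]]
      |q q' [c [Q [nc e]]] [c' [Q' [nc' e']]]].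
  - have [a [b [nb e]]] := frac y; exists b, a%:MP; split=> //.
    by rewrite map_mpolyC -rmorphM /= mulrC e.
  - exists 1, 'X_i; split; first exact: cprime1.
    by rewrite rmorph1 mul1r map_mpolyX.
  - exists (c * c'), (c'%:MP * Q + c%:MP * Q'); split; first by move=> /(cprimeM hr0)[].
    rewrite (rmorphD (map_mpoly iota)) !(rmorphM (map_mpoly iota)) /= !map_mpolyC -e -e'.
    by rewrite !rmorphM /=; ring.
  - exists (c * c'), (Q * Q'); split; first by move=> /(cprimeM hr0)[].
    by rewrite (rmorphM (map_mpoly iota)) /= -e -e' !rmorphM /=; ring.
have common (T : finType) (a : T -> F) : exists h, ~ colon O r0 h /\
    exists x : T -> {mpoly k[s]}, forall t, iota h * a t = iota (x t).
  have [num hnum] := choice_fun (fun t => frac (a t)).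
  have [den hden] := choice_fun hnum.
  exists (\prod_t den t); split.
    elim/big_rec: _ => [|t x _ nx]; first exact: cprime1.
    by move=> /(cprimeM hr0)[] //; case: (hden t).
  exists (fun t => num t * \prod_(t' | t' != t) den t') => t.
  have [_ e] := hden t; rewrite (bigD1 t) //= !rmorphM /= -e.
  by rewrite mulrAC [iota (den t) * _]mulrC.
(* The ideal over [F] generated by the relations, in a form where the denominators are cleared. *)
pose J (q : {mpoly F[m]}) := exists c Q, [/\ ~ colon O r0 c, relation Q &
  (iota c)%:MP * q = map_mpoly iota Q].
have relM Q Q' : relation Q -> relation (Q' * Q).
  by move=> h g Gg; rewrite (rmorphM (ev2 _ _)) mulrCA h ?mulr0.
have relD Q Q' : relation Q -> relation Q' -> relation (Q + Q').
  by move=> h h' g Gg; rewrite (rmorphD (ev2 _ _)) mulrDr h ?h' ?addr0.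
have hJ : ideal J.
  split.
  - exists 1, 0; split; first exact: cprime1.
      by move=> g Gg; rewrite (rmorph0 (ev2 _ _)) mulr0.
    by rewrite mulr0 (rmorph0 (map_mpoly iota)).
  - move=> q q' [c [Q [nc rQ e]]] [c' [Q' [nc' rQ' e']]].
    exists (c * c'), (c'%:MP * Q + c%:MP * Q'); split; first by move=> /(cprimeM hr0)[].
      by apply: relD; apply: relM.
    rewrite (rmorphD (map_mpoly iota)) !(rmorphM (map_mpoly iota)) /= !map_mpolyC -e -e'.
    by rewrite !rmorphM /=; ring.
  - move=> a q [c [Q [nc rQ e]]]; have [c' [Q' [nc' e']]] := clear_denom a.
    exists (c * c'), (Q' * Q); split; first by move=> /(cprimeM hr0)[].
      exact: relM.
    by rewrite (rmorphM (map_mpoly iota)) /= -e -e' !rmorphM /=; ring.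
have relp Q : (forall t, colon O r0 Q@_t) -> relation Q.
  move=> hQ g Gg; rewrite /ev2 /= /mmap mulr_sumr big1 // => t _.
  by have := hQ t _ (gamO Gg); rewrite evM mulrA => h; rewrite [X in X * _]h mul0r.
have J1 : ~ J 1.
  (* If 1 were in [J], a constant [c] outside the prime ideal would be a relation; as every point of
     [O] comes from [G], [r0 c] would vanish on [O]. *)
  move=> [c [Q [nc rQ]]]; rewrite mulr1 => e; apply: nc => _ /Ogam[g Gg ->].
  have : relation (c%:MP - Q).
    apply: relp => t; apply/iota0; rewrite -mcoeff_map_mpoly.
    by rewrite (rmorphB (map_mpoly iota)) /= map_mpolyC e subrr mcoeff0.
  by move/(_ g Gg); rewrite (rmorphB (ev2 _ _)) mulrBr rQ // subr0 ev2C evM.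
have [M [hM M1 JM [I [e he]]]] := mpoly_nullst hJ J1.
have [a ha] := choice_fun (fun ji : 'I_m * I => he ('X_ji.1 * e ji.2)).
have [h [nh [x hx]]] := common _ (fun t : 'I_m * I * I => a t.1 t.2).
exists F, iota, M, I, e, h; split=> //; split=> //.
  move=> Q rQ; apply: JM; exists 1, Q; split=> //; first exact: cprime1.
  by rewrite rmorph1 mul1r.
move=> j i; exists (fun l => x (j, i, l)).
have := idealM hM (iota h)%:MP (ha (j, i)); congr M; rewrite /= mulrBr mulr_sumr.
by congr (_ - _); apply: eq_bigr => l _; rewrite mulrA -rmorphM /= -hx.
Qed.

End GenericPoint.

(** * Nontrivial embeddings from non-closed orbits *)

Section Degeneration.
Variables (k : closedFieldType) (n : nat) (o : group_ops k n) (G : pset k n).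
Hypothesis hG : affine_algebraic_group o G.
Variables (s : nat) (Y : pset k s) (act : 'rV[k]_n -> 'rV[k]_s -> 'rV[k]_s).
Variables (y z : 'rV[k]_s).
Hypotheses (hY : affine_G_variety o G Y act) (Yy : Y y).
Hypotheses (hz : zclosure (orbit_of G act y) z) (nz : ~ orbit_of G act y z).
Variables (H : pset k n) (t0 : nat) (f0 : 'I_t0 -> {mpoly k[n]}).
Hypotheses (HG : psubset H G) (Hy : forall h, H h -> act h y = y).
Hypothesis sep0 : separates o G H f0.

Let G1 := aag_one hG.
Let GM := aag_mul hG.
Let GV := aag_inv hG.
Let YS := gvar_stable hY.
Let HGe h : H h -> G h. Proof. exact: HG. Qed.
#[local] Hint Resolve G1 GM GV YS HGe : core.

Let O := orbit_of G act y.
Let OY : psubset O Y := orbit_sub hY Yy.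
Let Yz : Y z := zclosure_min (gvar_closed hY) OY hz.

(** Otherwise [y] would lie in the closure of the orbit of [z], and the two orbits would
    coincide. *)
Let boundary_function : exists2 b, vanishes (orbit_of G act z) b & eval_at b y != 0.
Proof.
apply: NNPP => no; apply: nz; apply: (dense_orbits_eq hG hY Yy Yz hz) => b hb.
by apply/eqP; apply: contraT => by0; case: no; exists b.
Qed.

Section Translates.
Variables (N : nat) (E : 'I_N -> {mpoly k[s]}).
Hypothesis Etr : forall i g, G g -> exists c : 'I_N -> k,
  forall u, Y u -> eval_at (E i) (act g u) = \sum_j c j * eval_at (E j) u.

Let ipow_translate d a g : G g -> ipow E d a -> exists2 a', ipow E d a' &
  forall u, Y u -> eval_at a (act g u) = eval_at a' u.
Proof.
move=> Gg; elim=> {d a} [a|d|d i a b _ [a' ha ea] _ [b' hb eb]].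
- have [a' ha] := regular2_right a (gvar_regular hY) Gg.
  by exists a' => //; constructor.
- by exists 0; [constructor | move=> u _; rewrite !ev0].
have [c hc] := Etr i Gg; exists ((\sum_j (c j)%:MP * E j) * a' + b').
  apply: ipowD => //; apply: (ipowM (d := 1)) ha.
  by apply: ipow_sum => j; apply: ipow_scale; apply: ipow_gen.
move=> u Yu; rewrite !evD !evM ea // eb // hc // ev_sum; congr (_ * _ + _).
by apply: eq_bigr => j _; rewrite evM evC.
Qed.

Lemma translates_contradiction r0 f i0 d rho : colon_prime O r0 ->
  (forall p, colon O r0 p -> eval_at p z = 0) ->
  (forall i, eval_at (E i) z = 0) -> E i0 = f ->
  (forall i, exists2 g, G g & forall u, Y u -> eval_at (E i) u = eval_at f (act g u)) ->
  ipow E d rho -> vanishes O (f ^+ d.+1 + f * f * rho) -> colon O r0 f.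
Proof.
move=> hr0 pz Ez Ef Esrc hrho hv.
have hM : ideal (fun p : {mpoly k[s]} => eval_at p z = 0).
  by split=> [|p q hp hq|a p hp]; rewrite ?evE ?hp ?hq ?addr0 ?mulr0.
have [i|u hu hq] := @ipow_nakayama _ N E (vanishes O) _ d (vanishes_ideal O) hM Ez.
  have [g Gg e] := Esrc i; have [rho' hrho' e'] := ipow_translate Gg hrho.
  exists (- (E i * E i * rho')).
    rewrite -mulN1r; apply: ipow_scale; rewrite -mulrA.
    apply: (ipowM (d := 1)); first exact: ipow_gen.
    by apply: (ipowM (d := 1)) hrho'; apply: ipow_gen.
  move=> _ [h Gh ->]; have Yh : Y (act h y) by auto.
  rewrite opprK evD evXn !evM e // -e' // -!evM -evXn -evD.
  by apply: hv; exists (gmul o g h); [auto | rewrite (gvar_mul hY)].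
have [q Jq] := hq i0; rewrite Ef in Jq.
have [|hf] := cprimeM hr0 (vanishes_colon r0 Jq).
  move/pz => uz; move/eqP: hu; rewrite evB uz ev1 sub0r oppr_eq0 oner_eq0 //.
elim: q hf {Jq hq} => [|q IH]; first by rewrite expr0 => /(cprime1 hr0).
by rewrite exprS => /(cprimeM hr0)[].
Qed.

End Translates.

(* Let w be a vector with stabiliser H. For f vanishing on Gz, the functions v_a and
   v_a v_b w_j on G, with v_a the translates of f, again separate G/H. If f is divisible by
   the denominators h of a generic point w = P / h of the variety of the relations between
   the w_j over k[Y], then v_a v_b w_j becomes f times an element of k[Y][v / f], and so does
   v_a; hence if 0 were not in the closure of the image of G, then f would be invertible in
   k[Y][v / f]. As f may be replaced by any v_a, this would contradict Nakayama's lemma. *)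
Theorem degenerate_embedding : exists m (X : pset k m) act' x,
  affine_embedding o G H X act' x /\ ~ trivial_embedding G X act' x.
Proof.
have [b bz by0] := boundary_function.
have [r0 hr0 pz] := exists_colon_prime hz.
have [m [q [B linq]]] := linearization_exists hG (left_variety hG) f0.
pose p g j := eval_at (q j) g.
have [F [iota [M [I [e [h [iota0 hM M1 [relM span nh hx]]]]]]]] :=
  @generic_point k s m O r0 n G (act^~ y) p hr0
   (fun g Gg => ex_intro2 _ _ g Gg erefl) (fun x Ox => Ox).
have [g1 Gg1 rh1] : exists2 g1, G g1 & eval_at r0 (act g1 y) * eval_at h (act g1 y) != 0.
  apply: NNPP => no; apply: nh => _ [g Gg ->]; rewrite evM; apply/eqP; apply: contraT => ne.
  by case: no; exists g.
have [b1 hb1] := regular2_right b (gvar_regular hY) (GV Gg1).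
have b1z g : G g -> eval_at b1 (act g z) = 0.
  move=> Gg; rewrite -hb1; auto; rewrite -(gvar_mul hY); auto.
  by apply: bz; exists (gmul o (ginv o g1) g); auto.
(* [b1] makes [f] vanish on the orbit of [z], [h] clears the denominators of the generic point, and
   [r0] will turn an equation modulo the prime ideal into one on [O]. *)
pose f := r0 * h * b1.
have f1 : eval_at f (act g1 y) != 0.
  by rewrite !evM mulf_neq0 // -hb1 ?(act_invK hG hY); auto.
have fz g : G g -> eval_at f (act g z) = 0 by move=> Gg; rewrite evM b1z ?mulr0.
have fdef : f = r0 * h * b1 by []; clearbody f.
have [N [v [C linv]]] := linearization_exists hG hY (fun _ : 'I_1 => f).
(* [f] itself is put at position 0 in front of a basis of the span of its translates, since it
   serves as the denominator of the chart. *)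
pose E (i : 'I_N.+1) := if unlift ord0 i is Some j then v j else f.
have E0 : E ord0 = f by rewrite /E unlift_none.
have Esrc i : exists2 g, G g & forall u, Y u -> eval_at (E i) u = eval_at f (act g u).
  rewrite /E; case: unliftP => [j _|_]; last first.
    by exists (gone o) => // u Yu; rewrite (gvar_one hY).
  by have [_ [g [Gg hg]]] := lin_src linv j; exists g.
have Ez i : eval_at (E i) z = 0 by have [g Gg ->] := Esrc i; auto.
have Etr i g : G g -> exists c : 'I_N.+1 -> k,
    forall u, Y u -> eval_at (E i) (act g u) = \sum_j c j * eval_at (E j) u.
  move=> Gg; have [c hc] : exists c : 'I_N -> k,
      forall u, Y u -> eval_at (E i) (act g u) = \sum_j c j * eval_at (v j) u.
    rewrite /E; case: unliftP => [j _|_].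
      by exists (evmx C g j) => u Yu; rewrite (lin_act linv).
    have [c hc] := lin_span linv ord0.
    exists (fun j => \sum_i c i * evmx C g i j) => u Yu; rewrite hc; auto.
    under eq_bigr => j _ do rewrite (lin_act linv) // mulr_sumr.
    rewrite exchange_big; apply: eq_bigr => j _; rewrite mulr_suml.
    by apply: eq_bigr => l _; rewrite mulrA.
  exists (fun j => if unlift ord0 j is Some l then c l else 0) => u Yu.
  rewrite hc // big_ord_recl unlift_none mul0r add0r; apply: eq_bigr => j _.
  by rewrite liftK /E liftK.
have [D hD] := orbit_map hY Yy.
pose V i := polycomp (E i) D.
have VE i g : G g -> eval_at (V i) g = eval_at (E i) (act g y).
  by move=> Gg; rewrite ev_comp hD.
pose T := ('I_N.+1 + 'I_N.+1 * 'I_N.+1 * 'I_m)%type.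
pose fT (a : T) := match a with inl i => V i | inr a => V a.1.1 * V a.1.2 * q a.2 end.
pose fl (a : 'I_#|{: T}|) := fT (enum_val a).
have flE (a : T) : fl (enum_rank a) = fT a by rewrite /fl enum_rankK.
have [inv0 sepH] := sep0.
have qinv j g h' : G g -> H h' -> eval_at (q j) (gmul o g h') = eval_at (q j) g.
  move=> Gg Hh; have Gh := HGe Hh; have [a [g' [Gg' hq]]] := lin_src linq j.
  by rewrite !hq; auto; rewrite (aag_mulA hG) // inv0; auto.
have Vinv j g h' : G g -> H h' -> eval_at (V j) (gmul o g h') = eval_at (V j) g.
  move=> Gg Hh; have Gh := HGe Hh.
  by rewrite (VE _ _ (GM Gg Gh)) VE // (gvar_mul hY) // Hy.
have sep : separates o G H fl.
  split=> [a g h' Gg Hh|g0 Gg0 hg0].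
    rewrite /fl /fT; case: (enum_val a) => [i|[[i j] l]]; first exact: Vinv.
    by rewrite !evM /= !Vinv // qinv.
  (* At [g1] the factor [V ord0] can be cancelled, which recovers the values of the [q l]; these
     determine the values at every other point because the span of [q] is stable under
     translations. *)
  have V0 : eval_at (V ord0) g1 != 0 by rewrite VE // E0.
  have e0 : eval_at (V ord0) (gmul o g1 g0) = eval_at (V ord0) g1.
    by have := hg0 (enum_rank (inl ord0 : T)) g1 Gg1; rewrite flE.
  have eq0 l : eval_at (q l) (gmul o g1 g0) = eval_at (q l) g1.
    have := hg0 (enum_rank (inr (ord0, ord0, l) : T)) g1 Gg1; rewrite flE /= !evM e0.
    by move/mulfI; apply; rewrite mulf_neq0.
  apply: sepH => // a g Gg; have [c hc] := lin_span linq a.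
  rewrite !hc; auto; apply: eq_bigr => l _; congr (_ * _).
  have Gg' : G (gmul o g (ginv o g1)) by auto.
  rewrite -[in LHS](gmulgVK hG Gg1 Gg) -(aag_mulA hG) // (lin_act linq); auto.
  rewrite -[in RHS](gmulgVK hG Gg1 Gg) (lin_act linq) //.
  by apply: eq_bigr => j _; rewrite eq0.
have [M' [q' [A' [lin' emb actE]]]] := function_embedding hG HG sep.
eexists; eexists; eexists; eexists; split; first exact: emb.
move=> triv.
(* If all of [q'] vanished at one point of [G], translating would make its span vanish everywhere,
   against [V ord0] at [g1]. So 0 is not in the orbit, nor in its closure if the embedding is
   trivial. *)
have n0 : ~ zclosure (image_of (polymap q') G) 0.
  move/triv => [g Gg]; rewrite actE // => /rowP g0.
  have [c hc] := lin_span lin' (enum_rank (inl ord0 : T)).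
  have := hc g1 Gg1; rewrite flE /= VE // E0 big1 => [e1|i _]; first by rewrite e1 eqxx in f1.
  rewrite -(gmulgVK hG Gg Gg1) (lin_act lin'); auto.
  rewrite big1 ?mulr0 // => j _.
  by have := g0 j; rewrite !mxE => <-; rewrite mulr0.
have [P hP P0] : exists2 P, vanishes (image_of (polymap q') G) P & eval_at P 0 = 1.
  apply: NNPP => no; apply: n0 => P hP; apply/eqP; apply: contraT => P0; case: no.
  exists ((eval_at P 0)^-1 *: P); last by rewrite evZ mulVf.
  by move=> u hu; rewrite evZ (hP _ hu) mulr0.
have nf : ~ colon O r0 f.
  move=> hf; have := hf _ (ex_intro2 _ _ g1 Gg1 erefl); rewrite evM => /eqP.
  by rewrite mulf_eq0 (negbTE f1) orbF => /eqP r1; rewrite r1 mul0r eqxx in rh1.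
have if0 : iota f != 0 by apply/eqP => /iota0.
have ih0 : iota h != 0 by apply/eqP => /iota0.
(* [S] is the blow-up chart generated over the image of [k[Y]] by the [E i / f], and [S'] is its
   ideal generated by [f]. *)
pose S (x : F) := exists d rho, ipow E d rho /\ x * iota f ^+ d = iota rho.
pose S' (x : F) := exists2 x', S x' & x = iota f * x'.
have ipf : ipow E 1 f by rewrite -E0; apply: ipow_gen.
have ipfX d : ipow E d (f ^+ d).
  elim: d => [|d IH]; first by constructor.
  by rewrite exprS; apply: (ipowM (d := 1)).
have Si a : S (iota a) by exists 0%N, a; split; [constructor | rewrite expr0 mulr1].
have S1 : S 1 by rewrite -(rmorph1 iota).
have SM x1 x2 : S x1 -> S x2 -> S (x1 * x2).
  move=> [d [r [hr er]]] [d' [r' [hr' er']]]; exists (d + d')%N, (r * r').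
  by split; [apply: ipowM | rewrite rmorphM -er -er' exprD mulrACA].
have SD x1 x2 : S x1 -> S x2 -> S (x1 + x2).
  move=> [d [r [hr er]]] [d' [r' [hr' er']]].
  exists (d + d')%N, (r * f ^+ d' + f ^+ d * r'); split.
    by apply: ipowD; apply: ipowM.
  by rewrite rmorphD !rmorphM /= -er -er' !rmorphXn exprD /=; ring.
have SB x1 x2 : S x1 -> S x2 -> S (x1 - x2).
  by move=> h1 h2; apply: SD => //; rewrite -mulN1r -(rmorphN1 iota); apply: SM.
have SE i : S (iota (E i) / iota f).
  by exists 1%N, (E i); rewrite expr1 divfK //; split=> //; apply: ipow_gen.
have S'0 : S' 0 by exists 0; rewrite ?mulr0 // -(rmorph0 iota).
have S'D x1 x2 : S' x1 -> S' x2 -> S' (x1 + x2).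
  by move=> [x3 h3 ->] [x4 h4 ->]; exists (x3 + x4); rewrite ?mulrDr //; apply: SD.
have S'M x1 x2 : S x1 -> S' x2 -> S' (x1 * x2).
  by move=> h1 [x3 h3 ->]; exists (x1 * x3); [apply: SM | rewrite mulrCA].
have S'S x1 : S' x1 -> S x1 by move=> [x2 h2 ->]; apply: SM.
pose good Q := acts_in M e S' (map_mpoly iota Q).
have good0 : good 0 by rewrite /good raddf0 -mpolyC0; apply: acts_in_const.
have goodD Q Q' : good Q -> good Q' -> good (Q + Q').
  by move=> h1 h2; rewrite /good (rmorphD (map_mpoly iota)); apply: acts_inD.
have S0 : S 0 by rewrite -(rmorph0 iota).
have goodZ c Q : good Q -> good (c%:MP * Q).
  move=> h1; rewrite /good (rmorphM (map_mpoly iota)) /= map_mpolyC mulrC.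
  apply: (acts_inM hM (S := S) (T := S')) => //.
  by apply: acts_in_const => //; exact: Si.
have good_sum (J : finType) (Q : J -> {mpoly {mpoly k[s]}[m]}) :
    (forall j, good (Q j)) -> good (\sum_j Q j).
  by move=> h1; elim/big_rec: _ => [|j x _]; [exact: good0 | apply: goodD].
have goodE i : good (E i)%:MP.
  rewrite /good map_mpolyC; apply: acts_in_const => //.
  by exists (iota (E i) / iota f); [exact: SE | rewrite mulrC divfK].
(* The entries are [E_i E_j x / h = f (E_i / f) (E_j / f) (f / h) x], and [f / h] is the image of
   [r0 b1]. *)
have goodEX i j l : good ((E i * E j)%:MP * 'X_l).
  move=> a; have [x hx'] := hx l a; pose c := iota (E i * E j) / iota h.
  exists (fun a' => c * iota (x a')); split=> [a'|].
    exists (iota (E i) / iota f * (iota (E j) / iota f) * iota (x a' * (r0 * b1))).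
      by apply: (SM) => //; apply: SM.
    have fE : iota f = iota r0 * iota h * iota b1 by rewrite fdef !rmorphM.
    have : (iota r0 * iota h * iota b1) != 0 by rewrite -fE.
    rewrite !mulf_eq0 !negb_or => /andP[/andP[r00 _] b10].
    rewrite /c fE !rmorphM /=; field.
    by rewrite r00 b10 ih0.
  have := idealM hM c%:MP hx'; congr M.
  rewrite mulrBr; congr (_ - _); last first.
    by rewrite mulr_sumr; apply: eq_bigr => a' _; rewrite mulrA -rmorphM.
  rewrite (rmorphM (map_mpoly iota)) /= map_mpolyC map_mpolyX !mulrA -rmorphM /=.
  by rewrite divfK.
have hQ i : exists Q, (forall g, G g -> ev2 (act g y) (p g) Q = eval_at (q' i) g) /\ good Q.
  have [a [g' [Gg' hq']]] := lin_src lin' i.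
  have Emul j : exists c : 'I_N.+1 -> k, forall g, G g ->
      eval_at (V j) (gmul o g' g) = \sum_l c l * eval_at (E l) (act g y).
    have [c hc] := Etr j g' Gg'; exists c => g Gg.
    by rewrite VE; auto; rewrite (gvar_mul hY) // hc; auto.
  move: hq'; rewrite /fl /fT; case: (enum_val a) => [j|[[j j'] l]] hq'.
    have [c hc] := Emul j; exists (\sum_l (c l)%:MP%:MP * (E l)%:MP); split.
      move=> g Gg; rewrite hq' // hc // rmorph_sum; apply: eq_bigr => l _.
      by rewrite (rmorphM (ev2 _ _)) !ev2C evC.
    by apply: good_sum => l; apply: goodZ.
  have [c hc] := Emul j; have [c' hc'] := Emul j'.
  exists (\sum_a1 \sum_a2 \sum_a3 (c a1 * c' a2 * evmx B g' l a3)%:MP%:MP *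
     ((E a1 * E a2)%:MP * 'X_a3)); split; last first.
    by do 3!(apply: (good_sum) => ?); apply: goodZ.
  move=> g Gg; rewrite hq' // !evM /= hc // hc' // (lin_act linq) //.
  rewrite -mulrA mulr_suml rmorph_sum; apply: eq_bigr => a1 _.
  rewrite mulr_suml mulr_sumr rmorph_sum; apply: eq_bigr => a2 _.
  rewrite [X in _ = _ * X]mulr_sumr [RHS]mulr_sumr rmorph_sum; apply: eq_bigr => a3 _.
  rewrite !(rmorphM (ev2 _ _)) !ev2C evM evC ev2X /p; ring.
have [Q hQ'] := choice_fun hQ.
pose QP : {rmorphism {mpoly k[M']} -> {mpoly {mpoly k[s]}[m]}} :=
  mmap (@mpolyC m {mpoly k[s]} \o @mpolyC s k) Q.
have QPC c : QP c%:MP = c%:MP%:MP by rewrite /QP /= mmapC.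
have QPX i : QP 'X_i = Q i by rewrite /QP /= mmapX mmap1U.
clearbody QP.
have QPev P' g : G g -> ev2 (act g y) (p g) (QP P') = eval_at P' (polymap q' g).
  move=> Gg; elim/mpoly_gen_ind: P' => [c|i|P1 P2 h1 h2|P1 P2 h1 h2].
  - by rewrite QPC ev2C !evC.
  - by rewrite QPX evX mxE (hQ' i).1.
  - by rewrite (rmorphD QP) (rmorphD (ev2 _ _)) h1 h2 evD.
  - by rewrite (rmorphM QP) (rmorphM (ev2 _ _)) h1 h2 evM.
(* The [Q i] are [good], and [good] elements are closed under products and under combinations with
   coefficients in [k[Y]]; hence only the constant term is left over. *)
have QPgood P' : good (QP P' - (eval_at P' 0)%:MP%:MP).
  elim/mpoly_gen_ind: P' => [c|i|P1 P2 h1 h2|P1 P2 h1 h2]; rewrite !evE.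
  - by rewrite QPC subrr.
  - by rewrite QPX mxE !rmorph0 subr0; case: (hQ' i).
  - rewrite (rmorphD QP) !rmorphD opprD addrACA; exact: goodD.
  set c1 := eval_at P1 0 in h1 *; set c2 := eval_at P2 0 in h2 *.
  have -> : QP (P1 * P2) - (c1 * c2)%:MP%:MP =
     c2%:MP%:MP * (QP P1 - c1%:MP%:MP) + c1%:MP%:MP * (QP P2 - c2%:MP%:MP)
     + (QP P1 - c1%:MP%:MP) * (QP P2 - c2%:MP%:MP).
    by rewrite (rmorphM QP) !rmorphM /=; ring.
  apply: (goodD); first by apply: (goodD); apply: goodZ.
  rewrite /good (rmorphM (map_mpoly iota)).
  apply: (acts_inM hM (S := S') (T := S')) h1 h2 => // x1 x2 h1 h2.
  by apply: S'M => //; apply: S'S.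
have MP : M (map_mpoly iota (QP P)).
  by apply: relM => g Gg; rewrite QPev // hP ?mulr0 //; exists g.
have := QPgood P; rewrite P0 !rmorph1 => hgood.
(* [QP P] lies in [M] and differs from the value 1 of [P] at 0 by a [good] element, so [f] would be
   invertible in [S]. *)
have [x [d [rho [hrho ex]]] e1] : S' (-1).
  apply: (acts_in_unit hM M1 span (S := S) S1 SB SM S'0 S'D S'M S'S hgood).
  by rewrite (rmorphB (map_mpoly iota)) rmorph1 addrC subrK.
apply: nf; apply: (translates_contradiction Etr hr0 pz Ez E0 Esrc hrho).
have hc : colon O r0 (f ^+ d + f * rho).
  apply/iota0; rewrite rmorphD rmorphXn rmorphM /= -ex mulrA -e1 mulN1r subrr //.
move=> u Ou; have -> : f ^+ d.+1 + f * f * rho = h * b1 * (r0 * (f ^+ d + f * rho)).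
  by rewrite exprS -mulrA -mulrDr {1}fdef; ring.
by rewrite evM hc ?mulr0.
Qed.

End Degeneration.

(** * Semi-invariants *)

Section Semiinvariants.
Variables (k : closedFieldType) (n : nat) (o : group_ops k n) (G : pset k n).
Hypothesis hG : affine_algebraic_group o G.

Let G1 := aag_one hG.
Let GM := aag_mul hG.
Let GV := aag_inv hG.
#[local] Hint Resolve G1 GM GV : core.

Definition semiinvariant (H : pset k n) (chi : 'rV[k]_n -> k) (f : {mpoly k[n]}) : Prop :=
  forall g h, G g -> H h -> eval_at f (gmul o g h) = chi h * eval_at f g.

(* Chevalley: H is the stabiliser, under right translations, of the space E of functions
   vanishing on H inside a finite-dimensional space of functions. With E0 a basis of E and
   A'(g) the matrix of the translation, E0 A'(h) = t(h) E0 on H, so every det(E0 A'(g) D)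
   with D constant is semi-invariant of weight det t. *)
Theorem chevalley (H : pset k n) : algebraic_subgroup o G H ->
  exists (chi : 'rV[k]_n -> k) (b0 : {mpoly k[n]}) t (b : 'I_t -> {mpoly k[n]}),
    [/\ semiinvariant H chi b0, forall i, semiinvariant H chi (b i),
      (forall h, H h -> chi h != 0), eval_at b0 (gone o) != 0 &
      (forall h i, H h -> eval_at (b i) h = 0) /\
      forall g, G g -> eval_at b0 g != 0 -> (forall i, eval_at (b i) g = 0) -> H g].
Proof.
move=> hH; have HG := asub_sub hH; have [I hI] := asub_closed hH.
have [s sI Is] := @mpoly_noetherian k n I.
have sH x : H x <-> forall p, p \in s -> eval_at p x = 0.
  split=> [/hI h p /sI|h]; first exact: h.
  apply/hI => p /Is; apply: (gen_ideal_min (J := fun p => eval_at p x = 0)) => //.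
  by split=> [|p' q' hp hq|a p' hp]; rewrite ?evE ?hp ?hq ?addr0 ?mulr0.
pose f (i : 'I_(size s)) := nth 0 s i.
have [M [q [A lin]]] := linearization_exists hG (right_variety hG) f.
have [V hV] := inv_polys hG.
pose PA : 'M[{mpoly k[n]}]_M := \matrix_(i, j) polycomp (A i j) V.
pose ev (g : 'rV[k]_n) : {rmorphism {mpoly k[n]} -> k} := meval (fun i => g 0 i).
have evPA g : G g -> map_mx (ev g) PA = evmx A (ginv o g).
  move=> Gg; apply/matrixP => i j; rewrite !mxE hV //; exact: ev_comp.
have tr g y i : G g -> G y ->
    eval_at (q i) (gmul o y g) = \sum_j map_mx (ev g) PA i j * eval_at (q j) y.
  move=> Gg Gy; rewrite evPA //.
  by have /= := lin_act lin i (GV Gg) Gy; rewrite (ginvK hG).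
have PAM g h : G g -> G h ->
    map_mx (ev (gmul o g h)) PA = map_mx (ev h) PA *m map_mx (ev g) PA.
  by move=> Gg Gh; rewrite !evPA ?(ginvM hG) ?(lin_mul lin); auto.
have PA1 : map_mx (ev (gone o)) PA = 1%:M by rewrite evPA // (ginv1 hG) (lin_one lin).
have [B hB] := @subspace_mx k M
  (fun c => forall y, H y -> \sum_i c 0 i * eval_at (q i) y = 0)
  ltac:(by move=> y _; rewrite big1 // => i _; rewrite mxE mul0r)
  ltac:(move=> u v hu hv y Hy; under eq_bigr => i _ do rewrite mxE mulrDl;
        by rewrite big_split /= hu // hv // addr0)
  ltac:(move=> a u hu y Hy; under eq_bigr => i _ do rewrite mxE -mulrA;
        by rewrite -mulr_sumr hu // mulr0).
set r := \rank B; pose E0 := row_base B.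
have [E1 E01] := row_freeP (row_base_free B).
pose C := cokermx B.
have subB (u : 'rV_M) : (u <= B)%MS = (u *m C == 0) by rewrite submxE.
have E0B : (E0 :=: B)%MS := eq_row_base B.
have HB h : H h -> (E0 *m map_mx (ev h) PA <= B)%MS.
  move=> Hh; apply/row_subP => i; rewrite row_mul.
  have /hB hi : (row i E0 <= B)%MS by rewrite -E0B row_sub.
  apply/hB => y Hy; rewrite -[RHS](hi (gmul o y h)); last exact: (asub_mul hH).
  rewrite [RHS](eq_bigr (fun j => \sum_l (row i E0) 0 j *
    (map_mx (ev h) PA j l * eval_at (q l) y))); last first.
    by move=> j _; rewrite tr ?mulr_sumr; auto.
  rewrite exchange_big; apply: eq_bigr => j _; rewrite mxE mulr_suml.
  by apply: eq_bigr => l _; rewrite mulrA.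
pose PD (D : 'M[k]_(M, r)) := \det (map_mx (@mpolyC n k) E0 *m PA *m map_mx (@mpolyC n k) D).
pose EA g := E0 *m map_mx (ev g) PA.
have mapC g a c (D : 'M[k]_(a, c)) : map_mx (ev g) (map_mx (@mpolyC n k) D) = D.
  by apply/matrixP => i j; rewrite !mxE; exact: mevalC.
have evPD D g : eval_at (PD D) g = \det (EA g *m D).
  have -> : eval_at (PD D) g = ev g (PD D) by [].
  by rewrite /PD -det_map_mx !map_mxM !mapC.
pose tt h := EA h *m E1.
have Ht h : H h -> EA h = tt h *m E0.
  move=> /HB; rewrite -E0B => /submxP[D e]; rewrite /tt /EA e.
  by rewrite -[D *m E0 *m E1]mulmxA E01 mulmx1.
have EAM g h : G g -> H h -> EA (gmul o g h) = tt h *m EA g.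
  by move=> Gg Hh; rewrite {1}/EA PAM; auto; rewrite mulmxA -/(EA h) Ht // -!mulmxA.
have EA1 : EA (gone o) = E0 by rewrite /EA PA1 mulmx1.
pose chi h := \det (tt h).
have semi D : semiinvariant H chi (PD D).
  by move=> g h Gg Hh; rewrite !evPD EAM // -mulmxA det_mulmx.
(* [E1] with column [i] replaced by column [j] of [C]. On [H] this makes a column of the product
   with [E0] vanish; at a general [g], expansion along that column yields an entry of
   [\adj (tt g) *m (EA g *m C)]. *)
pose DC (i : 'I_r) (j : 'I_M) : 'M[k]_(M, r) := \matrix_(a, c) if c == i then C a j else E1 a c.
exists chi, (PD E1), #|{: 'I_r * 'I_M}|, (fun i => PD (DC (enum_val i).1 (enum_val i).2)); split.
- exact: semi.
- by move=> i; apply: semi.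
- move=> h Hh; have := semi E1 _ _ (HG _ (asub_inv hH Hh)) Hh.
  rewrite (aag_mulVg hG) ?evPD; last exact: HG.
  by rewrite EA1 E01 det1 => e; apply: contra_eq_neq e => ->; rewrite mul0r oner_eq0.
- by rewrite evPD EA1 E01 det1 oner_neq0.
split=> [h i Hh|g Gg].
  rewrite evPD Ht // -mulmxA det_mulmx; set i' := (enum_val i).1; set j := (enum_val i).2.
  suff -> : \det (E0 *m DC i' j) = 0 by rewrite mulr0.
  have E0C : E0 *m C = 0.
    by apply/row_matrixP => l; rewrite row_mul row0; apply/eqP; rewrite -subB -E0B row_sub.
  rewrite (expand_det_col _ i') big1 // => l _.
  have -> : (E0 *m DC i' j) l i' = (E0 *m C) l j.
    by rewrite [LHS]mxE [RHS]mxE; apply: eq_bigr => a _; rewrite [DC _ _ _ _]mxE eqxx.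
  by rewrite E0C mxE mul0r.
move=> + hb; rewrite evPD -/(tt g) => d0.
have low0 : EA g *m C = 0.
  have : \adj (tt g) *m (EA g *m C) = 0.
    apply/matrixP => i j; rewrite [RHS]mxE -(hb (enum_rank (i, j))) enum_rankK /= evPD.
    rewrite (expand_det_col _ i) mxE; apply: eq_bigr => l _; rewrite mxE mulrC.
    congr (_ * _); first by rewrite [LHS]mxE [RHS]mxE; apply: eq_bigr => a _; rewrite [DC _ _ _ _]mxE eqxx.
    rewrite /cofactor; congr (_ * \det _); apply/matrixP => a c; rewrite !mxE.
    by apply: eq_bigr => b _; rewrite [DC _ _ _ _]mxE eq_sym (negbTE (neq_lift _ _)).
  move/(congr1 (mulmx (tt g))); rewrite mulmxA mul_mx_adj mul_scalar_mx mulmx0 => /eqP.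
  by rewrite scalemx_eq0 (negbTE d0) => /eqP.
apply/sH => p ps; have ip : (index p s < size s)%N by rewrite index_mem.
have [c hc] := lin_span lin (Ordinal ip).
have fp : f (Ordinal ip) = p by rewrite /f /= nth_index.
rewrite fp in hc; have cB : (\row_i c i <= B)%MS.
  apply/hB => y Hy; transitivity (eval_at p y); last by move/sH: Hy; apply.
  by rewrite hc; auto; apply: eq_bigr => i _; rewrite mxE.
have : ((\row_i c i) *m map_mx (ev g) PA <= B)%MS.
  rewrite subB; move: cB; rewrite -E0B => /submxP[D ->].
  by move: low0; rewrite /EA -!mulmxA => ->; rewrite mulmx0.
(* The translate by [g] of a function vanishing on [H] again vanishes on [H]; at the neutral element
   this says that the function vanishes at [g]. *)
move/hB => /(_ _ (asub_one hH)) e.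
rewrite hc // -(aag_mul1g hG Gg) -[RHS]e.
rewrite (eq_bigr (fun i => \sum_j c i * (map_mx (ev g) PA i j * eval_at (q j) (gone o))));
  last by move=> i _; rewrite tr // mulr_sumr.
rewrite exchange_big; apply: eq_bigr => j _; rewrite mxE mulr_suml.
by apply: eq_bigr => i _; rewrite !mxE mulrA.
Qed.

Lemma colon_prime_prod m (Y : pset k m) r (I : Type) (s : seq I) (P : I -> {mpoly k[m]}) :
  colon_prime Y r -> (forall i, ~ colon Y r (P i)) -> ~ colon Y r (\prod_(i <- s) P i).
Proof.
move=> hr hP; elim/big_ind: _ => //; first exact: cprime1.
by move=> p q hp hq /(cprimeM hr)[].
Qed.

(* As G/H is quasi-affine, a product b c, c a function on G, descends to G/H: apply the
   lemma on fibre products to the graph of 1/b. Then b c^2 has the weight inverse to b. *)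
Theorem dual_weight (H : pset k n) m (X : pset k m) act x chi b g1 :
  psubset H G -> affine_G_variety o G X act -> X x ->
  (forall g, G g -> (act g x = x <-> H g)) -> (forall h, H h -> chi h != 0) ->
  semiinvariant H chi b -> G g1 -> eval_at b g1 != 0 ->
  exists2 f, semiinvariant H (fun h => (chi h)^-1) f & exists2 g, G g & eval_at f g != 0.
Proof.
move=> HG hX Xx stab chi0 semi Gg1 bg1.
have [F hF] := orbit_map hX Xx; pose Y := orbit_of G act x.
have YF g : G g -> Y (polymap F g) by move=> Gg; exists g; rewrite ?hF.
have [r0 hr0 _] := exists_colon_prime (sub_zclosure (orbit_self hG hX Xx)).
(* Some translate of [b] is not torsion over [k[Y]]: otherwise the product of annihilators of
   finitely many translates spanning all of them would kill the value of [b] at [g1]. *)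
have [g0 Gg0 nontors] : exists2 g0, G g0 & forall p, ~ colon Y r0 p ->
    exists2 g, G g & eval_at p (polymap F g) * eval_at b (gmul o g0 g) != 0.
  apply: NNPP => no.
  have tors g0 : exists p, G g0 -> ~ colon Y r0 p /\ forall g, G g ->
      eval_at p (polymap F g) * eval_at b (gmul o g0 g) = 0.
    case: (classic (G g0)) => [Gg0|nG]; last by exists 0.
    apply: NNPP => h; apply: no; exists g0 => // p np; apply: NNPP => h'.
    apply: h; exists p => _; split=> // g Gg; apply/eqP; apply: contraT => ne.
    by case: h'; exists g.
  have [p hp] := choice_fun tors.
  have [M [q [A lin]]] := linearization_exists hG (left_variety hG) (fun _ : 'I_1 => b).
  have [a ha] := choice_fun (lin_src lin); have [h hh] := choice_fun ha.
  have Gh i : G (h i) by case: (hh i).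
  pose P := \prod_i p (h i).
  have nP : ~ colon Y r0 P.
    by apply: colon_prime_prod => // i; case: (hp _ (Gh i)).
  have Pq g i : G g -> eval_at P (polymap F g) * eval_at (q i) g = 0.
    move=> Gg; rewrite /P (bigD1 i) //= evM mulrAC (hh i).2 // (hp _ (Gh i)).2 ?mul0r //.
  apply: nP; apply: vanishes_colon => _ [g Gg ->]; rewrite hF //.
  have [c hc] := lin_span lin ord0.
  have : eval_at P (polymap F g) * eval_at b g1 = 0.
    rewrite -(gmulgVK hG Gg Gg1) hc; last by auto.
    rewrite mulr_sumr big1 // => i _; rewrite (lin_act lin); auto.
    rewrite !mulr_sumr big1 // => j _.
    by rewrite mulrCA [X in _ * X]mulrCA Pq // !mulr0.
  by move/eqP; rewrite mulf_eq0 (negbTE bg1) orbF => /eqP.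
have [b0 hb0] := regular2_right b (aag_mul_regular hG) Gg0.
pose eqn : {mpoly k[n + 1]} := inr_poly n 'X_ord0 * inl_poly 1 b0 - 1.
pose G' : pset k (n + 1) := fun z => G (lsubmx z) /\ eval_at eqn z = 0.
have clG' : zariski_closed G'.
  exists (vanishes G') => z; split=> [Gz p|hz]; first exact.
  split; last by apply: hz => y [].
  apply: (closedP (aag_closed hG)) => p hp; rewrite -(ev_inl p _ (rsubmx z)) hsubmxK.
  by apply: hz => y [Gy _]; rewrite -(hsubmxK y) ev_inl; apply: hp.
pose zeta j := inl_poly 1 (F j).
have zF z : polymap zeta z = polymap F (lsubmx z).
  by apply/rowP => j; rewrite !mxE -{1}(hsubmxK z) ev_inl.
have eqnE g t : eval_at eqn (row_mx g t) = t 0 0 * eval_at b0 g - 1.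
  by rewrite evB evM ev_inr ev_inl evX ev1.
have semi0 g h : G g -> H h -> eval_at b0 (gmul o g h) = chi h * eval_at b0 g.
  move=> Gg Hh; have Gh := HG _ Hh; rewrite -!hb0; auto.
  by rewrite (aag_mulA hG) // semi; auto.
have [|||p np [c hc]] := @fibre_product k n (n + 1) m 1 G G' Y r0 F zeta (fun=> b0)
    (aag_closed hG) clG' hr0 YF.
- by move=> z [Gz _]; rewrite zF; apply: YF.
- move=> p hp; apply: NNPP => /nontors[g Gg]; rewrite hb0 // mulf_eq0 negb_or => /andP[pg bg].
  have G'z : G' (row_mx g (const_mx (eval_at b0 g)^-1)).
    by split; rewrite ?row_mxKl // eqnE mxE mulVf ?subrr.
  by have := hp _ G'z; rewrite ev_comp zF row_mxKl => e; rewrite e eqxx in pg.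
- move=> g z Gg [Gz]; rewrite -{1}(hsubmxK z) eqnE zF; set g' := lsubmx z in Gz *.
  move=> ez /(_ ord0) bg0 e.
  have Hh : H (gmul o (ginv o g') g).
    apply/stab; auto; rewrite (gvar_mul hX) ?hF // ?e -?hF ?(act_invK hG hX); auto.
  move: bg0; rewrite -(gmulVK hG Gz Gg) semi0 // => /eqP.
  rewrite mulf_eq0 (negbTE (chi0 _ Hh)) /= => /eqP b0'.
  by move/eqP: ez; rewrite b0' mulr0 sub0r oppr_eq0 oner_eq0.
have {}hc g : G g -> eval_at p (polymap F g) = eval_at b0 g * eval_at (c ord0) g.
  by move=> Gg; rewrite hc // big_ord1.
(* As [b0 c] is invariant, [c] has the inverse weight wherever [b0] is nonzero. The factor [b0 c]
   extends this to the zeros of [b0], where both sides are 0. *)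
exists (b0 * c ord0 * c ord0).
  move=> g h Gg Hh; rewrite !evM semi0 //.
  have := hc _ (GM Gg (HG _ Hh)); rewrite semi0 // -hF; auto; rewrite (gvar_mul hX); auto.
  have /(stab _ (HG _ Hh)) -> := Hh; rewrite hF // hc //.
  have := chi0 _ Hh; set X0 := chi h; set B := eval_at b0 g; set C := eval_at _ g.
  set C' := eval_at _ (gmul o g h) => X0n e.
  rewrite -e; have [->|Bn] := eqVneq B 0; first by rewrite !(mulr0, mul0r).
  have -> : C = X0 * C' by apply: (mulfI Bn); rewrite e mulrCA mulrA.
  by rewrite [X0^-1 * _]mulrCA [X0^-1 * _]mulrA mulVf // mul1r.
apply: NNPP => no; apply: np; apply: vanishes_colon => _ [g Gg ->].
rewrite hF // hc //; apply/eqP; apply: contraT; rewrite mulf_eq0 negb_or => /andP[Bn Cn].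
by case: no; exists g => //; rewrite !evM !mulf_neq0.
Qed.

End Semiinvariants.

Section Weights.
Variables (k : closedFieldType) (n : nat) (o : group_ops k n) (G : pset k n).
Hypothesis hG : affine_algebraic_group o G.

(** A translate of [f] that is nonzero at the neutral element, multiplied by [b0] and the [b i],
    gives invariants. Comparing their values at [g0] and at the neutral element recovers the
    conditions that define [H]. *)
Lemma separates_of_weights (H : pset k n) chi b0 t (b : 'I_t -> {mpoly k[n]}) f g1 :
  algebraic_subgroup o G H ->
  semiinvariant o G H chi b0 -> (forall i, semiinvariant o G H chi (b i)) ->
  (forall h, H h -> chi h != 0) -> eval_at b0 (gone o) != 0 ->
  (forall h i, H h -> eval_at (b i) h = 0) ->
  (forall g, G g -> eval_at b0 g != 0 -> (forall i, eval_at (b i) g = 0) -> H g) ->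
  semiinvariant o G H (fun h => (chi h)^-1) f -> G g1 -> eval_at f g1 != 0 ->
  exists t' (f' : 'I_t' -> {mpoly k[n]}), separates o G H f'.
Proof.
move=> hH sb0 sb chi0 b01 bH Hb sf Gg1 fg1; have HG := asub_sub hH.
have G1 := aag_one hG; have GM := aag_mul hG.
have [f1 hf1] := regular2_right f (aag_mul_regular hG) Gg1.
have f11 : eval_at f1 (gone o) != 0 by rewrite -hf1 // (aag_mulg1 hG).
have sf1 : semiinvariant o G H (fun h => (chi h)^-1) f1.
  move=> g h Gg Hh; have Gh := HG _ Hh.
  by rewrite -!hf1; auto; rewrite (aag_mulA hG) // sf; auto.
exists t.+1, (fun i => f1 * if unlift ord0 i is Some j then b j else b0); split.
  move=> a g h Gg Hh; rewrite !evM sf1 //.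
  have -> : eval_at (if unlift ord0 a is Some j then b j else b0) (gmul o g h) =
    chi h * eval_at (if unlift ord0 a is Some j then b j else b0) g.
    by case: unliftP => [j|] _; [apply: sb | apply: sb0].
  by rewrite mulrACA mulVf ?mul1r ?chi0.
move=> g0 Gg0 h.
have := h ord0 _ G1; rewrite unlift_none (aag_mul1g hG) // !evM => e0.
have : eval_at f1 g0 * eval_at b0 g0 != 0 by rewrite e0 mulf_neq0.
rewrite mulf_eq0 negb_or => /andP[f10 b00]; apply: Hb => // i.
have := h (lift ord0 i) _ G1; rewrite liftK (aag_mul1g hG) // !evM.
rewrite (bH _ _ (asub_one hH)) mulr0 => /eqP.
by rewrite mulf_eq0 (negbTE f10) => /eqP.
Qed.

End Weights.

(** * Levi decompositions *)

Section Levi.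
Variables (k : closedFieldType) (n : nat) (o : group_ops k n) (G H L Gu : pset k n).
Variable phi : 'rV[k]_n -> 'rV[k]_n.
Hypothesis char_k0 : [pchar k] =i pred0.
Hypotheses (hG : affine_algebraic_group o G) (hH : algebraic_subgroup o G H).
Hypotheses (hLevi : levi_decomposition o G L Gu) (hphi : levi_projection o G L Gu phi).

Let K := image_of phi H.
Let HG := asub_sub hH.
Let LG := asub_sub (levi_subgroup hLevi).
Let hL := subgroup_group hG (levi_subgroup hLevi).
Let hGu : algebraic_subgroup o G Gu := cnu_subgroup (levi_radical hLevi).1.
Let GuG := asub_sub hGu.
Let gGu := subgroup_group hG hGu.
Let unip : unipotent_group o Gu := cnu_unipotent (levi_radical hLevi).1.
Let Gu_normal : normal_in o G Gu := cnu_normal (levi_radical hLevi).1.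
Let G1 := aag_one hG.
Let GM := aag_mul hG.
Let GV := aag_inv hG.
Let L1 := aag_one hL.
Let LM := aag_mul hL.
Let LV := aag_inv hL.
Let phiL := lproj_codom hphi.
Let phiM := lproj_mul hphi.
#[local] Hint Resolve G1 GM GV L1 LM LV phiL HG LG GuG : core.

Let HGe h : H h -> G h. Proof. exact: HG. Qed.
Let LGe l : L l -> G l. Proof. exact: LG. Qed.
Let GuGe u : Gu u -> G u. Proof. exact: GuG. Qed.
#[local] Hint Resolve HGe LGe GuGe : core.

Let phi1 : phi (gone o) = gone o. Proof. exact: (lproj_id hphi). Qed.

Let phiV g : G g -> phi (ginv o g) = ginv o (phi g).
Proof.
move=> Gg; apply: (ginv_unique hG); auto.
by rewrite -phiM ?(aag_mulgV hG); auto.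
Qed.

Let phiu u : Gu u -> phi u = gone o.
Proof. by move=> Gu_u; apply/(lproj_ker hphi); auto. Qed.

Lemma phi_decomposition g : G g ->
  exists2 u, Gu u & g = gmul o u (phi g).
Proof.
move=> Gg; exists (gmul o g (ginv o (phi g))); last by rewrite (gmulgVK hG); auto.
apply/(lproj_ker hphi); auto.
by rewrite phiM ?phiV ?(lproj_id hphi (phiL Gg)) ?(aag_mulgV hG); auto.
Qed.

Let gconj g u : G g -> Gu u -> exists2 u', Gu u' & gmul o g u = gmul o u' g.
Proof.
move=> Gg Gu_u; exists (gmul o (gmul o g u) (ginv o g)); first exact: Gu_normal.
by rewrite (gmulgVK hG); auto.
Qed.

Let phi_poly f : exists f' : {mpoly k[n]}, forall g, G g -> eval_at f' g = eval_at f (phi g).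
Proof.
have [F hF] := lproj_regular hphi; exists (polycomp f F) => g Gg.
by rewrite ev_comp hF.
Qed.

Lemma K_sub : psubset K L.
Proof. by move=> _ [h Hh ->]; auto. Qed.

Lemma left_invariant_phi (f : {mpoly k[n]}) :
  (forall u g, Gu u -> G g -> eval_at f (gmul o u g) = eval_at f g) ->
  forall g, G g -> eval_at f g = eval_at f (phi g).
Proof.
move=> inv g Gg; have [u Gu_u e] := phi_decomposition Gg.
by rewrite {1}e inv; auto.
Qed.

(** Left translations by [Gu] commute with right translations by [H], so the invariant combination
    of translates keeps the weight. *)
Lemma invariant_semiinvariant chi f g0 : semiinvariant o G H chi f -> G g0 ->
  eval_at f g0 != 0 ->
  exists2 f', semiinvariant o G H chi f' & (exists2 l, L l & eval_at f' l != 0) /\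
    forall g, G g -> eval_at f' g = eval_at f' (phi g).
Proof.
move=> sf Gg0 fg0.
have [f' [s [sG hs]] [[y Gy f'y] inv]] := unipotent_invariant gGu
  (subgroup_variety (left_variety hG) hGu) char_k0 unip Gg0 fg0.
have inv' := left_invariant_phi inv; exists f'.
  move=> g h Gg Hh; rewrite !hs; auto; rewrite mulr_sumr; apply: eq_big_seq => a /sG Ga.
  have Gh := HGe Hh; have GGa := GuGe Ga.
  by rewrite (aag_mulA hG) // sf 1?mulrCA //; apply: GM.
by split=> //; exists (phi y); rewrite -?inv'; auto.
Qed.

(** The point is that [K] is closed. An element [l] of [L] is in [K] exactly when [act l x] is in
    the orbit of [x] under [Gu], which is closed as an orbit of a unipotent group. *)
Lemma K_subgroup m (X : pset k m) act x :
  affine_embedding o G H X act x -> algebraic_subgroup o L K.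
Proof.
move=> hE; have hX := emb_variety hE; have Xx := emb_base hE.
have hXu := subgroup_variety hX hGu.
have closed_orbit := unipotent_orbit_closed gGu hXu char_k0 unip Xx.
have [F hF] := orbit_map hX Xx.
have KP l : L l -> K l <-> orbit_of Gu act x (act l x).
  move=> Ll; split=> [[h Hh e]|[u Gu_u e]].
    have [u Gu_u eh] := phi_decomposition (HGe Hh).
    exists (ginv o u); first exact: (asub_inv hGu).
    have /(emb_stab hE (HGe Hh)) hx := Hh; rewrite -[in RHS]hx [in RHS]eh -e.
    by rewrite (gvar_mul hX) ?(act_invK hG hX); auto; apply: (gvar_stable hX); auto.
  have Hh : H (gmul o (ginv o u) l).
    by apply/(emb_stab hE); auto; rewrite (gvar_mul hX) ?e ?(act_invK hG hX); auto.
  exists (gmul o (ginv o u) l) => //.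
  have Gu' := GuGe Gu_u; have Gl := LGe Ll.
  by rewrite phiM ?(phiV Gu') ?(phiu Gu_u) ?(ginv1 hG) ?(lproj_id hphi Ll) ?(aag_mul1g hG) //; apply: GV.
split; first exact: K_sub.
- exists (fun p => vanishes L p \/
    exists2 P, vanishes (orbit_of Gu act x) P & p = polycomp P F) => l; split.
    move=> Kl p [hp|[P hP ->]]; first exact: hp (K_sub Kl).
    have Ll := K_sub Kl; rewrite ev_comp -hF; last exact: LGe.
    by apply: hP; apply/KP.
  move=> h; have Ll : L l by apply: (closedP (aag_closed hL)) => p hp; apply: h; left.
  apply/KP => //; apply: closed_orbit => P hP.
  by rewrite hF; auto; rewrite -ev_comp; apply: h; right; exists P.
- by exists (gone o) => //; exact: (asub_one hH).
- move=> _ _ [h Hh ->] [h' Hh' ->]; exists (gmul o h h'); first exact: (asub_mul hH).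
  by rewrite phiM; auto.
- move=> _ [h Hh ->]; exists (ginv o h); first exact: (asub_inv hH).
  by rewrite phiV; auto.
Qed.

(* Weights are transported between H and K through functions invariant under Gu, which
   exist in every nonzero space of functions stable under Gu. *)
Theorem observable_levi m (X : pset k m) act x : affine_embedding o G H X act x ->
  exists t (f : 'I_t -> {mpoly k[n]}), separates o L K f.
Proof.
move=> hE; have hK := K_subgroup hE.
have [chi [b0 [t [b [sb0 sb chi0 b01 [bK Kb]]]]]] := chevalley hL hK.
have [pb0 hpb0] := phi_poly b0.
have semi_pb0 : semiinvariant o G H (chi \o phi) pb0.
  move=> g h Gg Hh; rewrite !hpb0 ?phiM ?sb0; auto; by exists h.
have pb01 : eval_at pb0 (gone o) != 0 by rewrite hpb0 // phi1.
have [|f sf [g Gg fg]] := dual_weight hG HG (emb_variety hE) (emb_base hE) (emb_stab hE) _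
    semi_pb0 G1 pb01.
- by move=> h Hh; apply: chi0; exists h.
have [f' sf' [[l Ll f'l] inv]] := invariant_semiinvariant sf Gg fg.
apply: (separates_of_weights hL hK sb0 sb chi0 b01 bK Kb _ Ll f'l).
move=> l' _ Ll' [h Hh ->].
have Gl := LGe Ll'; have Gh := HGe Hh.
have <- : phi (gmul o l' h) = gmul o l' (phi h) by rewrite phiM // (lproj_id hphi Ll').
by rewrite -inv ?sf' //; apply: GM.
Qed.

(** The weight of [H] must descend to [K]. It does because a [Gu]-invariant semi-invariant [c] of
    this weight factors through [phi], so the weight is a quotient of values of [c] on [L]. *)
Theorem observable_lift m (X : pset k m) act x : affine_embedding o L K X act x ->
  exists t (f : 'I_t -> {mpoly k[n]}), separates o G H f.
Proof.
move=> hE; have [chi [b0 [t [b [sb0 sb chi0 b01 [bH Hb]]]]]] := chevalley hG hH.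
have [c sc [[l Ll cl] inv]] := invariant_semiinvariant sb0 G1 b01.
have cphi l' h : L l' -> H h -> eval_at c (gmul o l' (phi h)) = chi h * eval_at c l'.
  move=> Ll' Hh; rewrite -sc; auto.
  have Gl := LGe Ll'; have Gh := HGe Hh.
  by rewrite [RHS]inv ?phiM ?(lproj_id hphi Ll') //; apply: GM.
pose chi' y := eval_at c (gmul o l y) / eval_at c l.
have chi'E h : H h -> chi' (phi h) = chi h by move=> Hh; rewrite /chi' cphi // mulfK.
have semi_c : semiinvariant o L K chi' c.
  by move=> l' _ Ll' [h Hh ->]; rewrite chi'E // cphi.
have [|f sf [l' Ll' fl]] := dual_weight hL K_sub (emb_variety hE) (emb_base hE)
    (emb_stab hE) _ semi_c Ll cl.
- by move=> _ [h Hh ->]; rewrite chi'E // chi0.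
have [pf hpf] := phi_poly f.
apply: (separates_of_weights hG hH sb0 sb chi0 b01 bH Hb (f := pf) _ (LGe Ll')).
  move=> g h Gg Hh; rewrite !hpf ?phiM ?sf ?chi'E; auto; by exists h.
by rewrite hpf ?(lproj_id hphi); auto.
Qed.

Lemma projection_variety m (Y : pset k m) act : affine_G_variety o L Y act ->
  affine_G_variety o G Y (fun g y => act (phi g) y).
Proof.
move=> hY; have [F hF] := lproj_regular hphi; have /regular2P[E hE] := gvar_regular hY.
split; first exact: (gvar_closed hY).
- by move=> g y Gg Yy; apply: (gvar_stable hY); auto.
- by move=> y Yy; rewrite phi1 (gvar_one hY).
- by move=> g h y Gg Gh Yy; rewrite phiM // (gvar_mul hY); auto.
apply/regular2P; exists (fun i => polycomp (E i) (fun j : 'I_(n + m) =>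
  match split j with inl j => inl_poly m (F j) | inr j => inr_poly n 'X_j end)).
move=> g y Gg Yy; rewrite hE; auto; apply/rowP => i; rewrite !mxE ev_comp.
congr (eval_at _ _); apply/rowP => j; rewrite !mxE.
by case: (split j) => j'; rewrite ?ev_inl ?ev_inr ?evX // hF // mxE.
Qed.

Lemma levi_affinely_closed : affinely_closed o G H -> affinely_closed o L K.
Proof.
move=> [[m [X [act [x [hE _]]]]] triv].
have trivK m' (Y : pset k m') act' y : affine_embedding o L K Y act' y -> trivial_embedding L Y act' y.
  move=> hE' z Yz; apply: NNPP => nz; have hY := emb_variety hE'; have Yy := emb_base hE'.
  have [f [sep _]] := embedding_separates hG HG hE.
  have orb : psubset (orbit_of L act' y) (orbit_of G (fun g => act' (phi g)) y).
    by move=> _ [l Ll ->]; exists l; [auto | rewrite (lproj_id hphi)].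
  have hz : zclosure (orbit_of G (fun g => act' (phi g)) y) z.
    apply: (emb_dense hE' (zclosure_closed _) _ Yz) => u /orb; exact: sub_zclosure.
  have nz' : ~ orbit_of G (fun g => act' (phi g)) y z.
    by move=> [g Gg e]; apply: nz; exists (phi g); auto.
  have fixH h : H h -> act' (phi h) y = y.
    by move=> Hh; apply/(emb_stab hE'); auto; exists h.
  have [m'' [X' [act'' [x' [e]]]]] :=
    degenerate_embedding hG (projection_variety hY) Yy hz nz' HG fixH sep.
  by apply; apply: triv e.
(* Since every affine embedding is trivial, the existence of one shows that the homogeneous space is
   affine. *)
split; last exact: trivK; have [t [f sep]] := observable_levi hE.
have [M [q [A [_ e _]]]] := function_embedding hL K_sub sep.
by do 4 eexists; split; [exact: e | exact: trivK e].
Qed.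

(* A nontrivial embedding X of G/H is mapped to a representation of L by the L-translates of
   a Gu-invariant function vanishing on an orbit at the boundary: this puts 0 in the closure
   of an L-orbit of a nonzero K-invariant vector. *)
Lemma lift_affinely_closed : affinely_closed o L K -> affinely_closed o G H.
Proof.
move=> [[m [Y [act [y [hE _]]]]] triv].
have trivH m' (X : pset k m') act' x : affine_embedding o G H X act' x -> trivial_embedding G X act' x.
  move=> hE' z Xz; apply: NNPP => nz; have hX := emb_variety hE'; have Xx := emb_base hE'.
  have XS := gvar_stable hX.
  have dense u : X u -> zclosure (orbit_of G act' x) u.
    by move=> Xu; apply: (emb_dense hE' (zclosure_closed _) _ Xu); exact: sub_zclosure.
  have [f0 f0z f0x] : exists2 f0, vanishes (orbit_of G act' z) f0 & eval_at f0 x != 0.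
    apply: NNPP => no; apply: nz; apply: (dense_orbits_eq hG hX Xx Xz (dense _ Xz)) => b hb.
    by apply/eqP; apply: contraT => bx; case: no; exists b.
  have [f [s [sG hs]] [[x1 Xx1 fx1] inv]] :=
    unipotent_invariant gGu (subgroup_variety hX hGu) char_k0 unip Xx f0x.
  have hXL := subgroup_variety hX (levi_subgroup hLevi).
  have [M [q [A lin]]] := linearization_exists hL hXL (fun _ : 'I_1 => f).
  (* By normality of [Gu], the translates of [f] by [L] are again [Gu]-invariant. *)
  have qu u v : Gu u -> X v -> polymap q (act' u v) = polymap q v.
    move=> Gu_u Xv; apply/rowP => i; rewrite !mxE; have [_ [l [Ll hq]]] := lin_src lin i.
    have [u' Gu_u' e] := gconj (LGe Ll) Gu_u.
    have Gl := LGe Ll; have Gu1 := GuGe Gu_u; have Gu2 := GuGe Gu_u'.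
    rewrite !hq //; auto; rewrite -(gvar_mul hX) // e (gvar_mul hX) // inv //; auto.
  have qphi g v : G g -> X v -> polymap q (act' g v) = polymap q (act' (phi g) v).
    move=> Gg Xv; have [u Gu_u e] := phi_decomposition Gg.
    have Gu1 := GuGe Gu_u; have Gp := LGe (phiL Gg).
    by rewrite [in LHS]e (gvar_mul hX) // qu //; auto.
  have [c hc] := lin_span lin ord0.
  have fz g : G g -> eval_at f (act' g z) = 0.
    move=> Gg; rewrite hs; auto; rewrite big_seq big1 // => a /sG /GuGe Ga.
    by rewrite -(gvar_mul hX) // f0z ?mulr0 //; exists (gmul o a.2 g); auto.
  have qz : polymap q z = 0.
    apply/rowP => i; rewrite !mxE; have [_ [l [Ll ->]]] := lin_src lin i; auto.
  have hV := linearization_variety lin.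
  pose B g (v : 'rV[k]_M) := v *m (evmx A g)^T.
  have orbE l : L l -> B l (polymap q x) = polymap q (act' l x).
    by move=> Ll; rewrite (linearization_map lin).
  have h0 : zclosure (orbit_of L B (polymap q x)) 0.
    move=> P hP; rewrite -qz -ev_comp; apply: dense Xz _ _ => _ [g Gg ->].
    rewrite ev_comp qphi //; apply: hP; exists (phi g); auto.
    by rewrite orbE; auto.
  have n0 : ~ orbit_of L B (polymap q x) 0.
    (* If [q] vanished at one point of the [L]-orbit of [x], it would vanish on the whole orbit,
       hence on the [G]-orbit through [phi], and [f] would be zero on [X] by density. *)
    move=> [l Ll e0]; move/eqP: fx1; apply; apply: (dense _ Xx1) => _ [g Gg ->].
    rewrite hc; auto; rewrite big1 // => i _.
    have /rowP/(_ i) : polymap q (act' g x) = 0; last by rewrite !mxE => ->; rewrite mulr0.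
    have Lg := phiL Gg.
    rewrite qphi // -(gmulgVK hL Ll Lg) (gvar_mul hX); auto.
    rewrite (linearization_map lin); auto.
    by rewrite -orbE // -e0 mul0mx.
  have fixK h : K h -> B h (polymap q x) = polymap q x.
    move=> Kh; have Lh := K_sub Kh; rewrite orbE //; case: Kh Lh => h' Hh' -> _.
    have Gh := HGe Hh'; have /(emb_stab hE' Gh) hx := Hh'.
    by rewrite -qphi // hx.
  have [fK [sep _]] := embedding_separates hL K_sub hE.
  have [m'' [X' [act'' [x' [e]]]]] := degenerate_embedding hL hV I h0 n0 K_sub fixK sep.
  by apply; apply: triv e.
split; last exact: trivH; have [t [f sep]] := observable_lift hE.
have [M [q [A [_ e _]]]] := function_embedding hG HG sep.
by do 4 eexists; split; [exact: e | exact: trivH e].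
Qed.

End Levi.

Theorem theorem2 (k : closedFieldType) (char_k0 : [pchar k] =i pred0)
    (n : nat) (o : group_ops k n) (G H L Gu : pset k n)
    (phi : 'rV[k]_n -> 'rV[k]_n)
    (hG : affine_algebraic_group o G)
    (hH : algebraic_subgroup o G H)
    (hLevi : levi_decomposition o G L Gu)
    (hphi : levi_projection o G L Gu phi) :
  affinely_closed o G H <-> affinely_closed o L (image_of phi H).
Proof.
split.
  exact: (levi_affinely_closed char_k0 hG hH hLevi hphi).
exact: (lift_affinely_closed char_k0 hG hH hLevi hphi).
Qed.
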